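(* Consider the two-form $Q=r\,dr\wedge dt$ on the $4$-dimensional Schwarzschild spacetime with $m\ge0$. Let $\Sigma$ be a closed oriented spacelike $2$-surface, with null normals $L$ (future outgoing) and $\underline L$ (future incoming), $\langle L,\underline L\rangle=-2$. Then $$2\int_\Sigma\langle\vec H,L\rangle\Big\langle\underline L,\frac{\partial}{\partial t}\Big\rangle d\mu=-16\pi m+\int_\Sigma\Big\{\Big(R+\frac14\bar R_{L\underline LL\underline L}\Big)Q(L,\underline L)+\sum_{b,c=1}^2\Big(\frac12\bar R_{bc\underline LL}-2(d\zeta_L)_{bc}\Big)Q_{bc}\Big\}d\mu .$$
   Context: The 4-dimensional Schwarzschild spacetime is the region $r>2m$ with metric $\bar g=\langle\cdot,\cdot\rangle=-\left(1-\frac{2m}{r}\right)dt^2+\frac{1}{1-\frac{2m}{r}}dr^2+r^2g_{S^2}$, with Levi-Civita connection $D$; $(dr\wedge dt)(X,Y)=dr(X)dt(Y)-dt(X)dr(Y)$. For a surface in a slice $\{t=T\}$ with outward unit normal $\nu$, $(1-\frac{2m}{r})^{-1/2}\frac{\partial}{\partial t}+\nu$ is future outgoing and $(1-\frac{2m}{r})^{-1/2}\frac{\partial}{\partial t}-\nu$ is future incoming. $\vec H$ is the mean curvature vector of $\Sigma$ (trace of $(D_XY)^\perp$), $R$ the scalar curvature of $\Sigma$, $\zeta_L(V)=\frac12\langle D_VL,\underline L\rangle$ for $V\in T\Sigma$ the connection 1-form of the normal bundle with respect to $L$. With $\{e_1,e_2\}$ a local oriented orthonormal frame of $T\Sigma$,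 $Q_{bc}=Q(e_b,e_c)$, $(d\zeta_L)_{bc}=(d\zeta_L)(e_b,e_c)$, $\bar R_{bc\underline LL}=\bar R(e_b,e_c,\underline L,L)$, $\bar R_{L\underline LL\underline L}=\bar R(L,\underline L,L,\underline L)$. $\bar R$ is the curvature tensor of $\bar g$, with sign convention such that $\bar R(X,Y,X,Y)$ is the sectional curvature for orthonormal spacelike $X,Y$ (e.g. $\bar R(E_1,E_2,E_1,E_2)=\frac{2m}{r^3}$ for orthonormal $E_1,E_2$ tangent to a sphere of symmetry).
   Formalization: For m > 0 the surface is assumed homologous to the spheres of symmetry (x/|x| has degree 1 on Σ, oriented so that L is outgoing); without this the formula fails, e.g. for a small sphere in a slice not enclosing the black hole. *)

(* Defs.v *)
From HB Require Import structures.
From mathcomp Require Import all_boot all_order all_algebra.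
From mathcomp Require Import all_classical all_reals all_analysis.

Set Implicit Arguments.
Unset Strict Implicit.
Unset Printing Implicit Defensive.

Import Order.TTheory GRing.Theory Num.Theory.
Import numFieldNormedType.Exports.

Local Open Scope classical_set_scope.
Local Open Scope ring_scope.

Section Calculus.
Context {R : realType}.

Fixpoint differentiable_upto (k : nat) (V W : normedModType R)
    (U : set V) (f : V -> W) : Prop :=
  if k is k'.+1 then
    (forall x, U x -> differentiable f x) /\
    (forall v, differentiable_upto k' U (fun x => 'D_v f x))
  else True.

(* C^oo on [U]; meant for open [U]. *)
Definition smooth_on (V W : normedModType R) (U : set V) (f : V -> W) : Prop :=
  forall k, differentiable_upto k U f.

Definition pd {n : nat} {W : normedModType R} (i : 'I_n)
    (f : 'rV[R]_n -> W) (x : 'rV[R]_n) : W :=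
  'D_(delta_mx 0 i) f x.

End Calculus.

(* Metrics on (open subsets of) R^n, given by their coefficient matrices. *)
Section Curvature.
Context {R : realType} {n : nat}.
Variable G : 'rV[R]_n -> 'M[R]_n.

Definition christoffel (k i j : 'I_n) (x : 'rV[R]_n) : R :=
  2^-1 * \sum_(l < n) invmx (G x) k l *
    (pd i (fun y => G y j l) x + pd j (fun y => G y i l) x
     - pd l (fun y => G y i j) x).

(* [riemann i j k l] is R(d_i, d_j, d_k, d_l) := < R(d_i, d_j) d_l , d_k >, where
   R(X, Y) = [D_X, D_Y] - D_[X, Y]; thus R(X, Y, X, Y) is the sectional
   curvature when X, Y are orthonormal and spacelike. *)
Definition riemann (i j k l : 'I_n) (x : 'rV[R]_n) : R :=
  \sum_(s < n) G x k s *
    (pd i (christoffel s j l) x - pd j (christoffel s i l) x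
     + \sum_(q < n) (christoffel s i q x * christoffel q j l x
                     - christoffel s j q x * christoffel q i l x)).

Definition riemann_form (x X Y Z W : 'rV[R]_n) : R :=
  \sum_(i < n) \sum_(j < n) \sum_(k < n) \sum_(l < n)
    riemann i j k l x * X 0 i * Y 0 j * Z 0 k * W 0 l.

Definition scalar_curvature (x : 'rV[R]_n) : R :=
  \sum_(a < n) \sum_(b < n) \sum_(c < n) \sum_(d < n)
    invmx (G x) a c * invmx (G x) b d * riemann a b c d x.

End Curvature.

(* The exterior Schwarzschild spacetime is R x {x in R^3 : |x| > 2m}, a single
   chart with coordinates (t, x); [p 0 0] is t. *)
Section Schwarzschild.
Context {R : realType}.
Implicit Types (m : R) (p X Y : 'rV[R]_4).

Definition space X : 'rV[R]_3 := \row_(i < 3) X 0 (lift ord0 i).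

Definition dot3 (x y : 'rV[R]_3) : R := \sum_(i < 3) x 0 i * y 0 i.

Definition rad p : R := Num.sqrt (dot3 (space p) (space p)).

Definition exterior m : set 'rV[R]_4 := [set p | 2 * m < rad p].

Definition d_t X : R := X 0 0.

Definition d_r p X : R := dot3 (space p) (space X) / rad p.

Definition partial_t : 'rV[R]_4 := delta_mx 0 0.

Definition lapse2 m p : R := 1 - 2 * m / rad p.

(* [dot3 - d_r * d_r] is r^2 g_{S^2}, as |dx|^2 = dr^2 + r^2 g_{S^2} on R^3. *)
Definition schw m p X Y : R :=
  - lapse2 m p * d_t X * d_t Y
  + (lapse2 m p)^-1 * d_r p X * d_r p Y
  + (dot3 (space X) (space Y) - d_r p X * d_r p Y).

Definition schw_mx m p : 'M[R]_4 :=
  \matrix_(i, j) schw m p (delta_mx 0 i) (delta_mx 0 j).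

Definition Rbar m p X Y Z W : R := riemann_form (schw_mx m) p X Y Z W.

(* Q = r dr /\ dt *)
Definition Qform p X Y : R := rad p * (d_r p X * d_t Y - d_t X * d_r p Y).

(* The pull-back, under p |-> x / |x|, of the area form of the unit sphere S^2
   with its outward orientation. *)
Definition solid_angle p X Y : R :=
  \det (\matrix_(i < 3) [:: space p; space X; space Y]`_i) / rad p ^+ 3.

End Schwarzschild.

(* Geometry of a spacelike patch [f : R^2 -> spacetime]; [L], [Lb] and [V] are
   vector fields along [f]. *)
Section Patch.
Context {R : realType}.
Variables (m : R) (f : 'rV[R]_2 -> 'rV[R]_4).
Implicit Types (u v w : 'rV[R]_2) (L Lb V : 'rV[R]_2 -> 'rV[R]_4).

Definition induced_mx u : 'M[R]_2 :=
  \matrix_(a, b) schw m (f u) (pd a f u) (pd b f u).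

(* D_{df(v)} V *)
Definition covd V v u : 'rV[R]_4 :=
  'D_v V u + \row_(k < 4) \sum_(i < 4) \sum_(j < 4)
    christoffel (schw_mx m) k i j (f u) * ('D_v f u) 0 i * V u 0 j.

Definition normal_part u (X : 'rV[R]_4) : 'rV[R]_4 :=
  X - \sum_(a < 2) \sum_(b < 2)
        (invmx (induced_mx u) a b * schw m (f u) X (pd a f u)) *: pd b f u.

Definition mean_curvature u : 'rV[R]_4 :=
  \sum_(a < 2) \sum_(b < 2) invmx (induced_mx u) a b *:
    normal_part u (covd (pd b f) (delta_mx 0 a) u).

Definition zeta L Lb v u : R := 2^-1 * schw m (f u) (covd L v u) (Lb u).

(* d zeta_L(v, w); there is no bracket term since the constant fields v, w on
   R^2 commute. *)
Definition dzeta L Lb v w u : R :=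
  'D_v (zeta L Lb w) u - 'D_w (zeta L Lb v) u.

End Patch.

Section Surface.
Context {R : realType}.
Variable Sigma : ptopologicalType.

(* A local parametrization; only the values of [chart_map] on [chart_dom] are
   relevant. *)
Record chart := Chart {
  chart_dom : set 'rV[R]_2 ;
  chart_map :> 'rV[R]_2 -> Sigma }.

Implicit Types (A : set chart) (c d : chart).

Definition oriented_transition c d : Prop :=
  let O := chart_dom c `&` c @^-1` (d @` chart_dom d) in
  exists tau : 'rV[R]_2 -> 'rV[R]_2,
    smooth_on O tau /\
    forall u, O u ->
      [/\ chart_dom d (tau u), d (tau u) = c u & 0 < \det ('J tau u)].

Record closed_oriented_surface A : Prop := ClosedOrientedSurface {
  surface_compact : compact [set: Sigma] ;
  surface_hausdorff : hausdorff_space Sigma ;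
  surface_cover : forall p, exists2 c, A c & (c @` chart_dom c) p ;
  chart_dom_open : forall c, A c -> open (chart_dom c) ;
  chart_inj : forall c, A c -> set_inj (chart_dom c) c ;
  chart_continuous : forall c, A c ->
    forall u, chart_dom c u -> {for u, continuous c} ;
  chart_open_map : forall c, A c ->
    forall U, open U -> U `<=` chart_dom c -> open (c @` U) ;
  surface_oriented : forall c d, A c -> A d -> oriented_transition c d }.

Definition smooth_along A (X : Sigma -> 'rV[R]_4) : Prop :=
  forall c, A c -> smooth_on (chart_dom c) (X \o c).

Variables (m : R) (A : set chart) (F : Sigma -> 'rV[R]_4).

(* The last clause forces [F] to be an immersion. *)
Definition spacelike_immersion : Prop :=
  [/\ smooth_along A F,
      forall p, exterior m (F p) &
      forall c, A c -> forall u, chart_dom c u -> forall v, v != 0 ->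
        0 < schw m (F (c u)) ('D_v (F \o c) u) ('D_v (F \o c) u)].

(* [L] is the future outgoing and [Lb] the future incoming null normal. The
   orientations of the surface and of R^4 tell the two apart: in a slice
   {t = T}, with unit normal nu such that (nu, e1, e2) is positive for positive
   (e1, e2), [L] is a positive multiple of (1 - 2m/r)^(-1/2) d/dt + nu. *)
Definition null_normals (L Lb : Sigma -> 'rV[R]_4) : Prop :=
  [/\ smooth_along A L /\ smooth_along A Lb,
      forall c, A c -> forall u, chart_dom c u -> forall v,
        schw m (F (c u)) (L (c u)) ('D_v (F \o c) u) = 0 /\
        schw m (F (c u)) (Lb (c u)) ('D_v (F \o c) u) = 0,
      forall p, [/\ schw m (F p) (L p) (L p) = 0,
                    schw m (F p) (Lb p) (Lb p) = 0 &
                    schw m (F p) (L p) (Lb p) = -2],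
      forall p, 0 < d_t (L p) /\ 0 < d_t (Lb p) &
      forall c, A c -> forall u, chart_dom c u ->
        0 < \det (\matrix_(i < 4) [:: Lb (c u); L (c u);
                    pd 0 (F \o c) u; pd 1 (F \o c) u]`_i)].

(* [e p] is a positive orthonormal basis of the tangent plane at p. No
   continuity in [p] is asked, since only pointwise values are used. *)
Definition oriented_frame (e : Sigma -> 'I_2 -> 'rV[R]_4) : Prop :=
  forall c, A c -> forall u, chart_dom c u ->
    (exists2 M : 'M[R]_2, 0 < \det M &
       forall b, e (c u) b = \sum_(a < 2) M b a *: pd a (F \o c) u) /\
    (forall b b', schw m (F (c u)) (e (c u) b) (e (c u) b') = (b == b')%:R).

(* The following objects do not depend on the parametrization; they are
   specified by their expressions in the charts. *)
Definition is_mean_curvature (H : Sigma -> 'rV[R]_4) : Prop :=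
  forall c, A c -> forall u, chart_dom c u ->
    H (c u) = mean_curvature m (F \o c) u.

Definition is_scalar_curvature (S : Sigma -> R) : Prop :=
  forall c, A c -> forall u, chart_dom c u ->
    S (c u) = scalar_curvature (induced_mx m (F \o c)) u.

Definition is_dzeta (L Lb : Sigma -> 'rV[R]_4)
    (dz : Sigma -> 'rV[R]_4 -> 'rV[R]_4 -> R) : Prop :=
  forall c, A c -> forall u, chart_dom c u -> forall v w,
    dz (c u) ('D_v (F \o c) u) ('D_w (F \o c) u)
      = dzeta m (F \o c) (L \o c) (Lb \o c) v w u.

Definition borel := g_sigma_algebraType (@open Sigma).

Definition row2 (z : R * R) : 'rV[R]_2 :=
  \row_(a < 2) if a == 0 then z.1 else z.2.

Definition is_area_measure (mu : {measure set borel -> \bar R}) : Prop :=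
  forall c, A c -> forall B : set borel, measurable B ->
    B `<=` c @` chart_dom c ->
    mu B = (\int[lebesgue_measure \x lebesgue_measure]_(z in
              [set z | chart_dom c (row2 z) /\ B (c (row2 z))])
              (Num.sqrt (\det (induced_mx m (F \o c) (row2 z))))%:E)%E.

(* The class of [F] in H_2 of the exterior region (infinite cyclic, generated by
   the outward oriented spheres of symmetry) is the degree of
   x / |x| : Sigma -> S^2, that is (4 pi)^-1 times the integral of the
   pulled-back area form. *)
Definition homologous_to_sphere (e : Sigma -> 'I_2 -> 'rV[R]_4)
    (mu : {measure set borel -> \bar R}) : Prop :=
  (4 * pi)^-1 *
    \int[mu]_(p in [set: Sigma]) solid_angle (F p) (e p 0) (e p 1) = 1.

End Surface.

(* Main.v *)
Require Import Defs.
From HB Require Import structures.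
From mathcomp Require Import all_boot all_order all_algebra.
From mathcomp Require Import all_classical all_reals all_analysis.
From mathcomp Require Import measurable_realfun ring lra.
Import Defs.

(** Let P(X, Y) = det(x, X, Y), where x is the spatial part of the base point
    and only the spatial parts of X and Y count. This two-form ([area_form]) is
    r^3 times the pulled-back area form of the unit sphere and is, up to sign,
    the Hodge dual of Q. It is a Killing-Yano form: its covariant derivative
    (D_X P)(Y, Z) = det(X, Y, Z) is totally antisymmetric
    ([is_derive_area_form]). In a null frame (L, Lb, e1, e2) duality reads
    P(e1, e2) = Q(L, Lb) / 2, P(L, Lb) = - 2 Q(e1, e2) and
    det(e1, e2, Lb) = <Lb, d/dt> ([area_form_tangent], [area_form_normal],
    [triple_tangent]).

    The formula is the integral over the surface of the exterior derivative of
    the one-form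
      omega(v) = P(D_v L, Lb) + zeta(v) P(L, Lb),
    that is, of P applied to the tangential part of D_v L and to Lb
    ([potential]). By [d_potential], d omega consists of
      - a term from the derivative of P, which gives - <H, L> <Lb, d/dt>;
      - P(R(e1, e2) L, Lb), from the commutator of second derivatives of L;
      - d zeta (e1, e2) P(L, Lb);
      - P(e1, e2) times a quadratic expression in the two null second
        fundamental forms, equal to R - 2 Rbar(e1, e2, e1, e2) by the Gauss
        equation ([gauss_equation]).
    Inserting the explicit curvature tensor ([Rbar_riem]), the curvature terms
    recombine ([curvature_charge]) and one finds ([local_identity]) that
    2 d omega is, relative to the area form, the integrand on the right of the
    formula, minus 2 <H, L> <Lb, d/dt>, minus 4 m times the solid angle form.

    Since omega does not depend on the chart ([potential_transition]), the
    integral of d omega vanishes by Stokes' theorem ([stokes]). The solid angle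
    integrates to 4 pi because the surface has degree one, whence 16 pi m.

    Stokes' theorem on the closed surface reduces to Green's formula on
    rectangles ([green_box]), that is to Fubini's theorem and the fundamental
    theorem of calculus: for a C^1 partition of unity phi_i subordinate to
    coordinate squares, d omega is the sum of the d(phi_i omega), each of which
    has integral zero. *)

Set Implicit Arguments.
Unset Strict Implicit.
Unset Printing Implicit Defensive.

Import Order.TTheory GRing.Theory Num.Theory.
Import numFieldNormedType.Exports.

Local Open Scope classical_set_scope.
Local Open Scope ring_scope.

(** * Directional derivatives *)

Section Lines.
Context {R : realType} {V : normedModType R}.

(** This reduces directional derivatives to derivatives in one variable, for
    which the mean value theorem and the chain rule are applied below. *)
Lemma is_derive_line (W : normedModType R) (f : V -> W) (u v : V) (a : R) df :
  is_derive (a *: v + u) v f df -> is_derive a 1 (fun s : R => f (s *: v + u)) df.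
Proof.
case=> fd fv.
have E : (fun h : R => h^-1 *: (((fun s : R => f (s *: v + u)) \o shift a) (h *: 1)
            - f (a *: v + u))) =
         (fun h : R => h^-1 *: ((f \o shift (a *: v + u)) (h *: v) - f (a *: v + u))).
  by apply/funext => h /=; rewrite [h *: 1]mulr1 scalerDl addrA.
by split; rewrite /derivable /derive ?E.
Qed.

Lemma is_derive_comp1 (f : V -> R) (g : R -> R) (u v : V) df dg :
  is_derive u v f df -> is_derive (f u) 1 g dg ->
  is_derive u v (g \o f) (dg * df).
Proof.
move=> Hf [gd <-].
pose l := fun s : R => f (s *: v + u).
have l0 : l 0 = f u by rewrite /l scale0r add0r.
have [ld lv] : is_derive (0 : R) 1 l df.
  by apply: (@is_derive_line _ f u v 0); rewrite scale0r add0r.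
have dl : differentiable l 0 by exact: (derivable1_diffP l 0).1 ld.
have dgg : differentiable g (l 0) by rewrite l0; exact: (derivable1_diffP g _).1 gd.
have dc : differentiable (g \o l) 0 by apply: differentiable_comp.
split.
  by apply/derivable1P; have /derivable1_diffP := dc.
have E : 'D_v (g \o f) u = 'D_1 (g \o l) 0.
  have E : (fun h : R => h^-1 *: (((g \o f) \o shift u) (h *: v) - (g \o f) u)) =
           (fun h : R => h^-1 *: (((g \o l) \o shift 0) (h *: 1) - (g \o l) 0)).
    by apply/funext => h /=; rewrite /l /= addr0 scale0r add0r [h *: 1]mulr1.
  by rewrite /derive E.
have C := derive1_comp ld (eq_ind_r (fun y => derivable g y 1) gd l0).
apply: (etrans E); apply: (etrans (esym (derive1E _ _))); apply: (etrans C).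
by rewrite 2!derive1E lv l0.
Qed.

Lemma is_derive_inv (f : V -> R) (u v : V) df :
  f u != 0 -> is_derive u v f df ->
  is_derive u v (fun x => (f x)^-1) (- df / f u ^+ 2).
Proof.
move=> f0 [fd <-]; split; first exact: derivableV.
by rewrite deriveV // mulNr scaleNr mulrC.
Qed.

Lemma is_derive_sqrt (f : V -> R) (u v : V) df :
  0 < f u -> is_derive u v f df ->
  is_derive u v (fun x => Num.sqrt (f x)) (df / (2 * Num.sqrt (f u))).
Proof.
move=> f0 Hf; rewrite mulrC.
exact: (is_derive_comp1 Hf (is_derive1_sqrt f0)).
Qed.

Lemma is_derive_coord m n (M : V -> 'M[R]_(m, n)) u v dM i j :
  is_derive u v M dM -> is_derive u v (fun x => M x i j) (dM i j).
Proof.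
case=> Md <-; split; first exact: (derivable_mxP _ _ _).1 Md i j.
by rewrite derive_mx // mxE.
Qed.

Lemma is_derive_mx m n (M : V -> 'M[R]_(m, n)) u v (dM : 'M[R]_(m, n)) :
  (forall i j, is_derive u v (fun x => M x i j) (dM i j)) -> is_derive u v M dM.
Proof.
move=> H; have Md : derivable M u v.
  by apply/derivable_mxP => i j; have [] := H i j.
split => //; rewrite derive_mx //; apply/matrixP => i j.
by rewrite mxE; have [] := H i j.
Qed.

(** The mean value theorem in the direction [v], then in the direction [w]. *)
Lemma second_difference (g : V -> R) (u v w : V) (s : R) (U : set V) :
  0 < s ->
  (forall a b, 0 <= a <= s -> 0 <= b <= s -> U (a *: v + (b *: w + u))) ->
  (forall x, U x -> derivable g x v) ->
  (forall x, U x -> derivable ('D_v g) x w) ->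
  exists a b, [/\ 0 <= a <= s, 0 <= b <= s &
    g (s *: v + (s *: w + u)) - g (s *: w + u) - (g (s *: v + u) - g u) =
    s ^+ 2 * 'D_w ('D_v g) (a *: v + (b *: w + u))].
Proof.
move=> s0 HU Hv Hw.
have ss : 0 <= s <= s by rewrite lexx ltW.
have s00 : 0 <= (0:R) <= s by rewrite lexx ltW.
pose phi := fun a : R => g (a *: v + (s *: w + u)) - g (a *: v + u).
pose dphi := fun a : R => 'D_v g (a *: v + (s *: w + u)) - 'D_v g (a *: v + u).
have Dphi a : 0 <= a <= s -> is_derive a 1 phi (dphi a).
  move=> ha; apply: is_deriveB; apply: is_derive_line; apply: derivableP; apply: Hv.
    exact: HU.
  by have := HU a 0 ha s00; rewrite scale0r add0r.
have [a ha E1] : exists2 a, a \in `]0, s[ & phi s - phi 0 = dphi a * (s - 0).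
  apply: (@MVT R phi dphi 0 s s0).
    by move=> x; rewrite in_itv /= => /andP[x0 xs]; apply: Dphi; rewrite !ltW.
  apply: derivable_within_continuous => x; rewrite in_itv /= => hx.
  by have [] := Dphi x hx.
have {}ha : 0 <= a <= s by move: ha; rewrite in_itv /= => /andP[x0 xs]; rewrite !ltW.
pose psi := fun b : R => 'D_v g (b *: w + (a *: v + u)).
pose dpsi := fun b : R => 'D_w ('D_v g) (b *: w + (a *: v + u)).
have Dpsi b : 0 <= b <= s -> is_derive b 1 psi (dpsi b).
  move=> hb; apply: (is_derive_line (f := 'D_v g)); apply: derivableP; apply: Hw.
  by rewrite addrCA; exact: HU.
have [b hb E2] : exists2 b, b \in `]0, s[ & psi s - psi 0 = dpsi b * (s - 0).
  apply: (@MVT R psi dpsi 0 s s0).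
    by move=> x; rewrite in_itv /= => /andP[x0 xs]; apply: Dpsi; rewrite !ltW.
  apply: derivable_within_continuous => x; rewrite in_itv /= => hx.
  by have [] := Dpsi x hx.
have {}hb : 0 <= b <= s by move: hb; rewrite in_itv /= => /andP[x0 xs]; rewrite !ltW.
exists a, b; split => //.
have -> : g (s *: v + (s *: w + u)) - g (s *: w + u) - (g (s *: v + u) - g u) =
    phi s - phi 0.
  by rewrite /phi scale0r !add0r; ring.
rewrite E1.
have -> : dphi a = psi s - psi 0.
  by rewrite /dphi /psi scale0r add0r (addrCA (s *: w)).
by rewrite E2 subr0 /dpsi (addrCA (b *: w)); ring.
Qed.

(** Clairaut's theorem: by [second_difference], the second difference
    quotient, which is symmetric in [v] and [w], is close to both iterated
    derivatives. *)
Lemma derive_commute (g : V -> R) (u v w : V) (U : set V) :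
  open U -> U u ->
  (forall x, U x -> derivable g x v) ->
  (forall x, U x -> derivable g x w) ->
  (forall x, U x -> derivable ('D_v g) x w) ->
  (forall x, U x -> derivable ('D_w g) x v) ->
  {for u, continuous ('D_w ('D_v g))} ->
  {for u, continuous ('D_v ('D_w g))} ->
  'D_w ('D_v g) u = 'D_v ('D_w g) u.
Proof.
move=> oU Uu gv gw gvw gwv c1 c2.
apply/eqP; rewrite -subr_eq0 -normr_le0; apply/ler_addgt0Pr => e e0; rewrite add0r.
have e20 : 0 < e / 2 by lra.
have N1 : \forall x \near u, `|'D_w ('D_v g) u - 'D_w ('D_v g) x| < e / 2.
  by move/cvgrPdist_lt : c1; apply.
have N2 : \forall x \near u, `|'D_v ('D_w g) u - 'D_v ('D_w g) x| < e / 2.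
  by move/cvgrPdist_lt : c2; apply.
have N3 : \forall x \near u, U x by apply: open_nbhs_nbhs; split.
have [d /= d0 Hd] := (nbhs_ballP _ _).1 (filterI N1 (filterI N2 N3)).
(* The parallelogram spanned by s v and s w at u stays in the ball of radius d. *)
pose s := d / (2 * (`|v| + `|w| + 1)).
have n0 : 0 < `|v| + `|w| + 1 by rewrite ltr_wpDl // addr_ge0.
have s0 : 0 < s by rewrite divr_gt0 // mulr_gt0.
have inb a b : 0 <= a <= s -> 0 <= b <= s -> ball u d (a *: v + (b *: w + u)).
  move=> /andP[a0 as_] /andP[b0 bs].
  rewrite -ball_normE /ball_ /= distrC addrA addrK.
  apply: le_lt_trans (ler_normD _ _) _; rewrite !normrZ !ger0_norm //.
  have H1 : a * `|v| <= s * `|v| by apply: ler_wpM2r.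
  have H2 : b * `|w| <= s * `|w| by apply: ler_wpM2r.
  have H3 : s * (`|v| + `|w| + 1) * 2 = d by rewrite /s; field; rewrite gt_eqF.
  nra.
have [a [b [ha hb E1]]] := second_difference s0 inb
  (fun x Hx => gv x (Hd x Hx).2.2) (fun x Hx => gvw x (Hd x Hx).2.2).
have inb' a' b' : 0 <= a' <= s -> 0 <= b' <= s -> ball u d (a' *: w + (b' *: v + u)).
  by move=> *; rewrite addrCA; exact: inb.
have [a' [b' [ha' hb' E2]]] := second_difference s0 inb'
  (fun x Hx => gw x (Hd x Hx).2.2) (fun x Hx => gwv x (Hd x Hx).2.2).
have E : 'D_w ('D_v g) (a *: v + (b *: w + u)) = 'D_v ('D_w g) (a' *: w + (b' *: v + u)).
  apply: (mulfI (x := s ^+ 2)); first by rewrite expf_neq0 // gt_eqF.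
  by apply: etrans (esym E1) _; apply: etrans E2; rewrite (addrCA (s *: w)); ring.
have [X1 _] := Hd _ (inb a b ha hb).
have [_ [X2 _]] := Hd _ (inb' a' b' ha' hb').
rewrite /= in X1 X2; rewrite E in X1.
move: X1 X2.
move: ('D_v ('D_w g) (a' *: w + (b' *: v + u))) ('D_w ('D_v g) u) ('D_v ('D_w g) u).
move=> p c c' X1 X2.
have -> : c - c' = (c - p) - (c' - p) by ring.
apply: le_trans (ler_normB _ _) _; clear -X1 X2; lra.
Qed.

End Lines.

(** * Rules of differentiation and vector algebra *)

Section DeriveRules.
Context {R : realType} {V : normedModType R}.
Implicit Types f g : V -> R.

Lemma is_derive_mulf f g u v df dg :
  is_derive u v f df -> is_derive u v g dg ->
  is_derive u v (fun x => f x * g x) (df * g u + f u * dg).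
Proof.
move=> hf hg; apply: (is_derive_eq (is_deriveM hf hg)).
by rewrite addrC [df * _]mulrC.
Qed.

Lemma is_derive_addf f g u v df dg :
  is_derive u v f df -> is_derive u v g dg ->
  is_derive u v (fun x => f x + g x) (df + dg).
Proof. by move=> hf hg; exact: (is_deriveD hf hg). Qed.

Lemma is_derive_oppf f u v df :
  is_derive u v f df -> is_derive u v (fun x => - f x) (- df).
Proof. by move=> hf; exact: (is_deriveN hf). Qed.

Lemma is_derive_constf (c : R) (u v : V) : is_derive u v (fun=> c) 0.
Proof. exact: is_derive_cst. Qed.

Lemma is_derive_expf f u v df n :
  is_derive u v f df -> is_derive u v (fun x => f x ^+ n) (n%:R * f u ^+ n.-1 * df).
Proof.
move=> hf; case: n => [|n].
  rewrite mulr0n !mul0r; exact: is_derive_cst.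
elim: n => [|n IH].
  under eq_fun do rewrite expr1.
  by rewrite expr0 !mul1r.
have -> : (fun x => f x ^+ n.+2) = (fun x => f x * f x ^+ n.+1).
  by apply/funext => x; rewrite exprS.
apply: (is_derive_eq (is_derive_mulf hf IH)).
by rewrite /= [in RHS]mulrSr exprS; ring.
Qed.

Lemma is_derive_sumf n (h : 'I_n -> V -> R) u v (dh : 'I_n -> R) :
  (forall i, is_derive u v (h i) (dh i)) ->
  is_derive u v (fun x => \sum_i h i x) (\sum_i dh i).
Proof.
move=> H; have := is_derive_sum H.
by congr (is_derive _ _ _ _); apply/funext => x; rewrite fct_sumE.
Qed.

End DeriveRules.

(** The preceding rules are stated for explicit functions [fun x => _] so that
    a formula can be differentiated by recursion on its shape; afterwards
    [is_derive_eq] brings the derivative into the desired form. *)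
Ltac derive_step :=
  match goal with
  | H : is_derive ?u ?v ?f _ |- is_derive ?u ?v ?f _ => exact H
  | |- is_derive _ _ (fun _ => ?c) _ => eapply is_derive_constf
  | |- is_derive _ _ (fun _ => _ + _) _ => eapply is_derive_addf
  | |- is_derive _ _ (fun _ => _ ^+ _) _ => eapply is_derive_expf
  | |- is_derive _ _ (fun _ => _ * _) _ => eapply is_derive_mulf
  | |- is_derive _ _ (fun _ => - _) _ => eapply is_derive_oppf
  | |- is_derive _ _ (fun _ => _ ^-1) _ => eapply is_derive_inv
  end.

Section Vectors.
Context {R : realType}.
Implicit Types (X Y Z W p : 'rV[R]_4) (x y z : 'rV[R]_3) (a b m : R).

Definition event (t : R) (x : 'rV[R]_3) : 'rV[R]_4 :=
  \row_i (if unlift ord0 i is Some j then x 0 j else t).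

Lemma d_t_event t x : d_t (event t x) = t.
Proof. by rewrite /d_t mxE unlift_none. Qed.

Lemma space_event t x : space (event t x) = x.
Proof. by apply/rowP => i; rewrite !mxE liftK. Qed.

Lemma vec4P X Y : d_t X = d_t Y -> space X = space Y -> X = Y.
Proof.
move=> h0 hs; apply/rowP => i; case: (unliftP ord0 i) => [j|] -> //.
by move/rowP: hs => /(_ j); rewrite !mxE.
Qed.

Lemma d_tD X Y : d_t (X + Y) = d_t X + d_t Y. Proof. by rewrite /d_t mxE. Qed.
Lemma d_tN X : d_t (- X) = - d_t X. Proof. by rewrite /d_t mxE. Qed.
Lemma d_tZ a X : d_t (a *: X) = a * d_t X. Proof. by rewrite /d_t mxE. Qed.
Lemma d_t0 : d_t (0 : 'rV[R]_4) = 0. Proof. by rewrite /d_t mxE. Qed.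
Lemma spaceD X Y : space (X + Y) = space X + space Y.
Proof. by apply/rowP => i; rewrite !mxE. Qed.
Lemma spaceN X : space (- X) = - space X.
Proof. by apply/rowP => i; rewrite !mxE. Qed.
Lemma spaceZ a X : space (a *: X) = a *: space X.
Proof. by apply/rowP => i; rewrite !mxE. Qed.
Lemma space0 : space (0 : 'rV[R]_4) = 0.
Proof. by apply/rowP => i; rewrite !mxE. Qed.

Lemma dot3C x y : dot3 x y = dot3 y x.
Proof. by apply: eq_bigr => i _; rewrite mulrC. Qed.
Lemma dot3Dl x y z : dot3 (x + y) z = dot3 x z + dot3 y z.
Proof. by rewrite -big_split; apply: eq_bigr => i _; rewrite mxE mulrDl. Qed.
Lemma dot3Zl a x z : dot3 (a *: x) z = a * dot3 x z.
Proof. by rewrite /dot3 mulr_sumr; apply: eq_bigr => i _; rewrite mxE mulrA. Qed.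
Lemma dot3Nl x z : dot3 (- x) z = - dot3 x z.
Proof. by rewrite -scaleN1r dot3Zl mulN1r. Qed.
Lemma dot30l z : dot3 0 z = 0 :> R.
Proof. by rewrite /dot3 big1 // => i _; rewrite mxE mul0r. Qed.
Lemma dot3Dr x y z : dot3 z (x + y) = dot3 z x + dot3 z y.
Proof. by rewrite !(dot3C z) dot3Dl. Qed.
Lemma dot3Zr a x z : dot3 z (a *: x) = a * dot3 z x.
Proof. by rewrite !(dot3C z) dot3Zl. Qed.
Lemma dot3Nr x z : dot3 z (- x) = - dot3 z x.
Proof. by rewrite !(dot3C z) dot3Nl. Qed.
Lemma dot30r z : dot3 z 0 = 0 :> R.
Proof. by rewrite dot3C dot30l. Qed.

Definition linE := (d_t_event, space_event, d_tD, d_tN, d_tZ, d_t0, spaceD, spaceN,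
  spaceZ, space0, dot3Dl, dot3Zl, dot3Nl, dot30l, dot3Dr, dot3Zr, dot3Nr, dot30r).

Lemma dot3_ge0 x : 0 <= dot3 x x.
Proof. by apply: sumr_ge0 => i _; rewrite -expr2 sqr_ge0. Qed.

Lemma sqr_rad p : dot3 (space p) (space p) = rad p ^+ 2.
Proof. by rewrite /rad sqr_sqrtr // dot3_ge0. Qed.

Lemma lapse2_neq0 m p : rad p != 0 -> rad p - 2 * m != 0 -> lapse2 m p != 0.
Proof.
move=> rn; apply: contra => /eqP E; apply/eqP; apply: (mulIf (invr_neq0 rn)).
by rewrite mulrBl mulfV // mul0r -[RHS]E.
Qed.

Lemma schwC m p X Y : schw m p X Y = schw m p Y X.
Proof. by rewrite /schw (dot3C (space X)); ring. Qed.
Lemma schwDl m p X Y Z : schw m p (X + Y) Z = schw m p X Z + schw m p Y Z.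
Proof. by rewrite /schw /d_r !linE; ring. Qed.
Lemma schwZl m p a X Z : schw m p (a *: X) Z = a * schw m p X Z.
Proof. by rewrite /schw /d_r !linE; ring. Qed.
Lemma schwNl m p X Z : schw m p (- X) Z = - schw m p X Z.
Proof. by rewrite -scaleN1r schwZl mulN1r. Qed.
Lemma schw0l m p Z : schw m p 0 Z = 0.
Proof. by rewrite -(scale0r 0) schwZl mul0r. Qed.
Lemma schwDr m p X Y Z : schw m p Z (X + Y) = schw m p Z X + schw m p Z Y.
Proof. by rewrite !(schwC m p Z) schwDl. Qed.
Lemma schwZr m p a X Z : schw m p Z (a *: X) = a * schw m p Z X.
Proof. by rewrite !(schwC m p Z) schwZl. Qed.
Lemma schwNr m p X Z : schw m p Z (- X) = - schw m p Z X.
Proof. by rewrite !(schwC m p Z) schwNl. Qed.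
Lemma schw0r m p Z : schw m p Z 0 = 0.
Proof. by rewrite schwC schw0l. Qed.
Definition schwE := (schwDl, schwZl, schwNl, schw0l, schwDr, schwZr, schwNr, schw0r).

Lemma linear_sum_coord n (W : lmodType R) (phi : 'rV[R]_n -> W) (X : 'rV[R]_n) :
  (forall a (Y Z : 'rV[R]_n), phi (a *: Y + Z) = a *: phi Y + phi Z) ->
  phi X = \sum_i X 0 i *: phi (delta_mx 0 i).
Proof.
move=> H.
have H0 : phi 0 = 0 by have := H (-1) 0 0; rewrite scaler0 addr0 scaleN1r addNr.
have HZ a (Y : 'rV[R]_n) : phi (a *: Y) = a *: phi Y by have := H a Y 0; rewrite !addr0 H0 addr0.
have HD (Y Z : 'rV[R]_n) : phi (Y + Z) = phi Y + phi Z by have := H 1 Y Z; rewrite !scale1r.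
rewrite {1}(row_sum_delta X).
rewrite (big_morph phi HD H0); apply: eq_bigr => i _; exact: HZ.
Qed.

Section Along.
Context {V : normedModType R}.
Variables (u v : V).

Lemma is_derive_d_t (X : V -> 'rV[R]_4) X' :
  is_derive u v X X' -> is_derive u v (fun q : V => d_t (X q)) (d_t X').
Proof. exact: is_derive_coord. Qed.

Lemma is_derive_dot3 (X Y : V -> 'rV[R]_4) X' Y' :
  is_derive u v X X' -> is_derive u v Y Y' ->
  is_derive u v (fun q : V => dot3 (space (X q)) (space (Y q)))
    (dot3 (space X') (space (Y u)) + dot3 (space (X u)) (space Y')).
Proof.
move=> hX hY; rewrite /dot3 -big_split /=; apply: is_derive_sumf => i.
rewrite !mxE.
under eq_fun do rewrite !mxE.
by apply: is_derive_mulf; apply: is_derive_coord.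
Qed.

Lemma is_derive_rad (f : V -> 'rV[R]_4) f' :
  0 < rad (f u) -> is_derive u v f f' ->
  is_derive u v (fun q : V => rad (f q)) (dot3 (space (f u)) (space f') / rad (f u)).
Proof.
move=> r0 hf; rewrite /rad.
apply: is_derive_eq.
  apply: is_derive_sqrt; last by apply: is_derive_dot3.
  by rewrite -sqrtr_gt0.
rewrite -/(rad (f u)) (dot3C (space f')); field.
by rewrite gt_eqF.
Qed.
End Along.
End Vectors.

(** * The Levi-Civita connection of the Schwarzschild metric *)

Section Connection.
Context {R : realType}.
Implicit Types (X Y Z W p : 'rV[R]_4) (m : R).

Definition chr_space m p Y Z : R :=
  m * (rad p - 2 * m) / rad p ^+ 4 * (d_t Y * d_t Z)
  - m / (rad p ^+ 4 * (rad p - 2 * m))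
      * (dot3 (space p) (space Y) * dot3 (space p) (space Z))
  + 2 * m / rad p ^+ 3 * (dot3 (space Y) (space Z)
      - dot3 (space p) (space Y) * dot3 (space p) (space Z) / rad p ^+ 2).

(** The Christoffel symbols as a bilinear map; see [christoffel_schw]. *)
Definition chr m p Y Z : 'rV[R]_4 :=
  event (m / (rad p ^+ 2 * (rad p - 2 * m))
           * (d_t Y * dot3 (space p) (space Z) + d_t Z * dot3 (space p) (space Y)))
        (chr_space m p Y Z *: space p).

Lemma chrC m p Y Z : chr m p Y Z = chr m p Z Y.
Proof.
apply: vec4P; rewrite !linE; first by ring.
by congr (_ *: _); rewrite /chr_space (dot3C (space Y)); ring.
Qed.

Lemma chr_linr m p a Y Y' Z : chr m p Z (a *: Y + Y') = a *: chr m p Z Y + chr m p Z Y'.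
Proof.
apply: vec4P; rewrite !linE; first by ring.
rewrite scalerA -scalerDl; congr (_ *: _); rewrite /chr_space !linE; ring.
Qed.

Lemma chr_linl m p a Y Y' Z : chr m p (a *: Y + Y') Z = a *: chr m p Y Z + chr m p Y' Z.
Proof. by rewrite !(chrC _ _ _ Z) chr_linr. Qed.

Section Along.
Context {V : normedModType R}.
Variables (u v : V) (m : R) (f : V -> 'rV[R]_4) (f' : 'rV[R]_4).
Hypotheses (r0 : 0 < rad (f u)) (w0 : 0 < rad (f u) - 2 * m)
  (hf : is_derive u v f f').

Let rn : rad (f u) != 0. Proof. by rewrite gt_eqF. Qed.
Let wn : rad (f u) - 2 * m != 0. Proof. by rewrite gt_eqF. Qed.

(** Compatibility of [chr] with the metric. As [chr] is symmetric, it is the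
    Levi-Civita connection by [christoffel_unique]. *)
Lemma is_derive_schw (Y Z : V -> 'rV[R]_4) Y' Z' :
  is_derive u v Y Y' -> is_derive u v Z Z' ->
  is_derive u v (fun q => schw m (f q) (Y q) (Z q))
   (schw m (f u) (Y' + chr m (f u) f' (Y u)) (Z u)
    + schw m (f u) (Y u) (Z' + chr m (f u) f' (Z u))).
Proof.
move=> hY hZ; rewrite /schw /d_r /lapse2.
have hr := is_derive_rad r0 hf.
have hY0 := is_derive_d_t hY; have hZ0 := is_derive_d_t hZ.
have h1 := is_derive_dot3 hf hY; have h2 := is_derive_dot3 hf hZ.
have h3 := is_derive_dot3 hY hZ.
have ln : 1 - 2 * m / rad (f u) != 0 := lapse2_neq0 rn wn.
apply: is_derive_eq; first by repeat derive_step.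
rewrite !linE /chr_space ?(dot3C (space (Y u)) (space (f u)))
  ?(dot3C (space f') (space (f u))) ?(dot3C (space f') (space (Y u)))
  ?(dot3C (space Y') (space (f u))) ?(dot3C (space Z') (space (f u)))
  ?sqr_rad.
field.
by rewrite rn wn.
Qed.

End Along.

(** The fundamental theorem of Riemannian geometry, by the Koszul formula. It
    spares computing with the inverse of the metric, and serves both for the
    spacetime ([christoffel_schw]) and for the surface
    ([christoffel_induced]). *)
Lemma christoffel_unique n (G : 'rV[R]_n -> 'M[R]_n) (A : 'I_n -> 'I_n -> 'I_n -> R) x :
  G x \in unitmx -> (forall i j, G x i j = G x j i) ->
  (forall k i j, A k i j = A k j i) ->
  (forall l i j, pd l (fun y => G y i j) x =
     \sum_k (A k l i * G x k j + A k l j * G x i k)) ->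
  forall k i j, christoffel G k i j x = A k i j.
Proof.
move=> Gu Gs As dG k i j; rewrite /christoffel.
have E l : pd i (fun y => G y j l) x + pd j (fun y => G y i l) x
   - pd l (fun y => G y i j) x = 2 * \sum_s G x l s * A s i j.
  rewrite !dG -!big_split /= -sumrN -big_split /= mulr_sumr; apply: eq_bigr => s _.
  rewrite (Gs s l) (Gs j s) (Gs i s) (As s j i) (As s l i) (As s l j); ring.
under eq_bigr => l _ do rewrite E.
have -> : \sum_(l < n) invmx (G x) k l * (2 * (\sum_s G x l s * A s i j)) =
  2 * \sum_s (\sum_l invmx (G x) k l * G x l s) * A s i j.
  rewrite mulr_sumr; under [RHS]eq_bigr => s _ do rewrite mulr_suml mulr_sumr.
  rewrite exchange_big /=; apply: eq_bigr => l _.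
  rewrite !mulr_sumr; apply: eq_bigr => s _; ring.
rewrite mulrA mulVf ?mul1r ?pnatr_eq0 //.
have D s : \sum_l invmx (G x) k l * G x l s = (k == s)%:R.
  by have := mulVmx Gu => /matrixP/(_ k s); rewrite !mxE.
under eq_bigr => s _ do rewrite D.
rewrite (bigD1 k) //= eqxx mul1r big1 ?addr0 // => s sk.
by rewrite eq_sym (negbTE sk) mul0r.
Qed.

Lemma sum_row n (phi : 'rV[R]_n -> R) (X : 'rV[R]_n) :
  (forall a (Y Z : 'rV[R]_n), phi (a *: Y + Z) = a * phi Y + phi Z) ->
  phi X = \sum_i X 0 i * phi (delta_mx 0 i).
Proof. by move=> H; rewrite (@linear_sum_coord _ _ R^o phi X H). Qed.

Lemma schw_coordl m p X j : schw m p X (delta_mx 0 j) = \sum_k X 0 k * schw_mx m p k j.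
Proof.
rewrite (@sum_row 4 (fun X => schw m p X (delta_mx 0 j))); last first.
  by move=> a Y Z; rewrite !schwE.
by apply: eq_bigr => k _; rewrite mxE.
Qed.

Lemma schw_coord m p X Y :
  schw m p X Y = \sum_i \sum_j X 0 i * Y 0 j * schw_mx m p i j.
Proof.
rewrite (@sum_row 4 (fun Y => schw m p X Y)); last first.
  by move=> a Z Z'; rewrite !schwE.
rewrite exchange_big /=; apply: eq_bigr => j _.
by rewrite schw_coordl mulr_sumr; apply: eq_bigr => k _; ring.
Qed.

Lemma schw_mx_sym m p i j : schw_mx m p i j = schw_mx m p j i.
Proof. by rewrite !mxE schwC. Qed.

Lemma rad_gt0 m p : 0 <= m -> exterior m p -> 0 < rad p.
Proof. by move=> m0; apply: le_lt_trans; rewrite mulr_ge0. Qed.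

Lemma width_gt0 m p : exterior m p -> 0 < rad p - 2 * m.
Proof. by rewrite subr_gt0. Qed.

(** The vector metrically dual to the covector with the coefficients of [X];
    it inverts the metric matrix ([schw_mx_unit]). *)
Definition sharp m p X : 'rV[R]_4 :=
  event (- (d_t X / lapse2 m p))
    (space X - (2 * m / rad p ^+ 3 * dot3 (space p) (space X)) *: space p).

Lemma schw_sharp m p X Y : 0 < rad p -> 0 < rad p - 2 * m ->
  schw m p (sharp m p X) Y = d_t X * d_t Y + dot3 (space X) (space Y).
Proof.
move=> r0 w0; have rn : rad p != 0 by rewrite gt_eqF.
have wn : rad p - 2 * m != 0 by rewrite gt_eqF.
rewrite /sharp /schw /d_r /lapse2 !linE !sqr_rad; field.
by rewrite rn wn.
Qed.

Lemma d_t_delta i : d_t (delta_mx 0 i : 'rV[R]_4) = (i == 0)%:R.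
Proof. by rewrite /d_t mxE eqxx /= eq_sym. Qed.

Lemma dot_split X Y : d_t X * d_t Y + dot3 (space X) (space Y) = \sum_i X 0 i * Y 0 i.
Proof.
rewrite big_ord_recl; congr (_ * _ + _).
by apply: eq_bigr => i _; rewrite !mxE.
Qed.

Lemma schw_mx_unit m p : 0 < rad p -> 0 < rad p - 2 * m -> schw_mx m p \in unitmx.
Proof.
move=> r0 w0.
have : (\matrix_(i, j) sharp m p (delta_mx 0 i) 0 j) *m schw_mx m p = 1%:M.
  apply/matrixP => i j; rewrite !mxE.
  under eq_bigr => k _ do rewrite mxE.
  rewrite -schw_coordl schw_sharp // dot_split (bigD1 i) //= big1.
    by rewrite !mxE !eqxx addr0 mul1r.
  by move=> k ki; rewrite mxE (negbTE ki) andbF mul0r.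
by move/mulmx1_unit => [].
Qed.

Lemma christoffel_schw m p k i j : 0 < rad p -> 0 < rad p - 2 * m ->
  christoffel (schw_mx m) k i j p = chr m p (delta_mx 0 i) (delta_mx 0 j) 0 k.
Proof.
move=> r0 w0.
apply: (@christoffel_unique 4 _ (fun k i j => chr m p (delta_mx 0 i) (delta_mx 0 j) 0 k)).
- exact: schw_mx_unit.
- by move=> *; exact: schw_mx_sym.
- by move=> *; rewrite chrC.
move=> l a b; rewrite /pd.
have -> : (fun y => schw_mx m y a b) = (fun y => schw m y (delta_mx 0 a) (delta_mx 0 b)).
  by apply/funext => y; rewrite mxE.
have [_ ->] := @is_derive_schw _ p (delta_mx 0 l) m id (delta_mx 0 l) r0 w0
   (is_derive_id _ _) (cst (delta_mx 0 a)) (cst (delta_mx 0 b)) 0 0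
   (is_derive_cst _ _ _) (is_derive_cst _ _ _).
rewrite /= !add0r schw_coordl (schwC _ _ (delta_mx 0 a)) schw_coordl -big_split /=.
by apply: eq_bigr => s _; rewrite (schw_mx_sym _ _ s a).
Qed.

Lemma christoffel_sum m p X Y : 0 < rad p -> 0 < rad p - 2 * m ->
  \row_(k < 4) \sum_(i < 4) \sum_(j < 4) christoffel (schw_mx m) k i j p * X 0 i * Y 0 j
  = chr m p X Y.
Proof.
move=> r0 w0; apply/rowP => k; rewrite mxE.
rewrite (@sum_row 4 (fun X => chr m p X Y 0 k)); last first.
  by move=> a Z Z'; rewrite chr_linl !mxE.
apply: eq_bigr => i _.
rewrite (@sum_row 4 (fun Y => chr m p (delta_mx 0 i) Y 0 k)); last first.
  by move=> a Z Z'; rewrite chr_linr !mxE.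
by rewrite mulr_sumr; apply: eq_bigr => j _; rewrite christoffel_schw //; ring.
Qed.

End Connection.

(** * The curvature of the Schwarzschild metric *)

Section Curvature.
Context {R : realType}.
Implicit Types (X Y Z W p : 'rV[R]_4) (m : R).

Definition dchr_time m p X Y Z : R :=
  let r := rad p in let w := r - 2 * m in
  let r' := dot3 (space p) (space X) / r in
  - m * r' * (2 / (r ^+ 3 * w) + 1 / (r ^+ 2 * w ^+ 2))
     * (d_t Y * dot3 (space p) (space Z) + d_t Z * dot3 (space p) (space Y))
  + m / (r ^+ 2 * w)
     * (d_t Y * dot3 (space X) (space Z) + d_t Z * dot3 (space X) (space Y)).

Definition dchr_space m p X Y Z : R :=
  let r := rad p in let w := r - 2 * m in
  let r' := dot3 (space p) (space X) / r in
  let b := dot3 (space p) (space Y) * dot3 (space p) (space Z) in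
  let b' := dot3 (space X) (space Y) * dot3 (space p) (space Z)
            + dot3 (space p) (space Y) * dot3 (space X) (space Z) in
  m * r' * (1 / r ^+ 4 - 4 * w / r ^+ 5) * (d_t Y * d_t Z)
  + m * b * r' * (4 / (r ^+ 5 * w) + 1 / (r ^+ 4 * w ^+ 2)) - m / (r ^+ 4 * w) * b'
  - 6 * m * r' / r ^+ 4 * dot3 (space Y) (space Z) + 10 * m * r' / r ^+ 6 * b
  - 2 * m / r ^+ 5 * b'.

(** The derivative of [chr] in the base point, in the direction [X]. *)
Definition dchr m p X Y Z : 'rV[R]_4 :=
  event (dchr_time m p X Y Z)
    (dchr_space m p X Y Z *: space p + chr_space m p Y Z *: space X).

Lemma is_derive_event (V : normedModType R) (u v : V) (t : V -> R) t'
    (x : V -> 'rV[R]_3) x' :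
  is_derive u v t t' -> is_derive u v x x' ->
  is_derive u v (fun q : V => event (t q) (x q)) (event t' x').
Proof.
move=> ht hx; apply: is_derive_mx => i j; rewrite /event mxE.
under eq_fun do rewrite mxE.
by case: unlift => [k|] //; apply: is_derive_coord.
Qed.

Lemma is_derive_space (V : normedModType R) (u v : V) (f : V -> 'rV[R]_4) f' :
  is_derive u v f f' -> is_derive u v (fun q : V => space (f q)) (space f').
Proof.
move=> hf; apply: is_derive_mx => i j; rewrite mxE.
under eq_fun do rewrite mxE.
exact: is_derive_coord.
Qed.

Lemma is_derive_scale3 (V : normedModType R) (u v : V) (t : V -> R) t'
    (x : V -> 'rV[R]_3) x' :
  is_derive u v t t' -> is_derive u v x x' ->
  is_derive u v (fun q : V => t q *: x q) (t' *: x u + t u *: x').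
Proof.
move=> ht hx; apply: is_derive_mx => i j; rewrite !mxE.
under eq_fun do rewrite mxE.
by apply: is_derive_mulf => //; apply: is_derive_coord.
Qed.

Section Along.
Context {V : normedModType R}.
Variables (u v : V) (m : R) (f : V -> 'rV[R]_4) (f' : 'rV[R]_4).
Hypotheses (r0 : 0 < rad (f u)) (w0 : 0 < rad (f u) - 2 * m)
  (hf : is_derive u v f f').

Let rn : rad (f u) != 0. Proof. by rewrite gt_eqF. Qed.
Let wn : rad (f u) - 2 * m != 0. Proof. by rewrite gt_eqF. Qed.

Lemma is_derive_chr (Y Z : V -> 'rV[R]_4) Y' Z' :
  is_derive u v Y Y' -> is_derive u v Z Z' ->
  is_derive u v (fun q => chr m (f q) (Y q) (Z q))
   (dchr m (f u) f' (Y u) (Z u) + chr m (f u) Y' (Z u) + chr m (f u) (Y u) Z').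
Proof.
move=> hY hZ.
have hr := is_derive_rad r0 hf.
have hY0 := is_derive_d_t hY; have hZ0 := is_derive_d_t hZ.
have h1 := is_derive_dot3 hf hY; have h2 := is_derive_dot3 hf hZ.
have h3 := is_derive_dot3 hY hZ.
have n1 : rad (f u) ^+ 2 * (rad (f u) - 2 * m) != 0 by rewrite mulf_neq0 ?expf_neq0.
have n2 : rad (f u) ^+ 4 * (rad (f u) - 2 * m) != 0 by rewrite mulf_neq0 ?expf_neq0.
have n3 n : rad (f u) ^+ n != 0 by rewrite expf_neq0.
rewrite /chr.
pose tt := fun q => m / (rad (f q) ^+ 2 * (rad (f q) - 2 * m)) *
   (d_t (Y q) * dot3 (space (f q)) (space (Z q)) + d_t (Z q) * dot3 (space (f q)) (space (Y q))).
have ht : is_derive u v tt (d_t (dchr m (f u) f' (Y u) (Z u) + chr m (f u) Y' (Z u) + chr m (f u) (Y u) Z')).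
  rewrite /tt; apply: is_derive_eq; first by repeat derive_step; exact: n1.
  rewrite !linE /dchr_time /= ?(dot3C (space (Y u)) (space (f u)))
   ?(dot3C (space f') (space (f u))) ?(dot3C (space f') (space (Y u)))
   ?(dot3C (space Y') (space (f u))) ?(dot3C (space Z') (space (f u)))
   ?sqr_rad /=.
  by field; rewrite rn wn.
pose bb := fun q => chr_space m (f q) (Y q) (Z q).
have hb : is_derive u v bb (dchr_space m (f u) f' (Y u) (Z u)
     + chr_space m (f u) Y' (Z u) + chr_space m (f u) (Y u) Z').
  rewrite /bb /chr_space; apply: is_derive_eq.
    by repeat derive_step; first [exact: n2|exact: n3].
  rewrite /dchr_space /chr_space /= ?(dot3C (space (Y u)) (space (f u)))
   ?(dot3C (space f') (space (f u))) ?(dot3C (space f') (space (Y u)))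
   ?(dot3C (space Y') (space (f u))) ?(dot3C (space Z') (space (f u)))
   ?sqr_rad /=.
  by field; rewrite rn wn.
apply: (is_derive_eq (is_derive_event ht (is_derive_scale3 hb (is_derive_space hf)))).
apply: vec4P; rewrite !linE // /bb.
move: (dchr_space _ _ _ _ _) (chr_space _ _ _ _) (chr_space _ _ _ _) (chr_space _ _ _ _).
move: (space (f u)) (space f') => x y a b c d.
by apply/rowP => k; rewrite !mxE; ring.
Qed.

End Along.

(** The curvature R(X, Y) W of the connection [chr], for constant [X], [Y]. *)
Definition curv m p X Y W : 'rV[R]_4 :=
  dchr m p X Y W - dchr m p Y X W + chr m p X (chr m p Y W) - chr m p Y (chr m p X W).

(** This is r^2 g_{S^2}. *)
Definition ang p X Y : R := dot3 (space X) (space Y) - d_r p X * d_r p Y.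

Definition drdt p X Y : R := d_r p X * d_t Y - d_t X * d_r p Y.

Definition curvature_radial m p X Y W : R :=
  - 3 * drdt p X Y * d_t W * lapse2 m p / rad p
  - 3 * (ang p Y W * d_r p X - ang p X W * d_r p Y) / rad p.

(** Substitution of the formulas for [chr] and [dchr]. The right-hand side only
    involves the metric, dr /\ dt and r^2 g_{S^2}, which is what makes its
    contractions in [schw_curv] and [area_form_curv] short. *)
Lemma curvE m p X Y W : 0 < rad p -> 0 < rad p - 2 * m ->
  curv m p X Y W = (m / rad p ^+ 3) *:
   event (- (schw m p Y W * d_t X - schw m p X W * d_t Y)
            - 3 * drdt p X Y * d_r p W / lapse2 m p)
     ((3 * ang p Y W - schw m p Y W) *: space X - (3 * ang p X W - schw m p X W) *: space Y
       + curvature_radial m p X Y W *: space p).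
Proof.
move=> r0 w0; have rn : rad p != 0 by rewrite gt_eqF.
have wn : rad p - 2 * m != 0 by rewrite gt_eqF.
have ln : 1 - 2 * m / rad p != 0 := lapse2_neq0 rn wn.
rewrite /curv; apply: vec4P; rewrite !linE.
  rewrite /dchr_time /chr_space /schw /ang /drdt /d_r /lapse2 /= ?linE ?sqr_rad.
  rewrite ?(dot3C (space Y) (space X)) ?(dot3C (space Y) (space p)) ?(dot3C (space X) (space p)).
  by field; rewrite rn wn.
have E1 A B : chr_space m p A B = m / rad p ^+ 3 * (3 * ang p A B - schw m p A B).
  rewrite /chr_space /schw /ang /d_r /lapse2; field; by rewrite rn wn.
have E2 : dchr_space m p X Y W - dchr_space m p Y X W + chr_space m p X (chr m p Y W)
   - chr_space m p Y (chr m p X W) = m / rad p ^+ 3 * curvature_radial m p X Y W.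
  rewrite /dchr_space /curvature_radial /chr_space ?linE /chr_space /schw /ang /drdt /d_r /lapse2 /= ?linE ?sqr_rad.
  rewrite ?(dot3C (space Y) (space X)) ?(dot3C (space Y) (space p)) ?(dot3C (space X) (space p)).
  by field; rewrite rn wn.
rewrite (E1 Y W) (E1 X W); move: E2.
move: (dchr_space m p X Y W) => a; move: (dchr_space m p Y X W) => b.
move: (chr_space m p X (chr m p Y W)) => c; move: (chr_space m p Y (chr m p X W)) => d.
move=> E2; apply/rowP => k; rewrite !mxE.
have := congr1 (fun z => z * p 0 (lift ord0 k)) E2.
move: (3 * _ - _) (3 * _ - _) => h g /=.
move: (m / _) (curvature_radial m p X Y W) => z t E3.
transitivity (z * g * X 0 (lift ord0 k) - z * h * Y 0 (lift ord0 k) +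
   (a - b + c - d) * p 0 (lift ord0 k)).
  by ring.
by rewrite E3; ring.
Qed.

End Curvature.

Section Riemann.
Context {R : realType}.
Implicit Types (X Y Z W p : 'rV[R]_4) (m : R).

Lemma rad_continuous : continuous (@rad R).
Proof.
move=> p; rewrite /rad.
apply: (@continuous_comp _ _ _ (fun p : 'rV[R]_4 => dot3 (space p) (space p))
  (@Num.sqrt R)); last exact: sqrt_continuous.
have c i : {for p, continuous (fun p : 'rV[R]_4 => p 0 i)}.
  exact: coord_continuous.
have -> : (fun p : 'rV[R]_4 => dot3 (space p) (space p)) =
   (fun p => p 0 1 * p 0 1 + (p 0 2 * p 0 2 + p 0 3 * p 0 3)).
  apply/funext => q; rewrite /dot3 !big_ord_recl big_ord0 addr0 !mxE.
  by congr (q 0 _ * q 0 _ + (q 0 _ * q 0 _ + q 0 _ * q 0 _)); apply: val_inj.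
by apply: continuousD; [|apply: continuousD]; apply: continuousM; exact: c.
Qed.

Lemma near_exterior m p : 0 < rad p -> 0 < rad p - 2 * m ->
  \forall q \near p, 0 < rad q /\ 0 < rad q - 2 * m.
Proof.
move=> r0 w0; have c := @rad_continuous p.
have H1 : \forall q \near p, 0 < rad q by move/cvgr_gt : c; apply.
have H2 : \forall q \near p, 2 * m < rad q.
  by move/cvgr_gt : c; apply; rewrite -subr_gt0.
by near=> q; split; [near: q|rewrite subr_gt0; near: q].
Unshelve. all: by end_near. Qed.

(** The curvature tensor in closed form; see [Rbar_riem]. *)
Definition riem m p X Y Z W : R :=
  m / rad p ^+ 3 * (
    - (schw m p X Z * schw m p Y W - schw m p X W * schw m p Y Z)
    - 3 * drdt p X Y * drdt p Z W
    + 3 * (ang p X Z * ang p Y W - ang p X W * ang p Y Z)).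

Lemma schw_curv m p X Y Z W : 0 < rad p -> 0 < rad p - 2 * m ->
  schw m p Z (curv m p X Y W) = riem m p X Y Z W.
Proof.
move=> r0 w0; have rn : rad p != 0 by rewrite gt_eqF.
have wn : rad p - 2 * m != 0 by rewrite gt_eqF.
have ln : lapse2 m p != 0 := lapse2_neq0 rn wn.
rewrite curvE // schwE /riem; congr (_ * _).
rewrite [schw m p X Z]/schw [schw m p Y Z]/schw /schw /d_r /curvature_radial !linE.
move: (schw m p Y W) (schw m p X W) => g h.
rewrite /ang /drdt /d_r ?sqr_rad.
rewrite ?(dot3C (space Y) (space p)) ?(dot3C (space X) (space p)) ?(dot3C (space Z) (space p))
  ?(dot3C (space Z) (space X)) ?(dot3C (space Z) (space Y)).
move: ln; move: (lapse2 m p) => l ln.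
by field; rewrite rn ln.
Qed.

Lemma pd_christoffel m p i s j l : 0 < rad p -> 0 < rad p - 2 * m ->
  pd i (christoffel (schw_mx m) s j l) p
  = dchr m p (delta_mx 0 i) (delta_mx 0 j) (delta_mx 0 l) 0 s.
Proof.
move=> r0 w0; rewrite /pd.
have D := @is_derive_chr _ _ p (delta_mx 0 i) m id (delta_mx 0 i) r0 w0
   (is_derive_id _ _) (cst (delta_mx 0 j)) (cst (delta_mx 0 l)) 0 0
   (is_derive_cst _ _ _) (is_derive_cst _ _ _).
have E0 Y : chr m p 0 Y = 0.
  by have := chr_linl m p (-1) 0 0 Y; rewrite scaler0 addr0 scaleN1r addNr.
have E : dchr m (id p) (delta_mx 0 i) (cst (delta_mx 0 j) p) (cst (delta_mx 0 l) p)
   + chr m (id p) 0 (cst (delta_mx 0 l) p) + chr m (id p) (cst (delta_mx 0 j) p) 0 =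
   dchr m p (delta_mx 0 i) (delta_mx 0 j) (delta_mx 0 l).
  by rewrite /cst /= E0 chrC E0 !addr0.
rewrite E in D.
have [_ <-] := is_derive_coord 0 s D.
apply: near_eq_derive; near=> q; rewrite /cst /=; apply: christoffel_schw.
- by have [] : 0 < rad q /\ 0 < rad q - 2 * m by near: q; exact: near_exterior.
- by have [] : 0 < rad q /\ 0 < rad q - 2 * m by near: q; exact: near_exterior.
Unshelve. all: by end_near. Qed.

Lemma riemann_schw m p i j k l : 0 < rad p -> 0 < rad p - 2 * m ->
  riemann (schw_mx m) i j k l p
  = riem m p (delta_mx 0 i) (delta_mx 0 j) (delta_mx 0 k) (delta_mx 0 l).
Proof.
move=> r0 w0; rewrite -schw_curv // schwC schw_coordl /riemann.
apply: eq_bigr => s _; rewrite schw_mx_sym mulrC; congr (_ * _).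
rewrite !pd_christoffel // /curv !mxE -!addrA; congr (_ + (_ + _)).
have H (c a b : 'I_4) : \sum_(q < 4) christoffel (schw_mx m) s c q p * christoffel (schw_mx m) q a b p
   = chr m p (delta_mx 0 c) (chr m p (delta_mx 0 a) (delta_mx 0 b)) 0 s.
  rewrite (@sum_row R 4 (fun Y => chr m p (delta_mx 0 c) Y 0 s)).
    by apply: eq_bigr => q _; rewrite !christoffel_schw // mulrC.
  by move=> z Y Y'; rewrite chr_linr !mxE.
by rewrite big_split /= sumrN !H /chr !mxE.
Qed.

Lemma angC p X Y : ang p X Y = ang p Y X.
Proof. by rewrite /ang (dot3C (space X)) mulrC. Qed.

Lemma riem_multilinear m p a X X' Y Z W :
 [/\ riem m p (a *: X + X') Y Z W = a * riem m p X Y Z W + riem m p X' Y Z W,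
     riem m p Y (a *: X + X') Z W = a * riem m p Y X Z W + riem m p Y X' Z W,
     riem m p Y Z (a *: X + X') W = a * riem m p Y Z X W + riem m p Y Z X' W &
     riem m p Y Z W (a *: X + X') = a * riem m p Y Z W X + riem m p Y Z W X'].
Proof. by split; rewrite /riem !schwE /ang /drdt /d_r !linE; ring. Qed.

Lemma Rbar_riem m p X Y Z W : 0 < rad p -> 0 < rad p - 2 * m ->
  Rbar m p X Y Z W = riem m p X Y Z W.
Proof.
move=> r0 w0; rewrite /Rbar /riemann_form.
rewrite (@sum_row R 4 (fun X => riem m p X Y Z W)); last first.
  by move=> a A B; have [] := riem_multilinear m p a A B Y Z W.
apply: eq_bigr => i _.
rewrite (@sum_row R 4 (fun Y => riem m p (delta_mx 0 i) Y Z W)); last first.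
  by move=> a A B; have [] := riem_multilinear m p a A B (delta_mx 0 i) Z W.
rewrite mulr_sumr; apply: eq_bigr => j _.
rewrite (@sum_row R 4 (fun Z => riem m p (delta_mx 0 i) (delta_mx 0 j) Z W)); last first.
  by move=> a A B; have [] := riem_multilinear m p a A B (delta_mx 0 i) (delta_mx 0 j) W.
rewrite !mulr_sumr; apply: eq_bigr => k _.
rewrite (@sum_row R 4 (fun W => riem m p (delta_mx 0 i) (delta_mx 0 j) (delta_mx 0 k) W)); last first.
  by move=> a A B; have [] := riem_multilinear m p a A B (delta_mx 0 i) (delta_mx 0 j) (delta_mx 0 k).
rewrite !mulr_sumr; apply: eq_bigr => l _.
by rewrite riemann_schw //; ring.
Qed.

End Riemann.

(** * Determinants *)

Section Determinants.
Context {R : comPzRingType}.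

(** Replaces ordinal indices by numbers, on which cofactor expansions compute. *)
Lemma det_nat n (M : 'M[R]_n.+1) : exists m : nat -> nat -> R, forall i j, M i j = m i j.
Proof. by exists (fun i j => M (inord i) (inord j)) => i j; rewrite !inord_val. Qed.

Lemma det22 (M : 'M[R]_2) : \det M = M 0 0 * M 1 1 - M 0 1 * M 1 0.
Proof.
rewrite (expand_det_row _ ord0) !big_ord_recl big_ord0 /cofactor !det_mx11 !mxE /=.
have [m E] := det_nat M; rewrite !E /= /bump /=; ring.
Qed.

Lemma det33 (M : 'M[R]_3) : \det M =
  M 0 0 * (M 1 1 * M 2 2 - M 1 2 * M 2 1) - M 0 1 * (M 1 0 * M 2 2 - M 1 2 * M 2 0)
  + M 0 2 * (M 1 0 * M 2 1 - M 1 1 * M 2 0).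
Proof.
rewrite (expand_det_row _ ord0) !big_ord_recl big_ord0 /cofactor !det22 !mxE /=.
have [m E] := det_nat M; rewrite !E /= /bump /=; ring.
Qed.

Lemma det44 (M : 'M[R]_4) : \det M =
  let d a b c := M 1 a * (M 2 b * M 3 c - M 2 c * M 3 b)
    - M 1 b * (M 2 a * M 3 c - M 2 c * M 3 a) + M 1 c * (M 2 a * M 3 b - M 2 b * M 3 a) in
  M 0 0 * d 1 2 3 - M 0 1 * d 0 2 3 + M 0 2 * d 0 1 3 - M 0 3 * d 0 1 2.
Proof.
rewrite (expand_det_row _ ord0) !big_ord_recl big_ord0 /cofactor !det33 !mxE /=.
have [m E] := det_nat M; rewrite !E /= /bump /=; ring.
Qed.

End Determinants.

Lemma invmx_entry (R : comUnitRingType) (A : 'M[R]_2) i j : A \in unitmx ->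
  invmx A i j = (\det A)^-1 * ((-1) ^+ (j + i) * A (lift j 0) (lift i 0)).
Proof.
by move=> Au; rewrite /invmx Au !mxE /cofactor det_mx11 !mxE.
Qed.

Section NullFrame.
Context {R : realType}.
Implicit Types (X Y Z W p L Lb : 'rV[R]_4) (x y z : 'rV[R]_3) (m : R).

Definition triple x y z : R :=
  x 0 0 * (y 0 1 * z 0 2 - y 0 2 * z 0 1) - x 0 1 * (y 0 0 * z 0 2 - y 0 2 * z 0 0)
  + x 0 2 * (y 0 0 * z 0 1 - y 0 1 * z 0 0).

(** The metric volume form, as the metric has determinant -1 in these
    coordinates ([det_schw_mx]). *)
Definition vol X Y Z W : R :=
  d_t X * triple (space Y) (space Z) (space W)
  - d_t Y * triple (space X) (space Z) (space W)
  + d_t Z * triple (space X) (space Y) (space W)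
  - d_t W * triple (space X) (space Y) (space Z).

(** The Killing-Yano form dual to Q. *)
Definition area_form p X Y : R := triple (space p) (space X) (space Y).

Lemma det_triple x y z : \det (\matrix_(i < 3) [:: x; y; z]`_i) = triple x y z.
Proof. by rewrite det33 !mxE. Qed.

Lemma space_coord X : [/\ space X 0 0 = X 0 1, space X 0 1 = X 0 2 & space X 0 2 = X 0 3].
Proof. by split; rewrite mxE; congr (X 0 _); apply: val_inj. Qed.

Lemma det_vol X Y Z W : \det (\matrix_(i < 4) [:: X; Y; Z; W]`_i) = vol X Y Z W.
Proof.
have E (i j : 'I_4) : (\matrix_(i < 4) [:: X; Y; Z; W]`_i) i j = ([:: X; Y; Z; W]`_i) 0 j.
  by rewrite mxE.
rewrite det44 /= !E /= /vol /triple /d_t.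
have [-> -> ->] := space_coord X; have [-> -> ->] := space_coord Y.
have [-> -> ->] := space_coord Z; have [-> -> ->] := space_coord W.
ring.
Qed.

Lemma dot3E x y : dot3 x y = x 0 0 * y 0 0 + x 0 1 * y 0 1 + x 0 2 * y 0 2.
Proof.
rewrite /dot3 !big_ord_recl big_ord0 addr0 addrA.
by congr (x 0 _ * y 0 _ + x 0 _ * y 0 _ + x 0 _ * y 0 _); apply: val_inj.
Qed.

Lemma det_schw_mx m p : 0 < rad p -> 0 < rad p - 2 * m -> \det (schw_mx m p) = -1.
Proof.
move=> r0 w0; have rn : rad p != 0 by rewrite gt_eqF.
have wn : rad p - 2 * m != 0 by rewrite gt_eqF.
have t i : d_t (delta_mx 0 i : 'rV[R]_4) = (i == 0)%:R by exact: d_t_delta.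
have s (i : 'I_4) (k : 'I_3) : (space (delta_mx 0 i : 'rV[R]_4)) 0 k = (lift ord0 k == i)%:R.
  by rewrite !mxE.
have E := sqr_rad p; rewrite dot3E in E.
rewrite det44 /= !mxE /schw /d_r /lapse2 !dot3E !t !s /=.
have {}E : (space p) 0 0 ^+ 2 = rad p ^+ 2 - (space p) 0 1 ^+ 2 - (space p) 0 2 ^+ 2.
  by rewrite -E; ring.
move: E rn wn; move: (rad p) (space p 0 0) (space p 0 1) (space p 0 2).
move=> r a b c E rn wn.
have ln : 1 - 2 * m / r != 0.
  apply: contra wn => /eqP E1; apply/eqP; apply: (mulIf (invr_neq0 rn)).
  by rewrite mulrBl mulfV // E1 mul0r.
move: ln; move: (1 - 2 * m / r) => l ln.
rewrite !(mulr0, mul0r, mulr1, mul1r, addr0, add0r, subr0, sub0r, oppr0).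
by field: E; rewrite rn ln.
Qed.

Lemma tripleDl x y z z' : triple (x + y) z z' = triple x z z' + triple y z z'.
Proof. by rewrite /triple !mxE; ring. Qed.
Lemma tripleZl (a : R) x z z' : triple (a *: x) z z' = a * triple x z z'.
Proof. by rewrite /triple !mxE; ring. Qed.
Lemma triplexx x y : triple x x y = 0.
Proof. by rewrite /triple; ring. Qed.
Lemma tripleDm x y z z' : triple z (x + y) z' = triple z x z' + triple z y z'.
Proof. by rewrite /triple !mxE; ring. Qed.
Lemma tripleZm (a : R) x z z' : triple z (a *: x) z' = a * triple z x z'.
Proof. by rewrite /triple !mxE; ring. Qed.
Lemma tripleDr x y z z' : triple z z' (x + y) = triple z z' x + triple z z' y.
Proof. by rewrite /triple !mxE; ring. Qed.
Lemma tripleZr (a : R) x z z' : triple z z' (a *: x) = a * triple z z' x.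
Proof. by rewrite /triple !mxE; ring. Qed.

Lemma volDl (a b : R) X Y Z W A : vol (a *: X + b *: Y) A Z W = a * vol X A Z W + b * vol Y A Z W.
Proof. by rewrite /vol !linE !tripleDl !tripleZl; ring. Qed.

Lemma vol_swap12 X Y Z W : vol X Y Z W = - vol Y X Z W.
Proof. by rewrite /vol /triple; ring. Qed.
Lemma vol_swap23 X Y Z W : vol X Y Z W = - vol X Z Y W.
Proof. by rewrite /vol /triple; ring. Qed.
Lemma vol_swap34 X Y Z W : vol X Y Z W = - vol X Y W Z.
Proof. by rewrite /vol /triple; ring. Qed.

Lemma vol_swap_pairs X Y Z W : vol X Y Z W = vol Z W X Y.
Proof. by rewrite /vol /triple; ring. Qed.

Lemma vol_pair (a b c d a' b' c' d' : R) X Y Z W :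
  vol (a *: X + b *: Y + c *: Z + d *: W) (a' *: X + b' *: Y + c' *: Z + d' *: W) Z W
  = (a * b' - a' * b) * vol X Y Z W.
Proof.
have xx (A B C : 'rV[R]_4) : vol A A B C = 0 by have := vol_swap12 A A B C; lra.
have xz (A B C : 'rV[R]_4) : vol A B B C = 0 by have := vol_swap23 A B B C; lra.
have xw (A B C : 'rV[R]_4) : vol A B C B = 0 by rewrite vol_swap34 xz oppr0.
have split4 (e f g h : R) (A : 'rV[R]_4) : vol (e *: X + f *: Y + g *: Z + h *: W) A Z W =
   e * vol X A Z W + f * vol Y A Z W + g * vol Z A Z W + h * vol W A Z W.
  have -> : e *: X + f *: Y + g *: Z + h *: W =
    1 *: (e *: X + f *: Y) + 1 *: (g *: Z + h *: W) by rewrite !scale1r addrA.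
  by rewrite volDl !mul1r !volDl; ring.
have zz (A : 'rV[R]_4) : vol Z A Z W = 0 by rewrite vol_swap12 xz oppr0.
have ww (A : 'rV[R]_4) : vol W A Z W = 0 by rewrite vol_swap12 xw oppr0.
rewrite split4 // zz ww !(vol_swap12 _ (_ + _)) !split4 // !zz !ww !xx (vol_swap12 Y X).
ring.
Qed.

End NullFrame.

(** * Duality in a null frame *)

Section NullFrameAlgebra.
Context {R : realType}.
Implicit Types (X Y Z W p L Lb : 'rV[R]_4) (x y z : 'rV[R]_3) (m : R).

Record null_frame m p L Lb e1 e2 : Prop := NullFrame {
  frame_LL : schw m p L L = 0;
  frame_BB : schw m p Lb Lb = 0;
  frame_LB : schw m p L Lb = -2;
  frame_L1 : schw m p L e1 = 0;
  frame_L2 : schw m p L e2 = 0;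
  frame_B1 : schw m p Lb e1 = 0;
  frame_B2 : schw m p Lb e2 = 0;
  frame_11 : schw m p e1 e1 = 1;
  frame_22 : schw m p e2 e2 = 1;
  frame_12 : schw m p e1 e2 = 0;
  frame_pos : 0 < vol Lb L e1 e2 }.

Section Frame.
Variables (m : R) (p L Lb e1 e2 : 'rV[R]_4).
Hypotheses (r0 : 0 < rad p) (w0 : 0 < rad p - 2 * m) (fr : null_frame m p L Lb e1 e2).

Let rn : rad p != 0. Proof. by rewrite gt_eqF. Qed.
Let wn : rad p - 2 * m != 0. Proof. by rewrite gt_eqF. Qed.
Let ln : lapse2 m p != 0 := lapse2_neq0 rn wn.

Let E : 'M[R]_4 := \matrix_(i < 4) [:: Lb; L; e1; e2]`_i.

Lemma schw_mulmx X Y : schw m p X Y = (X *m schw_mx m p *m Y^T) 0 0.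
Proof.
rewrite schw_coord exchange_big mxE; apply: eq_bigr => j _.
rewrite !mxE mulr_suml; apply: eq_bigr => i _; rewrite !mxE; ring.
Qed.

Lemma schw_rowE X j : (X *m schw_mx m p *m E^T) 0 j = schw m p X ([:: Lb; L; e1; e2]`_j).
Proof.
rewrite schw_mulmx !mxE; apply: eq_bigr => k _; congr (_ * _).
by rewrite !mxE.
Qed.

(** The Gram determinant of the frame, which is minus the square of its volume,
    equals -4; the orientation determines the sign. *)
Lemma frame_vol : vol Lb L e1 e2 = 2.
Proof.
have V0 := frame_pos fr.
have H : \det (E *m schw_mx m p *m E^T) = -4.
  have C i j : (E *m schw_mx m p *m E^T) i j =
     schw m p ([:: Lb; L; e1; e2]`_i) ([:: Lb; L; e1; e2]`_j).
    rewrite -schw_rowE -[in RHS](_ : row i E = [:: Lb; L; e1; e2]`_i).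
      by rewrite -!row_mul [RHS]mxE.
    by apply/rowP => k; rewrite !mxE.
  rewrite det44 /= !C /= !(schwC m p e1 Lb, schwC m p e1 L, schwC m p e2 Lb,
    schwC m p e2 L, schwC m p e2 e1, schwC m p Lb L).
  rewrite (frame_LL fr) (frame_BB fr) (frame_LB fr) (frame_L1 fr) (frame_L2 fr)
   (frame_B1 fr) (frame_B2 fr) (frame_11 fr) (frame_22 fr) (frame_12 fr).
  ring.
rewrite !det_mulmx det_tr det_schw_mx // det_vol in H.
have : (vol Lb L e1 e2 - 2) * (vol Lb L e1 e2 + 2) = 0.
  transitivity (- (vol Lb L e1 e2 * -1 * vol Lb L e1 e2) - 4); first by ring.
  by rewrite H; ring.
move/eqP; rewrite mulf_eq0 => /orP[/eqP|/eqP] H2; lra.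
Qed.

(** The difference of the two sides is orthogonal to the four frame vectors,
    which span. *)
Lemma frame_decomposition X : X = (- 2^-1 * schw m p X Lb) *: L + (- 2^-1 * schw m p X L) *: Lb
   + schw m p X e1 *: e1 + schw m p X e2 *: e2.
Proof.
set Y := (RHS); apply/eqP; rewrite -subr_eq0; apply/eqP.
have Eu : E^T \in unitmx.
  by rewrite unitmx_tr unitmxE det_vol frame_vol unitfE pnatr_eq0.
have gu := schw_mx_unit r0 w0.
suff H : (X - Y) *m schw_mx m p *m E^T = 0.
  by have := mulmxK Eu ((X - Y) *m schw_mx m p); rewrite H mul0mx => H2;
     have := mulmxK gu (X - Y); rewrite -H2 mul0mx.
apply/rowP => j; rewrite schw_rowE mxE /Y.
rewrite !schwE.
case: j => [[|[|[|[|//]]]] /= _];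
 rewrite ?(schwC m p e1 Lb) ?(schwC m p e1 L) ?(schwC m p e2 Lb) ?(schwC m p e2 L)
   ?(schwC m p e2 e1) ?(schwC m p Lb L)
   ?(frame_LL fr) ?(frame_BB fr) ?(frame_LB fr) ?(frame_L1 fr) ?(frame_L2 fr)
   ?(frame_B1 fr) ?(frame_B2 fr) ?(frame_11 fr) ?(frame_22 fr) ?(frame_12 fr); lra.
Qed.

Let pos := event 0 (space p).

(** P is the contraction of the volume form with d/dt and with the position
    vector. Their metric duals are multiples of dt and dr ([schw_partial_t],
    [schw_pos]); this is the duality between P and Q. *)
Lemma area_form_vol X Y : area_form p X Y = vol partial_t pos X Y.
Proof.
have -> : partial_t = event 1 0 :> 'rV[R]_4.
  apply/rowP => i; rewrite !mxE; case: unliftP => [j|] ->; rewrite ?mxE //.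
rewrite /area_form /vol /pos !linE.
by rewrite /triple !mxE; ring.
Qed.

Lemma triple_vol X Y Z : triple (space X) (space Y) (space Z) = vol partial_t X Y Z.
Proof.
have -> : partial_t = event 1 0 :> 'rV[R]_4.
  apply/rowP => i; rewrite !mxE; case: unliftP => [j|] ->; rewrite ?mxE //.
by rewrite /vol !linE /triple !mxE; ring.
Qed.

Lemma schw_partial_t X : schw m p partial_t X = - lapse2 m p * d_t X.
Proof.
have -> : partial_t = event 1 0 :> 'rV[R]_4.
  apply/rowP => i; rewrite !mxE; case: unliftP => [j|] ->; rewrite ?mxE //.
by rewrite /schw /d_r !linE; ring.
Qed.

Lemma schw_pos X : schw m p pos X = rad p / lapse2 m p * d_r p X.
Proof.
by rewrite /schw /d_r /pos !linE sqr_rad; field; rewrite rn ln.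
Qed.

(** Only the components of d/dt and of the position along [L] and [Lb]
    contribute to the volume. *)
Lemma area_form_tangent : area_form p e1 e2 = 2^-1 * Qform p L Lb.
Proof.
rewrite area_form_vol (frame_decomposition partial_t) (frame_decomposition pos).
rewrite vol_pair (vol_swap12 L) frame_vol !schw_partial_t !schw_pos /Qform.
by field; exact: ln.
Qed.

Lemma area_form_normal : area_form p L Lb = - 2 * Qform p e1 e2.
Proof.
have re a b c d : a *: L + b *: Lb + c *: e1 + d *: e2 = c *: e1 + d *: e2 + a *: L + b *: Lb.
  by rewrite -addrA addrC !addrA.
rewrite area_form_vol (frame_decomposition partial_t) (frame_decomposition pos) !re.
rewrite vol_pair vol_swap_pairs (vol_swap12 L) frame_vol !schw_partial_t !schw_pos /Qform.
by field; exact: ln.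
Qed.

Lemma triple_tangent : triple (space e1) (space e2) (space Lb) = schw m p Lb partial_t.
Proof.
have re a b c d : a *: L + b *: Lb + c *: e1 + d *: e2 =
   1 *: (a *: L + b *: Lb) + 1 *: (c *: e1 + d *: e2) by rewrite !scale1r addrA.
rewrite triple_vol [in LHS](frame_decomposition partial_t) re volDl !volDl.
have -> : vol L e1 e2 Lb = - vol Lb L e1 e2 by rewrite /vol /triple; ring.
have -> : vol Lb e1 e2 Lb = 0 by rewrite /vol /triple; ring.
have -> : vol e1 e1 e2 Lb = 0 by rewrite /vol /triple; ring.
have -> : vol e2 e1 e2 Lb = 0 by rewrite /vol /triple; ring.
by rewrite frame_vol (schwC m p partial_t); field.
Qed.

(** Gram's identity in the plane orthogonal to the position vector. *)
Lemma area_form_gram X Y Z W : area_form p X Y * area_form p Z W =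
  rad p ^+ 2 * (ang p X Z * ang p Y W - ang p X W * ang p Y Z).
Proof.
rewrite /ang /d_r /area_form /triple !dot3E.
have := sqr_rad p; rewrite dot3E => H.
have {}H : (space p) 0 0 ^+ 2 = rad p ^+ 2 - (space p) 0 1 ^+ 2 - (space p) 0 2 ^+ 2.
  by rewrite -H; ring.
by field: H; exact: rn.
Qed.

(** Gram's identity in the Lorentzian (t, r)-plane, with metric [schw - ang]. *)
Lemma drdt_gram X Y : drdt p X Y ^+ 2 =
  (schw m p X Y - ang p X Y) ^+ 2 - (schw m p X X - ang p X X) * (schw m p Y Y - ang p Y Y).
Proof. by rewrite /drdt /schw /ang; field; exact: ln. Qed.

(** Three vectors of the plane orthogonal to the position are linearly
    dependent. *)
Lemma area_form_plane X Y Z W :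
  ang p Y Z * area_form p X W - ang p X Z * area_form p Y W = area_form p X Y * ang p Z W.
Proof.
apply: (mulfI (expf_neq0 2 rn)).
rewrite /ang /d_r /area_form /triple !dot3E.
have := sqr_rad p; rewrite dot3E => H.
have {}H : (space p) 0 0 ^+ 2 = rad p ^+ 2 - (space p) 0 1 ^+ 2 - (space p) 0 2 ^+ 2.
  by rewrite -H; ring.
by field: H; exact: rn.
Qed.

Lemma area_form_curv X Y Z W : area_form p (curv m p X Y Z) W =
  m / rad p ^+ 3 * ((3 * ang p Y Z - schw m p Y Z) * area_form p X W
     - (3 * ang p X Z - schw m p X Z) * area_form p Y W).
Proof.
rewrite curvE // /area_form !linE -scaleNr !(tripleDm, tripleZm).
have -> : triple (space p) (space p) (space W) = 0 by rewrite triplexx.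
ring.
Qed.

(** After the curvature is expanded by [Rbar_riem] and [area_form_curv], the
    Gram identities reduce both sides to polynomials in the components of
    dr /\ dt on (L, Lb) and on (e1, e2). The solid angle term is what remains:
    it is closed, but not exact. *)
Lemma curvature_charge :
  2 * area_form p (curv m p e1 e2 L) Lb - 2 * Rbar m p e1 e2 e1 e2 * Qform p L Lb
  = 4^-1 * Rbar m p L Lb L Lb * Qform p L Lb + Rbar m p e1 e2 Lb L * Qform p e1 e2
    - 4 * m * solid_angle p e1 e2.
Proof.
rewrite /solid_angle det_triple -/(area_form p e1 e2) !Rbar_riem // area_form_curv.
have EP := area_form_plane e1 e2 L Lb.
have -> : schw m p e2 L = 0 by rewrite schwC (frame_L2 fr).
have -> : schw m p e1 L = 0 by rewrite schwC (frame_L1 fr).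
rewrite !subr0 -!(mulrA 3) -mulrBr EP /riem.
have G1 := area_form_gram e1 e2 e1 e2.
have G2 := area_form_gram L Lb L Lb.
have G3 := area_form_gram e1 e2 Lb L.
have G4 := drdt_gram L Lb.
have a3 : area_form p Lb L = - area_form p L Lb by rewrite /area_form /triple; ring.
move: G1 G2 G3 G4; rewrite a3 area_form_tangent area_form_normal.
have Q1 : Qform p L Lb = rad p * drdt p L Lb by [].
have Q2 : Qform p e1 e2 = rad p * drdt p e1 e2 by [].
have b1 : drdt p Lb L = - drdt p L Lb by rewrite /drdt; ring.
rewrite Q1 Q2 b1 (frame_LL fr) (frame_BB fr) (frame_LB fr) (frame_11 fr) (frame_22 fr)
  !(schwC m p e1 Lb, schwC m p e1 L, schwC m p e2 Lb, schwC m p e2 L, schwC m p e2 e1, schwC m p Lb L)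
  (frame_LB fr) (frame_L1 fr) (frame_L2 fr) (frame_B1 fr) (frame_B2 fr) (frame_12 fr).
rewrite (angC p e2 e1) (angC p Lb L).
move: (drdt p L Lb) (drdt p e1 e2) => q s.
move: (ang p e1 e1) (ang p e2 e2) (ang p e1 e2) => a11 a22 a12.
move: (ang p L L) (ang p Lb Lb) (ang p L Lb) => aLL aBB A.
move: (ang p e1 L) (ang p e1 Lb) (ang p e2 L) (ang p e2 Lb) => b1L b1B b2L b2B.
move=> G1 G2 G3 G4.
have rr : rad p ^+ 2 != 0 by rewrite expf_neq0.
have {}G1 : a11 * a22 - a12 * a12 = q ^+ 2 / 4.
  by apply: (mulfI rr); rewrite -G1; field.
have {}G2 : aLL * aBB - A * A = 4 * s ^+ 2.
  by apply: (mulfI rr); rewrite -G2; field.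
have {}G3 : b1B * b2L - b1L * b2B = q * s.
  by apply: (mulfI rr); rewrite -[LHS]G3; field.
(* Eliminate aLL * aBB between Gram's identities for (L, Lb) in the two planes. *)
have GA : A = -1 + s ^+ 2 + q ^+ 2 / 4.
  have : q ^+ 2 + 4 * s ^+ 2 = 4 + 4 * A by rewrite G4 -G2; ring.
  lra.
rewrite ?G1 ?G2 ?G3 GA.
by field; exact: rn.
Qed.

End Frame.
End NullFrameAlgebra.

(** * Covariant derivatives along a patch *)

Section Smooth.
Context {R : realType}.

Lemma smooth_differentiable (V W : normedModType R) (U : set V) (f : V -> W) x :
  smooth_on U f -> U x -> differentiable f x.
Proof. by move=> /(_ 1%N) [H _] /H. Qed.

Lemma smooth_derive (V W : normedModType R) (U : set V) (f : V -> W) v :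
  smooth_on U f -> smooth_on U ('D_v f).
Proof. by move=> H k; have [_] := H k.+1; exact. Qed.

Lemma smooth_is_derive (V W : normedModType R) (U : set V) (f : V -> W) x v :
  smooth_on U f -> U x -> is_derive x v f ('D_v f x).
Proof.
move=> H Ux; apply: derivableP; apply: diff_derivable; exact: smooth_differentiable H Ux.
Qed.

Lemma smooth_continuous (V W : normedModType R) (U : set V) (f : V -> W) x :
  smooth_on U f -> U x -> {for x, continuous f}.
Proof. by move=> H Ux; apply/differentiable_continuous/(smooth_differentiable H). Qed.

Lemma near_open (T : topologicalType) (U : set T) x : open U -> U x -> \forall y \near x, U y.
Proof. by move=> oU Ux; apply: open_nbhs_nbhs; split. Qed.

Lemma near_eq_continuous (T S : topologicalType) (f g : T -> S) (x : T) :
  (\forall y \near x, f y = g y) -> {for x, continuous f} -> {for x, continuous g}.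
Proof.
move=> N C; rewrite /prop_for /continuous_at -(nbhs_singleton N).
exact: (cvg_trans (near_eq_cvg N) C).
Qed.

Lemma smooth_derive_commute n k (U : set 'rV[R]_n) (f : 'rV[R]_n -> 'rV[R]_k) u v w :
  open U -> smooth_on U f -> U u -> 'D_w ('D_v f) u = 'D_v ('D_w f) u.
Proof.
move=> oU sf Uu; apply/rowP => i.
pose g x := f x 0 i.
have dg x v' : U x -> 'D_v' g x = ('D_v' f x) 0 i.
  by move=> Ux; have [_ ->] := is_derive_coord 0 i (smooth_is_derive v' sf Ux).
have ndg x v' : U x -> \forall y \near x, ('D_v' f y) 0 i = 'D_v' g y.
  move=> Ux; near=> y; rewrite dg //; near: y. apply: (near_open oU Ux).
have dg1 x v' : U x -> derivable g x v'.
  by move=> Ux; have [] := is_derive_coord 0 i (smooth_is_derive v' sf Ux).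
have dg2 x v' w' : U x -> is_derive x w' ('D_v' g) (('D_w' ('D_v' f) x) 0 i).
  move=> Ux; apply: near_eq_is_derive; first exact: ndg.
  exact: is_derive_coord (smooth_is_derive w' (smooth_derive v' sf) Ux).
have E x v' w' : U x -> 'D_w' ('D_v' g) x = ('D_w' ('D_v' f) x) 0 i.
  by move=> Ux; have [] := dg2 x v' w' Ux.
have C v' w' : {for u, continuous ('D_w' ('D_v' g))}.
  have C0 : {for u, continuous (fun x => ('D_w' ('D_v' f) x) 0 i)}.
    apply: (@continuous_comp _ _ _ ('D_w' ('D_v' f)) (fun M : 'rV[R]_k => M 0 i)).
      exact: smooth_continuous (smooth_derive _ (smooth_derive _ sf)) Uu.
    exact: coord_continuous.
  apply: near_eq_continuous C0.
  by near=> y; rewrite E //; near: y; exact: (near_open oU Uu).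
apply: (etrans (esym (E u v w Uu))); apply: (etrans _ (E u w v Uu)).
apply: (@derive_commute R _ g u v w U) => //.
- by move=> x Ux; exact: dg1.
- by move=> x Ux; exact: dg1.
- by move=> x Ux; have [] := dg2 x v w Ux.
- by move=> x Ux; have [] := dg2 x w v Ux.
Unshelve. all: by end_near. Qed.

End Smooth.

Section AlongPatch.
Context {R : realType}.
Variables (m : R) (U : set 'rV[R]_2) (f : 'rV[R]_2 -> 'rV[R]_4).
Hypotheses (oU : open U) (sf : smooth_on U f)
  (rad0 : forall u, 0 < rad (f u)) (width0 : forall u, 0 < rad (f u) - 2 * m).
Implicit Types (V W : 'rV[R]_2 -> 'rV[R]_4) (u v w : 'rV[R]_2).

Lemma covdE V v u : covd m f V v u = 'D_v V u + chr m (f u) ('D_v f u) (V u).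
Proof. by rewrite /covd christoffel_sum. Qed.

Local Opaque derive chr dchr covd.

Lemma is_derive_covd V v w u : smooth_on U V -> U u ->
  is_derive u v (covd m f V w)
   ('D_v ('D_w V) u + (dchr m (f u) ('D_v f u) ('D_w f u) (V u)
    + chr m (f u) ('D_v ('D_w f) u) (V u) + chr m (f u) ('D_w f u) ('D_v V u))).
Proof.
move=> sV Uu.
have -> : covd m f V w = (fun q => 'D_w V q + chr m (f q) ('D_w f q) (V q)).
  by apply/funext => q; rewrite covdE.
apply: is_deriveD; first exact: smooth_is_derive (smooth_derive _ sV) Uu.
apply: is_derive_chr => //; first exact: smooth_is_derive sf Uu.
  exact: smooth_is_derive (smooth_derive _ sf) Uu.
exact: smooth_is_derive sV Uu.
Qed.

Lemma curv_from_second_derivatives p X Y Z ZX ZY a a' b b' : a = a' -> b = b' ->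
  a + (dchr m p X Y Z + chr m p b Z + chr m p Y ZX) + chr m p X (ZY + chr m p Y Z)
  - (a' + (dchr m p Y X Z + chr m p b' Z + chr m p X ZY) + chr m p Y (ZX + chr m p X Z))
  = curv m p X Y Z.
Proof.
move=> <- <-.
have chrD A B C : chr m p A (B + C) = chr m p A B + chr m p A C.
  by rewrite -[in LHS](scale1r B) chr_linr scale1r.
rewrite !chrD /curv.
move: (dchr m p X Y Z) => c1; move: (dchr m p Y X Z) => c2; move: (chr m p b Z) => c3.
move: (chr m p Y ZX) => c4; move: (chr m p X ZY) => c5.
move: (chr m p X (chr m p Y Z)) => c6; move: (chr m p Y (chr m p X Z)) => c7.
by apply/rowP => k; rewrite !mxE; ring.
Qed.

(** The Ricci identity; the fields [v] and [w] are constant, so that no bracket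
    occurs. *)
Lemma covd_commute V v w u : smooth_on U V -> U u ->
  covd m f (covd m f V w) v u - covd m f (covd m f V v) w u
  = curv m (f u) ('D_v f u) ('D_w f u) (V u).
Proof.
move=> sV Uu.
have E a b : covd m f (covd m f V b) a u = 'D_a ('D_b V) u + (dchr m (f u) ('D_a f u) ('D_b f u) (V u)
    + chr m (f u) ('D_a ('D_b f) u) (V u) + chr m (f u) ('D_b f u) ('D_a V u))
   + chr m (f u) ('D_a f u) ('D_b V u + chr m (f u) ('D_b f u) (V u)).
  apply: (etrans (covdE _ _ _)); congr (_ + chr _ _ _ _); last exact: covdE.
  by have [] := is_derive_covd a b sV Uu.
apply: (etrans (congr2 (fun x y => x - y) (E v w) (E w v))).
apply: curv_from_second_derivatives.
  exact: smooth_derive_commute w v oU sV Uu.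
exact: smooth_derive_commute w v oU sf Uu.
Qed.

(** The connection is torsion-free and second derivatives of [f] commute. *)
Lemma covd_sym v w u : U u -> covd m f ('D_w f) v u = covd m f ('D_v f) w u.
Proof.
move=> Uu; apply: (etrans (covdE _ _ _)); apply: (etrans _ (esym (covdE _ _ _))).
apply: (congr2 (fun x y => x + y)); last exact: chrC.
exact: smooth_derive_commute w v oU sf Uu.
Qed.

Lemma is_derive_metric V W v u (V' W' : 'rV[R]_4) : U u ->
  is_derive u v V V' -> is_derive u v W W' ->
  is_derive u v (fun q => schw m (f q) (V q) (W q))
    (schw m (f u) (covd m f V v u) (W u) + schw m (f u) (V u) (covd m f W v u)).
Proof.
move=> Uu hV hW; have sV := is_derive_schw (rad0 u) (width0 u) (smooth_is_derive v sf Uu) hV hW.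
apply: (is_derive_eq sV); apply: (congr2 (fun x y => x + y)).
  by apply: (congr1 (fun x => schw _ _ x _)); rewrite covdE; case: hV => _ ->.
by apply: (congr1 (fun x => schw _ _ _ x)); rewrite covdE; case: hW => _ ->.
Qed.

Lemma is_derive_triple (A : normedModType R) (u v : A) (X Y Z : A -> 'rV[R]_4) (X' Y' Z' : 'rV[R]_4) :
  is_derive u v X X' -> is_derive u v Y Y' -> is_derive u v Z Z' ->
  is_derive u v (fun q : A => triple (space (X q)) (space (Y q)) (space (Z q)))
   (triple (space X') (space (Y u)) (space (Z u)) + triple (space (X u)) (space Y') (space (Z u))
    + triple (space (X u)) (space (Y u)) (space Z')).
Proof.
move=> hX hY hZ; rewrite /triple.
have cX i := is_derive_coord 0 i (is_derive_space hX).
have cY i := is_derive_coord 0 i (is_derive_space hY).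
have cZ i := is_derive_coord 0 i (is_derive_space hZ).
apply: is_derive_eq.
have sc (a b : R) : a *: b = a * b by [].
rewrite !sc.
by ring.
Qed.

(** The spatial part of [chr] is a multiple of the position, which P
    annihilates; hence P does not distinguish ordinary from covariant
    derivatives. *)
Lemma area_form_chr p (X Y Z : 'rV[R]_4) Y' Z' :
  triple (space X) (space Y) (space Z) + triple (space p) (space Y') (space Z)
    + triple (space p) (space Y) (space Z')
  = triple (space X) (space Y) (space Z)
     + area_form p (Y' + chr m p X Y) Z + area_form p Y (Z' + chr m p X Z).
Proof.
rewrite /area_form !linE !(tripleDm, tripleDr, tripleZm, tripleZr).
have -> : triple (space p) (space p) (space Z) = 0 by rewrite triplexx.
have -> : triple (space p) (space Y) (space p) = 0 by rewrite /triple; ring.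
by rewrite !mulr0 !addr0.
Qed.

(** The Killing-Yano equation: beside the derivatives of the two arguments only
    the totally antisymmetric form det(X, Y, Z) occurs. *)
Lemma is_derive_area_form V W v u (V' W' : 'rV[R]_4) : U u ->
  is_derive u v V V' -> is_derive u v W W' ->
  is_derive u v (fun q => area_form (f q) (V q) (W q))
    (triple (space ('D_v f u)) (space (V u)) (space (W u))
     + area_form (f u) (covd m f V v u) (W u) + area_form (f u) (V u) (covd m f W v u)).
Proof.
move=> Uu hV hW.
apply: (is_derive_eq (is_derive_triple (smooth_is_derive v sf Uu) hV hW)).
have EV : covd m f V v u = V' + chr m (f u) ('D_v f u) (V u).
  by apply: (etrans (covdE _ _ _)); case: hV => _ ->.
have EW : covd m f W v u = W' + chr m (f u) ('D_v f u) (W u).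
  by apply: (etrans (covdE _ _ _)); case: hW => _ ->.
rewrite EV EW; exact: area_form_chr.
Qed.

End AlongPatch.

(** * The Gauss equation *)

Section Gauss.
Context {R : realType}.
Variables (m : R) (U : set 'rV[R]_2) (f : 'rV[R]_2 -> 'rV[R]_4).
Hypotheses (oU : open U) (sf : smooth_on U f)
  (rad0 : forall u, 0 < rad (f u)) (width0 : forall u, 0 < rad (f u) - 2 * m)
  (Gunit : forall u, U u -> induced_mx m f u \in unitmx).
Implicit Types (u v w : 'rV[R]_2) (a b c d k s : 'I_2).

Let G := induced_mx m f.
Let Gam k a b u := christoffel G k a b u.

(** Its normal part is the second fundamental form, its tangential part the
    induced connection. *)
Definition second_deriv a b u := covd m f (pd b f) (delta_mx 0 a) u.

Let T a b c u := schw m (f u) (second_deriv a b u) (pd c f u).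

Lemma induced_mx_sym u a b : G u a b = G u b a.
Proof. by rewrite !mxE; exact: schwC. Qed.

Lemma is_derive_pd v a u : U u -> is_derive u v (pd a f) ('D_v (pd a f) u).
Proof. by move=> Uu; exact: smooth_is_derive (smooth_derive _ sf) Uu. Qed.

Lemma is_derive_induced_mx a b c u : U u ->
  is_derive u (delta_mx 0 a) (fun q => G q b c) (T a b c u + T a c b u).
Proof.
move=> Uu.
have -> : (fun q => G q b c) = (fun q => schw m (f q) (pd b f q) (pd c f q)).
  by apply/funext => q; rewrite mxE.
have H := is_derive_metric sf rad0 width0 Uu (is_derive_pd (delta_mx 0 a) b Uu)
  (is_derive_pd (delta_mx 0 a) c Uu).
by apply: (is_derive_eq H); congr (_ + _); exact: schwC.
Qed.

Lemma second_derivC a b u : U u -> second_deriv a b u = second_deriv b a u.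
Proof. by move=> Uu; exact: (covd_sym oU sf rad0 width0). Qed.

Lemma lower_index (x : 'I_2 -> R) c u : U u ->
  \sum_s (\sum_d invmx (G u) s d * x d) * G u s c = x c.
Proof.
move=> Uu.
have inv i j : \sum_l G u i l * invmx (G u) l j = (i == j)%:R.
  by have := mulmxV (Gunit Uu) => /matrixP/(_ i j); rewrite !mxE.
transitivity (\sum_d (\sum_s G u c s * invmx (G u) s d) * x d).
  under eq_bigr => s _ do rewrite mulr_suml.
  rewrite exchange_big /=; apply: eq_bigr => d _.
  by rewrite mulr_suml; apply: eq_bigr => s _; rewrite (induced_mx_sym u s c); ring.
under eq_bigr => d _ do rewrite inv.
rewrite (bigD1 c) //= eqxx mul1r big1 ?addr0 // => d dc.
by rewrite eq_sym (negbTE dc) mul0r.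
Qed.

(** The tangential part of the ambient connection is symmetric and compatible
    with the induced metric, so [christoffel_unique] applies. *)
Lemma christoffel_induced k a b u : U u ->
  Gam k a b u = \sum_c invmx (G u) k c * T a b c u.
Proof.
move=> Uu.
apply: (@christoffel_unique R 2 G (fun k a b => \sum_c invmx (G u) k c * T a b c u) u).
- exact: Gunit.
- exact: induced_mx_sym.
- by move=> i j l; apply: eq_bigr => c _; rewrite /T second_derivC.
- move=> l i j.
  have [_ E] := is_derive_induced_mx l i j Uu; apply: (etrans E).
  rewrite big_split /=; congr (_ + _); first by rewrite lower_index.
  under eq_bigr => s _ do rewrite (induced_mx_sym u i s).
  by rewrite lower_index.
Qed.

Lemma christoffel_lower a b c u : U u -> \sum_s Gam s a b u * G u s c = T a b c u.
Proof.
move=> Uu; under eq_bigr => s _ do rewrite christoffel_induced //.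
exact: lower_index.
Qed.

Lemma derivable_T a b c u v : U u -> derivable (T a b c) u v.
Proof.
move=> Uu.
have h1 := is_derive_covd sf rad0 width0 v (delta_mx 0 a) (smooth_derive (delta_mx 0 b) sf) Uu.
by have [] := is_derive_metric sf rad0 width0 Uu h1 (is_derive_pd v c Uu).
Qed.

Lemma derivable_induced a b u v : U u -> derivable (fun q => G q a b) u v.
Proof.
move=> Uu.
have -> : (fun q => G q a b) = (fun q => schw m (f q) (pd a f q) (pd b f q)).
  by apply/funext => q; rewrite mxE.
by have [] := is_derive_metric sf rad0 width0 Uu (is_derive_pd v a Uu)
  (is_derive_pd v b Uu).
Qed.

Lemma derivable_christoffel k a b u v : U u -> derivable (Gam k a b) u v.
Proof.
move=> Uu.
have dG i j : is_derive u v (fun q => G q i j) ('D_v (fun q => G q i j) u).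
  by apply: derivableP; exact: derivable_induced.
have dT i j l : is_derive u v (T i j l) ('D_v (T i j l) u).
  by apply: derivableP; exact: derivable_T.
have detu : \det (G u) != 0 by rewrite -unitfE -unitmxE; exact: Gunit.
have [D ddet] : exists D, is_derive u v (fun q => \det (G q)) D.
  have -> : (fun q => \det (G q)) = (fun q => G q 0 0 * G q 1 1 - G q 0 1 * G q 1 0).
    by apply/funext => q; exact: det22.
  by eexists; repeat first [eapply dG | derive_step].
pose I (i j : 'I_2) q := (\det (G q))^-1 * ((-1) ^+ (j + i) * G q (lift j 0) (lift i 0)).
have dI i j : is_derive u v (I i j) ('D_v (I i j) u).
  have [D' dD] : exists D', is_derive u v (I i j) D'.
    by eexists; eapply is_derive_mulf; [eapply is_derive_inv; [exact: detu|exact: ddet]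
      |eapply is_derive_mulf; [eapply is_derive_constf|eapply dG]].
  by apply: derivableP; case: dD.
have D1 : is_derive u v (fun q => \sum_(c < 2) I k c q * T a b c q)
    (\sum_(c < 2) ('D_v (I k c) u * T a b c u + I k c u * 'D_v (T a b c) u)).
  by apply: is_derive_sumf => c; apply: is_derive_mulf.
case: D1 => D1 _; apply: near_eq_derivable D1.
near=> q; apply/esym; apply: (etrans (christoffel_induced _ _ _ _)).
  by near: q; exact: (near_open oU Uu).
apply: eq_bigr => c _; rewrite invmx_entry //; apply: Gunit.
by near: q; exact: (near_open oU Uu).
Unshelve. all: by end_near. Qed.

(** Two ways to differentiate the identity [christoffel_lower]. *)
Lemma gauss_derivative a b c d u : U u ->
  \sum_s ('D_(delta_mx 0 a) (Gam s b d) u * G u s c + Gam s b d u * (T a s c u + T a c s u))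
  = schw m (f u) (covd m f (second_deriv b d) (delta_mx 0 a) u) (pd c f u)
    + schw m (f u) (second_deriv b d u) (second_deriv a c u).
Proof.
move=> Uu.
have dd := is_derive_covd sf rad0 width0 (delta_mx 0 a) (delta_mx 0 b)
   (smooth_derive (delta_mx 0 d) sf) Uu.
have [_ <-] := is_derive_metric sf rad0 width0 Uu dd (is_derive_pd (delta_mx 0 a) c Uu).
have [_ <-] : is_derive u (delta_mx 0 a) (fun q => \sum_s Gam s b d q * G q s c)
  (\sum_s ('D_(delta_mx 0 a) (Gam s b d) u * G u s c + Gam s b d u * (T a s c u + T a c s u))).
  apply: is_derive_sumf => s; apply: is_derive_mulf; last exact: is_derive_induced_mx.
  by apply: derivableP; exact: derivable_christoffel.
apply: near_eq_derive; near=> q; apply: christoffel_lower.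
by near: q; exact: (near_open oU Uu).
Unshelve. all: by end_near. Qed.

(** The inner product of two values of the second fundamental form: the
    subtracted sum is the inner product of the tangential parts. *)
Definition normal_product a c b d u :=
  schw m (f u) (second_deriv b d u) (second_deriv a c u) - \sum_s Gam s b d u * T a c s u.

Lemma riemann_sum_split n (g dA dB : 'I_n -> R) (P Q : 'I_n -> 'I_n -> R) :
  \sum_s g s * (dA s - dB s + \sum_q (P s q - Q s q)) =
  (\sum_s dA s * g s + \sum_s g s * \sum_q P s q)
  - (\sum_s dB s * g s + \sum_s g s * \sum_q Q s q).
Proof.
rewrite -!big_split /= -sumrN -big_split /=; apply: eq_bigr => s _.
by rewrite big_split /= sumrN; ring.
Qed.

Lemma riemann_lower a b c d u : U u ->
  riemann G a b c d u =
    (\sum_s 'D_(delta_mx 0 a) (Gam s b d) u * G u s c + \sum_s Gam s b d u * T a s c u)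
  - (\sum_s 'D_(delta_mx 0 b) (Gam s a d) u * G u s c + \sum_s Gam s a d u * T b s c u).
Proof.
move=> Uu; rewrite /riemann.
have L i j : \sum_s Gam s j d u * T i s c u =
    \sum_s G u c s * \sum_(q < 2) Gam s i q u * Gam q j d u.
  under eq_bigr => s _ do rewrite -christoffel_lower // mulr_sumr.
  under [RHS]eq_bigr => s _ do rewrite mulr_sumr.
  rewrite exchange_big /=; apply: eq_bigr => s _; apply: eq_bigr => q _.
  by rewrite (induced_mx_sym u c s); ring.
have S i j : \sum_s 'D_(delta_mx 0 i) (Gam s j d) u * G u c s
   = \sum_s 'D_(delta_mx 0 i) (Gam s j d) u * G u s c.
  by apply: eq_bigr => s _; rewrite (induced_mx_sym u c s).
apply: (etrans (riemann_sum_split (G u c) (fun s => 'D_(delta_mx 0 a) (Gam s b d) u)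
  (fun s => 'D_(delta_mx 0 b) (Gam s a d) u) (fun s q => Gam s a q u * Gam q b d u)
  (fun s q => Gam s b q u * Gam q a d u))).
apply: (congr2 (fun x y => x - y)); apply: (congr2 (fun x y => x + y)).
- exact: S.
- exact/esym/L.
- exact: S.
- exact/esym/L.
Qed.

Lemma gauss_arithmetic (A1 A2 x1 x2 x3 x4 x5 x6 z : R) :
  A1 + x5 = x1 + x3 -> A2 + x6 = x2 + x4 -> x1 - x2 = z ->
  A1 - A2 = z + (x3 - x5) - (x4 - x6).
Proof. move=> E1 E2 <-; lra. Qed.

(** Antisymmetrize [gauss_derivative] in [a] and [b]: the third derivatives of
    [f] leave the ambient curvature by the Ricci identity, and the terms in
    the induced Christoffel symbols assemble to the intrinsic curvature. *)
Lemma gauss_equation a b c d u : U u ->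
  riemann G a b c d u = riem m (f u) (pd a f u) (pd b f u) (pd c f u) (pd d f u)
    + normal_product a c b d u - normal_product b c a d u.
Proof.
move=> Uu; rewrite -schw_curv // riemann_lower //.
have cc := covd_commute oU sf rad0 width0 (delta_mx 0 a) (delta_mx 0 b)
  (smooth_derive (delta_mx 0 d) sf) Uu.
have EX : schw m (f u) (covd m f (second_deriv b d) (delta_mx 0 a) u) (pd c f u)
    - schw m (f u) (covd m f (second_deriv a d) (delta_mx 0 b) u) (pd c f u)
  = schw m (f u) (pd c f u) (curv m (f u) (pd a f u) (pd b f u) (pd d f u)).
  apply: (etrans _ (schwC _ _ _ _)).
  apply: (etrans _ (congr1 (fun x => schw m (f u) x (pd c f u)) cc)).
  apply: (etrans _ (esym (schwDl _ _ _ _ _))).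
  by apply: (congr1 (fun x => _ + x)); apply/esym; exact: schwNl.
have E1 := gauss_derivative a b c d Uu; have E2 := gauss_derivative b a c d Uu.
have split_sum i j : \sum_s ('D_(delta_mx 0 i) (Gam s j d) u * G u s c + Gam s j d u * (T i s c u + T i c s u))
  = \sum_s 'D_(delta_mx 0 i) (Gam s j d) u * G u s c + \sum_s Gam s j d u * T i s c u
   + \sum_s Gam s j d u * T i c s u.
  by rewrite -!big_split /=; apply: eq_bigr => s _; rewrite mulrDr addrA.
exact: (gauss_arithmetic (etrans (esym (split_sum a b)) E1)
  (etrans (esym (split_sum b a)) E2) EX).
Qed.

End Gauss.

(** * Continuously differentiable functions *)

Lemma near_eq_differentiable (R : realType) (V W : normedModType R) (f g : V -> W) (x : V) :
  (\forall y \near x, f y = g y) -> differentiable f x -> differentiable g x.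
Proof.
move=> N df; have fx := nbhs_singleton N.
have c := diff_continuous df.
have E : g \o shift x = cst (g x) + 'd f x +o_ 0 id.
  apply/eqaddoP => e e0.
  have /eqaddoP/(_ e e0) H := diff_locally df.
  have N0 : \forall h \near (0 : V), f (h + x) = g (h + x).
    by have := N; rewrite (near_shift 0 x); apply: filterS => h; rewrite /= subr0.
  near=> h.
  have -> : (g \o shift x - (cst (g x) + 'd f x)) h = (f \o shift x - (cst (f x) + 'd f x)) h.
    rewrite -fx; congr (_ - _).
    by apply/esym; near: h.
  by near: h.
have D := diff_unique c E.
by apply/diff_locallyP; rewrite D.
Unshelve. all: by end_near. Qed.

Section C1.
Context {R : realType} {n : nat}.
Variable U : set 'rV[R]_n.
Hypothesis oU : open U.
Implicit Types g h : 'rV[R]_n -> R.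

(** Regularity sufficient for the fundamental theorem of calculus, and easy to
    verify for inverses, square roots and composites. *)
Definition C1 g : Prop := forall u, U u ->
  differentiable g u /\ forall v, {for u, continuous ('D_v g)}.

Lemma C1_is_derive g u v : C1 g -> U u -> is_derive u v g ('D_v g u).
Proof. by move=> cg /cg[d _]; apply: derivableP; exact: diff_derivable. Qed.

Lemma C1_continuous g u : C1 g -> U u -> {for u, continuous g}.
Proof. by move=> cg /cg[d _]; exact: differentiable_continuous. Qed.

Lemma C1_intro g (dg : 'rV[R]_n -> 'rV[R]_n -> R) :
  (forall u, U u -> differentiable g u) ->
  (forall u v, U u -> is_derive u v g (dg v u)) ->
  (forall u v, U u -> {for u, continuous (dg v)}) -> C1 g.
Proof.
move=> H1 H2 H3 u Uu; split; first exact: H1.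
move=> v; apply: near_eq_continuous (H3 u v Uu).
have := near_open oU Uu; apply: filterS => x Ux.
by have [_ <-] := H2 x v Ux.
Qed.

Lemma C1_const (c : R) : C1 (fun=> c).
Proof.
apply: (@C1_intro _ (fun _ _ => 0)) => u.
- by move=> _; exact: differentiable_cst.
- by move=> v _; exact: cst_continuous.
Qed.

Lemma C1_add g h : C1 g -> C1 h -> C1 (fun x => g x + h x).
Proof.
move=> cg ch; apply: (@C1_intro _ (fun v x => 'D_v g x + 'D_v h x)) => u.
- move=> Uu; apply: (@differentiableD _ _ _ g h); [exact: (cg u Uu).1|exact: (ch u Uu).1].
- by move=> v Uu; apply: is_derive_addf; exact: C1_is_derive.
- move=> v Uu; apply: (@continuousD _ _ _ ('D_v g) ('D_v h)).
    exact: (cg u Uu).2.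
  exact: (ch u Uu).2.
Qed.

Lemma C1_mul g h : C1 g -> C1 h -> C1 (fun x => g x * h x).
Proof.
move=> cg ch; apply: (@C1_intro _ (fun v x => 'D_v g x * h x + g x * 'D_v h x)) => u.
- move=> Uu; apply: (@differentiableM _ _ g h); [exact: (cg u Uu).1|exact: (ch u Uu).1].
- by move=> v Uu; apply: is_derive_mulf; exact: C1_is_derive.
- move=> v Uu.
  apply: (@continuousD _ _ _ (fun x => 'D_v g x * h x) (fun x => g x * 'D_v h x)).
    apply: (@continuousM _ _ ('D_v g) h); [exact: (cg u Uu).2|exact: C1_continuous].
  apply: (@continuousM _ _ g ('D_v h)); [exact: C1_continuous|exact: (ch u Uu).2].
Qed.

Lemma C1_opp g : C1 g -> C1 (fun x => - g x).
Proof.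
move=> cg; apply: (@C1_intro _ (fun v x => - 'D_v g x)) => u.
- by move=> Uu; apply: (@differentiableN _ _ _ g); exact: (cg u Uu).1.
- by move=> v Uu; apply: is_derive_oppf; exact: C1_is_derive.
- by move=> v Uu; apply: (@continuousN _ _ _ ('D_v g)); exact: (cg u Uu).2.
Qed.

Lemma C1_comp g (k dk : R -> R) :
  (forall u, U u -> is_derive (g u) 1 k (dk (g u))) ->
  (forall u, U u -> {for g u, continuous dk}) -> C1 g -> C1 (fun x => k (g x)).
Proof.
move=> hk hdk cg; apply: (@C1_intro _ (fun v x => dk (g x) * 'D_v g x)) => u.
- move=> Uu; apply: (@differentiable_comp _ _ _ _ g k); first exact: (cg u Uu).1.
  by apply/derivable1_diffP; have [] := hk u Uu.
- by move=> v Uu; apply: (is_derive_comp1 (C1_is_derive v cg Uu)); exact: hk.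
- move=> v Uu; apply: (@continuousM _ _ (fun x => dk (g x)) ('D_v g)).
    apply: (@continuous_comp _ _ _ g dk); first exact: C1_continuous.
    exact: hdk.
  exact: (cg u Uu).2.
Qed.

Lemma C1_inv g : C1 g -> (forall u, U u -> g u != 0) -> C1 (fun x => (g x)^-1).
Proof.
move=> cg g0; apply: (@C1_comp g (fun t => t^-1) (fun t => - (t ^+ 2)^-1)) => // u Uu.
- apply: is_derive_eq; first exact: (is_derive_inv (g0 u Uu) (is_derive_id _ _)).
  by rewrite mulNr mul1r.
- apply: continuousN; apply: (@continuousV R R (fun t => t ^+ 2)).
    by rewrite expf_neq0 // g0.
  exact: exprn_continuous.
Qed.

Lemma C1_sqrt g : C1 g -> (forall u, U u -> 0 < g u) -> C1 (fun x => Num.sqrt (g x)).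
Proof.
move=> cg g0; apply: (@C1_comp g Num.sqrt (fun t => (2 * Num.sqrt t)^-1)) => // u Uu.
- exact: (is_derive1_sqrt (g0 u Uu)).
- apply: (@continuousV R R (fun t => 2 * Num.sqrt t)).
    by rewrite mulf_neq0 ?pnatr_eq0 // gt_eqF // sqrtr_gt0 g0.
  apply: (@continuousM R R (fun=> 2) Num.sqrt); first exact: cst_continuous.
  exact: sqrt_continuous.
Qed.

Lemma C1_near g : (forall u, U u -> exists h, (\forall y \near u, h y = g y) /\
   (differentiable h u /\ forall v, {for u, continuous ('D_v h)})) -> C1 g.
Proof.
move=> H u Uu; have [h [N [dh ch]]] := H u Uu; split.
  exact: near_eq_differentiable N dh.
move=> v; apply: near_eq_continuous (ch v).
have NN : \forall x \near u, \forall y \near x, h y = g y by exact/nbhs_interior.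
by move: NN; apply: filterS => x Nx; exact: near_eq_derive.
Qed.

Lemma C1_eq g h : (forall u, U u -> g u = h u) -> C1 g -> C1 h.
Proof.
move=> E cg; apply: C1_near => u Uu; exists g; split; last exact: cg.
by have := near_open oU Uu; apply: filterS => y; exact: E.
Qed.

Lemma C1_sum k (g : 'I_k -> 'rV[R]_n -> R) :
  (forall i, C1 (g i)) -> C1 (fun x => \sum_i g i x).
Proof.
elim: k g => [|k IH] g cg.
  by apply: (C1_eq _ (C1_const 0)) => u _; rewrite big_ord0.
apply: (C1_eq (g := fun x => g ord0 x + \sum_i g (lift ord0 i) x)).
  by move=> u _; rewrite big_ord_recl.
by apply: C1_add => //; apply: IH => i; exact: cg.
Qed.

Lemma C1_coord k (f : 'rV[R]_n -> 'rV[R]_k) i : smooth_on U f -> C1 (fun x => f x 0 i).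
Proof.
move=> sf; apply: (@C1_intro _ (fun v x => 'D_v f x 0 i)) => u.
- move=> Uu; apply: (@differentiable_comp _ _ _ _ f (fun M : 'rV[R]_k => M 0 i)).
    exact: smooth_differentiable sf Uu.
  exact: differentiable_coord.
- by move=> v Uu; exact: is_derive_coord (smooth_is_derive v sf Uu).
- move=> v Uu; apply: (@continuous_comp _ _ _ ('D_v f) (fun M : 'rV[R]_k => M 0 i)).
    exact: smooth_continuous (smooth_derive v sf) Uu.
  exact: coord_continuous.
Qed.

End C1.

(** * Regularity of the geometric quantities *)

Ltac C1_step oU :=
  match goal with
  | H : C1 ?U ?f |- C1 ?U ?f => exact H
  | H : (forall u, C1 _ _) |- _ => solve [eapply H]
  | |- C1 _ (fun _ => _ + _) => apply: (C1_add oU)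
  | |- C1 _ (fun _ => _ * _) => apply: (C1_mul oU)
  | |- C1 _ (fun _ => - _) => apply: (C1_opp oU)
  | |- C1 _ (fun _ => _ ^-1) => apply: (C1_inv oU)
  | |- C1 _ (fun _ => ?c) => exact (C1_const oU c)
  end.

Section C1Geometry.
Context {R : realType} {n : nat}.
Variables (m : R) (U : set 'rV[R]_n) (f : 'rV[R]_n -> 'rV[R]_4).
Hypotheses (oU : open U) (sf : smooth_on U f)
  (rad0 : forall u, 0 < rad (f u)) (width0 : forall u, 0 < rad (f u) - 2 * m).
Implicit Types (X Y Z : 'rV[R]_n -> 'rV[R]_4) (u v : 'rV[R]_n).

Definition C1_vector X := forall i, C1 U (fun q => X q 0 i).

Lemma C1_vector_smooth X : smooth_on U X -> C1_vector X.
Proof. by move=> sX i; exact: C1_coord. Qed.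

Lemma C1_exp g k : C1 U g -> C1 U (fun x : 'rV[R]_n => g x ^+ k).
Proof.
move=> cg; elim: k => [|k IH].
  by under eq_fun do rewrite expr0; exact: (C1_const oU).
by under eq_fun do rewrite exprS; apply: (C1_mul oU).
Qed.

Lemma C1_dot3 X Y : C1_vector X -> C1_vector Y ->
  C1 U (fun q => dot3 (space (X q)) (space (Y q))).
Proof.
move=> cX cY; rewrite /dot3; apply: (C1_sum oU) => i.
by under eq_fun do rewrite !mxE; apply: (C1_mul oU).
Qed.

Let cf : C1_vector f. Proof. exact: C1_vector_smooth. Qed.

Lemma C1_rad : C1 U (fun q => rad (f q)).
Proof.
by apply: (C1_sqrt oU); [exact: C1_dot3|move=> u _; rewrite -sqrtr_gt0; exact: rad0].
Qed.

Lemma rad_neq0 u : rad (f u) != 0. Proof. by rewrite gt_eqF. Qed.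
Lemma width_neq0 u : rad (f u) - 2 * m != 0. Proof. by rewrite gt_eqF. Qed.
Lemma lapse_neq0 u : 1 - 2 * m / rad (f u) != 0.
Proof. exact: lapse2_neq0 (rad_neq0 u) (width_neq0 u). Qed.

Lemma C1_schw X Y : C1_vector X -> C1_vector Y -> C1 U (fun q => schw m (f q) (X q) (Y q)).
Proof.
move=> cX cY; rewrite /schw /d_r /lapse2 /d_t.
have h1 := C1_dot3 cf cX; have h2 := C1_dot3 cf cY; have h3 := C1_dot3 cX cY.
have h4 := cX 0; have h5 := cY 0; have hr := C1_rad.
by repeat (C1_step oU); move=> u _; first [exact: lapse_neq0 | exact: rad_neq0].
Qed.

Lemma C1_triple X Y Z : C1_vector X -> C1_vector Y -> C1_vector Z ->
  C1 U (fun q => triple (space (X q)) (space (Y q)) (space (Z q))).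
Proof.
move=> cX cY cZ; rewrite /triple.
have sX i : C1 U (fun q => space (X q) 0 i) by under eq_fun do rewrite mxE; exact: cX.
have sY i : C1 U (fun q => space (Y q) 0 i) by under eq_fun do rewrite mxE; exact: cY.
have sZ i : C1 U (fun q => space (Z q) 0 i) by under eq_fun do rewrite mxE; exact: cZ.
by repeat first [eapply sX | eapply sY | eapply sZ | C1_step oU].
Qed.

Lemma C1_chr X Y : C1_vector X -> C1_vector Y -> C1_vector (fun q => chr m (f q) (X q) (Y q)).
Proof.
move=> cX cY i; rewrite /chr /event.
under eq_fun do rewrite mxE.
have h1 := C1_dot3 cf cX; have h2 := C1_dot3 cf cY; have h3 := C1_dot3 cX cY.
have h4 := cX 0; have h5 := cY 0; have hr := C1_rad.
have hk k : C1 U (fun q => rad (f q) ^+ k) by exact: C1_exp.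
have nk k u : rad (f u) ^+ k != 0 by rewrite expf_neq0 // rad_neq0.
destruct (unlift ord0 i) as [j|].
  under eq_fun do rewrite !mxE.
  apply: (C1_mul oU); last exact: cf.
  rewrite /chr_space /d_t.
  (repeat first [eapply hk | C1_step oU]) => u _; 
  first [exact: nk | by apply: mulf_neq0; [exact: nk|exact: width_neq0]].
rewrite /d_t.
by apply: (C1_mul oU); (repeat first [eapply hk | C1_step oU]) => u _; 
  first [exact: nk | by apply: mulf_neq0; [exact: nk|exact: width_neq0]].
Qed.

Lemma C1_vector_add X Y : C1_vector X -> C1_vector Y -> C1_vector (fun q => X q + Y q).
Proof. by move=> cX cY i; under eq_fun do rewrite mxE; apply: (C1_add oU). Qed.

End C1Geometry.

Section C1Patch.
Context {R : realType}.
Variables (m : R) (U : set 'rV[R]_2) (f : 'rV[R]_2 -> 'rV[R]_4).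
Hypotheses (oU : open U) (sf : smooth_on U f)
  (rad0 : forall u, 0 < rad (f u)) (width0 : forall u, 0 < rad (f u) - 2 * m).
Implicit Types (V W : 'rV[R]_2 -> 'rV[R]_4) (u v w : 'rV[R]_2).

Lemma C1_covd V v : smooth_on U V -> C1_vector U (covd m f V v).
Proof.
move=> sV.
have -> : covd m f V v = (fun q => 'D_v V q + chr m (f q) ('D_v f q) (V q)).
  by apply/funext => q; exact: covdE.
apply: (C1_vector_add oU); first exact/C1_vector_smooth/smooth_derive.
by apply: C1_chr => //; apply: (C1_vector_smooth oU) => //; exact: smooth_derive.
Qed.

Variables (L Lb : 'rV[R]_2 -> 'rV[R]_4).
Hypotheses (sL : smooth_on U L) (sLb : smooth_on U Lb).

Lemma C1_zeta v : C1 U (zeta m f L Lb v).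
Proof.
apply: (C1_mul oU); first exact: (C1_const oU).
by apply: (C1_schw oU) => //; [exact: C1_covd|exact: C1_vector_smooth].
Qed.

(** The one-form omega, evaluated on the constant field [v]: P applied to Lb and
    to D_v L + zeta(v) L, the tangential part of D_v L. *)
Definition potential v u : R :=
  area_form (f u) (covd m f L v u) (Lb u) + zeta m f L Lb v u * area_form (f u) (L u) (Lb u).

Lemma C1_potential v : C1 U (potential v).
Proof.
have cf := C1_vector_smooth oU sf; have cL := C1_vector_smooth oU sL.
have cLb := C1_vector_smooth oU sLb.
apply: (C1_add oU).
  by apply: (C1_triple oU) => //; exact: C1_covd.
by apply: (C1_mul oU); [exact: C1_zeta|exact: (C1_triple oU)].
Qed.

End C1Patch.

(** * The exterior derivative of the potential *)

Section StructureAlgebra.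
Context {R : realType}.
Variables (m : R) (p L Lb e1 e2 : 'rV[R]_4).
Hypotheses (r0 : 0 < rad p) (w0 : 0 < rad p - 2 * m) (fr : null_frame m p L Lb e1 e2).

Lemma frame_inner X Y : schw m p X Y =
  - 2^-1 * (schw m p X L * schw m p Y Lb + schw m p X Lb * schw m p Y L)
  + schw m p X e1 * schw m p Y e1 + schw m p X e2 * schw m p Y e2.
Proof.
rewrite {1}(frame_decomposition r0 w0 fr X) !schwE.
by rewrite (schwC m p L) (schwC m p Lb) (schwC m p e1) (schwC m p e2); ring.
Qed.

(** Here [A1], [A2] stand for the derivatives of L along [e1], [e2], and [B1],
    [B2] for those of Lb. In the frame the connection coefficients [z1], [z2]
    cancel: what remains is the trace of the first second fundamental form and
    the mixed determinant of the two. *)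
Lemma connection_algebra A1 A2 B1 B2 z1 z2 :
  schw m p A1 L = 0 -> schw m p A2 L = 0 -> schw m p B1 Lb = 0 -> schw m p B2 Lb = 0 ->
  schw m p A1 Lb = 2 * z1 -> schw m p A2 Lb = 2 * z2 ->
  schw m p B1 L = - 2 * z1 -> schw m p B2 L = - 2 * z2 ->
  schw m p A1 e2 = schw m p A2 e1 -> schw m p B1 e2 = schw m p B2 e1 ->
  triple (space e1) (space A2) (space Lb) - triple (space e2) (space A1) (space Lb)
  + area_form p A2 B1 - area_form p A1 B2
  + z2 * (triple (space e1) (space L) (space Lb) + area_form p A1 Lb + area_form p L B1)
  - z1 * (triple (space e2) (space L) (space Lb) + area_form p A2 Lb + area_form p L B2)
  = (schw m p A1 e1 + schw m p A2 e2) * triple (space e1) (space e2) (space Lb)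
    - (schw m p A1 e1 * schw m p B2 e2 + schw m p A2 e2 * schw m p B1 e1
       - 2 * schw m p A1 e2 * schw m p B1 e2) * area_form p e1 e2.
Proof.
move=> A1L A2L B1Lb B2Lb A1Lb A2Lb B1L B2L hA hB.
have dA1 := frame_decomposition r0 w0 fr A1; have dA2 := frame_decomposition r0 w0 fr A2.
have dB1 := frame_decomposition r0 w0 fr B1; have dB2 := frame_decomposition r0 w0 fr B2.
move: dA1 dA2 dB1 dB2.
rewrite A1L A2L B1Lb B2Lb A1Lb A2Lb B1L B2L -hA -hB.
move: (schw m p A1 e1) (schw m p A1 e2) (schw m p A2 e2) => h11 h12 h22.
move: (schw m p B1 e1) (schw m p B1 e2) (schw m p B2 e2) => k11 k12 k22.
move=> -> -> -> ->; rewrite /area_form !linE !(tripleDm, tripleDr, tripleZm, tripleZr).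
by rewrite /triple; field.
Qed.

(** The part of d omega built from first derivatives of [f], L and Lb. *)
Definition connection_form p' X0 X1 A0 A1 B0 B1 N N' z0 z1 : R :=
  triple (space X0) (space A1) (space N') - triple (space X1) (space A0) (space N')
  + area_form p' A1 B0 - area_form p' A0 B1
  + z1 * (triple (space X0) (space N) (space N') + area_form p' A0 N' + area_form p' N B0)
  - z0 * (triple (space X1) (space N) (space N') + area_form p' A1 N' + area_form p' N B1).

(** An alternating form in two directions: passing from the coordinate fields
    to a frame multiplies it by the determinant. *)
Lemma connection_form_change a b c d p' X0 X1 A0 A1 B0 B1 N N' z0 z1 :
  connection_form p' (a *: X0 + b *: X1) (c *: X0 + d *: X1)
    (a *: A0 + b *: A1) (c *: A0 + d *: A1) (a *: B0 + b *: B1) (c *: B0 + d *: B1) N N'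
    (a * z0 + b * z1) (c * z0 + d * z1)
  = (a * d - b * c) * connection_form p' X0 X1 A0 A1 B0 B1 N N' z0 z1.
Proof.
rewrite /connection_form /area_form !linE.
rewrite !(tripleDl, tripleZl, tripleDm, tripleDr, tripleZm, tripleZr).
rewrite /triple; ring.
Qed.

Lemma area_form_curv_change a b c d X0 X1 :
  area_form p (curv m p (a *: X0 + b *: X1) (c *: X0 + d *: X1) L) Lb
  = (a * d - b * c) * area_form p (curv m p X0 X1 L) Lb.
Proof.
rewrite !area_form_curv // /area_form /ang /d_r !linE !schwE.
rewrite !(tripleDm, tripleZm); ring.
Qed.

End StructureAlgebra.

Section Structure.
Context {R : realType}.
Variables (m : R) (U : set 'rV[R]_2) (f L Lb : 'rV[R]_2 -> 'rV[R]_4).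
Hypotheses (oU : open U) (sf : smooth_on U f) (sL : smooth_on U L) (sLb : smooth_on U Lb)
  (rad0 : forall u, 0 < rad (f u)) (width0 : forall u, 0 < rad (f u) - 2 * m).
Implicit Types (u v w : 'rV[R]_2) (a b c d : 'I_2).

Lemma is_derive_potential v w u : U u ->
  is_derive u v (potential m f L Lb w)
   (triple (space ('D_v f u)) (space (covd m f L w u)) (space (Lb u))
    + area_form (f u) (covd m f (covd m f L w) v u) (Lb u)
    + area_form (f u) (covd m f L w u) (covd m f Lb v u)
    + ('D_v (zeta m f L Lb w) u * area_form (f u) (L u) (Lb u)
       + zeta m f L Lb w u *
         (triple (space ('D_v f u)) (space (L u)) (space (Lb u))
          + area_form (f u) (covd m f L v u) (Lb u)
          + area_form (f u) (L u) (covd m f Lb v u)))).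
Proof.
move=> Uu; apply: is_derive_addf.
  apply: (is_derive_area_form sf rad0 width0 Uu); last exact: smooth_is_derive v sLb Uu.
  exact: (is_derive_covd sf rad0 width0 v w sL Uu).
apply: is_derive_mulf.
  exact: (C1_is_derive v (C1_zeta oU sf rad0 width0 sL sLb w) Uu).
apply: (is_derive_area_form sf rad0 width0 Uu); last exact: smooth_is_derive v sLb Uu.
exact: smooth_is_derive v sL Uu.
Qed.

Lemma potential_arithmetic (t1 p1 q1 d1 z1 s1 t2 p2 q2 d2 z2 s2 pLB k : R) : p1 - p2 = k ->
  t1 + p1 + q1 + (d1 * pLB + z1 * s1) - (t2 + p2 + q2 + (d2 * pLB + z2 * s2))
  = (t1 - t2 + q1 - q2 + z1 * s1 - z2 * s2) + k + (d1 - d2) * pLB.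
Proof. by move=> <-; ring. Qed.

Lemma area_form_sub (p X Y Z : 'rV[R]_4) :
  area_form p (X - Y) Z = area_form p X Z - area_form p Y Z.
Proof. by rewrite /area_form /triple spaceD spaceN; do !rewrite mxE; ring. Qed.

(** Second derivatives of L enter through their commutator only. *)
Lemma d_potential u : U u ->
  'D_(delta_mx 0 0) (potential m f L Lb (delta_mx 0 1)) u
  - 'D_(delta_mx 0 1) (potential m f L Lb (delta_mx 0 0)) u
  = connection_form (f u) (pd 0 f u) (pd 1 f u)
      (covd m f L (delta_mx 0 0) u) (covd m f L (delta_mx 0 1) u)
      (covd m f Lb (delta_mx 0 0) u) (covd m f Lb (delta_mx 0 1) u) (L u) (Lb u)
      (zeta m f L Lb (delta_mx 0 0) u) (zeta m f L Lb (delta_mx 0 1) u)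
    + area_form (f u) (curv m (f u) (pd 0 f u) (pd 1 f u) (L u)) (Lb u)
    + dzeta m f L Lb (delta_mx 0 0) (delta_mx 0 1) u * area_form (f u) (L u) (Lb u).
Proof.
move=> Uu.
have [_ D1] := is_derive_potential (delta_mx 0 0) (delta_mx 0 1) Uu.
have [_ D2] := is_derive_potential (delta_mx 0 1) (delta_mx 0 0) Uu.
apply: (etrans (congr2 (fun x y => x - y) D1 D2)).
apply: potential_arithmetic.
have cc := covd_commute oU sf rad0 width0 (delta_mx 0 0) (delta_mx 0 1) sL Uu.
apply: (etrans _ (congr1 (fun X => area_form (f u) X (Lb u)) cc)).
exact/esym/area_form_sub.
Qed.

Lemma covd_of_constant V W (c : R) v u : smooth_on U V -> smooth_on U W -> U u ->
  (forall q, U q -> schw m (f q) (V q) (W q) = c) ->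
  schw m (f u) (covd m f V v u) (W u) + schw m (f u) (V u) (covd m f W v u) = 0.
Proof.
move=> sV sW Uu H.
have [_ <-] := is_derive_metric sf rad0 width0 Uu (smooth_is_derive v sV Uu)
  (smooth_is_derive v sW Uu).
have -> : 'D_v (fun q => schw m (f q) (V q) (W q)) u = 'D_v (fun=> c) u.
  by apply: near_eq_derive; have := near_open oU Uu; apply: filterS => q; exact: H.
exact: derive_cst.
Qed.

End Structure.

(** * The pointwise identity *)

Lemma sum2 (V : nmodType) (F : 'I_2 -> V) : \sum_(i < 2) F i = F 0 + F 1.
Proof.
by rewrite !big_ord_recl big_ord0 addr0; congr (F _ + F _); apply: val_inj.
Qed.

Lemma ord2P (i : 'I_2) : i = 0 \/ i = 1.
Proof. by case: i => [[|[|//]] hi]; [left|right]; apply: val_inj. Qed.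

Lemma double_eq0 (R : realType) (x : R) : x + x = 0 -> x = 0.
Proof. lra. Qed.

Lemma schw_sum2 (R : realType) (m : R) (p N : 'rV[R]_4) (c : 'I_2 -> 'I_2 -> R)
    (V : 'I_2 -> 'I_2 -> 'rV[R]_4) :
  schw m p (\sum_(a < 2) \sum_(b < 2) c a b *: V a b) N
  = \sum_(a < 2) \sum_(b < 2) c a b * schw m p (V a b) N.
Proof. by rewrite !sum2 !schwDl !schwZl. Qed.

Section FrameChange.
Context {R : realType}.
Variables (m : R) (p L Lb : 'rV[R]_4) (X e : 'I_2 -> 'rV[R]_4) (M : 'M[R]_2).
Hypotheses (r0 : 0 < rad p) (w0 : 0 < rad p - 2 * m).
Let G : 'M[R]_2 := \matrix_(a, b) schw m p (X a) (X b).
Hypotheses (eM : forall b, e b = \sum_(a < 2) M b a *: X a)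
  (fr : null_frame m p L Lb (e 0) (e 1)).
Implicit Types (Y Z N : 'rV[R]_4) (a b c d : 'I_2).

Lemma frame_comb b : e b = M b 0 *: X 0 + M b 1 *: X 1.
Proof. by rewrite eM sum2. Qed.

Lemma frame_gram b c : schw m p (e b) (e c) = (b == c)%:R.
Proof.
case: (ord2P b) => ->; case: (ord2P c) => ->;
  rewrite /= ?(frame_11 fr) ?(frame_22 fr) ?(frame_12 fr) //.
by rewrite schwC; exact: (frame_12 fr).
Qed.

Lemma frame_mx : M *m G *m M^T = 1%:M.
Proof.
apply/matrixP => b c; rewrite mxE [RHS]mxE -frame_gram !frame_comb.
rewrite !sum2 !mxE !sum2 !mxE !schwE; ring.
Qed.

Lemma frame_unit : G \in unitmx.
Proof.
have : M *m (G *m M^T) = 1%:M by rewrite mulmxA; exact: frame_mx.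
by move/mulmx1C; rewrite -mulmxA => /mulmx1_unit[].
Qed.

Lemma frame_inv : invmx G = M^T *m M.
Proof.
have H : G *m (M^T *m M) = 1%:M.
  rewrite mulmxA; apply: mulmx1C; rewrite mulmxA; exact: frame_mx.
by have := mulKmx frame_unit (M^T *m M); rewrite H mulmx1.
Qed.

Lemma frame_det : (\det M) ^+ 2 * \det G = 1.
Proof.
have := congr1 (fun A => \det A) frame_mx; rewrite !det_mulmx det_tr det1.
by move=> <-; ring.
Qed.

Lemma inv_entry a b : invmx G a b = M 0 a * M 0 b + M 1 a * M 1 b.
Proof. by rewrite frame_inv mxE sum2 !mxE. Qed.

(** Removing the tangential part does not affect the product with a normal
    vector. *)
Lemma schw_projection Y N : (forall a, schw m p N (X a) = 0) ->
  schw m p (Y - \sum_(a < 2) \sum_(b < 2) (invmx G a b * schw m p Y (X a)) *: X b) N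
  = schw m p Y N.
Proof.
move=> H; rewrite !sum2.
have H' a : schw m p (X a) N = 0 by rewrite schwC.
by rewrite schwDl schwNl !schwDl !schwZl !H' !mulr0 !addr0 oppr0 addr0.
Qed.

(** Without the tangential parts, the product is computed in the normal plane,
    spanned by [L] and [Lb]. *)
Lemma schw_normal_product Y Z :
  schw m p Y Z - \sum_(s < 2) (\sum_(c < 2) invmx G s c * schw m p Y (X c)) * schw m p Z (X s)
  = - 2^-1 * (schw m p Y L * schw m p Z Lb + schw m p Y Lb * schw m p Z L).
Proof.
rewrite (frame_inner r0 w0 fr) !sum2 !inv_entry !frame_comb !schwDr !schwZr; ring.
Qed.

Lemma riem_antisym Y Z Y' Z' : riem m p Y Z Y' Z' = - riem m p Z Y Y' Z' /\
  riem m p Y Z Y' Z' = - riem m p Y Z Z' Y'.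
Proof. by split; rewrite /riem /drdt; ring. Qed.

Lemma riem_frame : riem m p (e 0) (e 1) (e 0) (e 1) =
  (\det M) ^+ 2 * riem m p (X 0) (X 1) (X 0) (X 1).
Proof.
rewrite !frame_comb det22 /riem /drdt /ang /d_r !linE !schwE; ring.
Qed.

(** The contracted Gauss equation. The components of the second fundamental
    form paired with [L] and [Lb] are [lam] and [kap] in coordinates, and their
    transforms under [quad] in the frame [e]. *)
Lemma trace_curvature (lam kap : 'I_2 -> 'I_2 -> R) (Rm : 'I_2 -> 'I_2 -> 'I_2 -> 'I_2 -> R) :
  (forall a b, lam a b = lam b a) -> (forall a b, kap a b = kap b a) ->
  (forall a b c d, Rm a b c d = riem m p (X a) (X b) (X c) (X d)
     + - 2^-1 * (lam b d * kap a c + kap b d * lam a c)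
     - - 2^-1 * (lam a d * kap b c + kap a d * lam b c)) ->
  let quad (F : 'I_2 -> 'I_2 -> R) b c := \sum_(i < 2) \sum_(j < 2) M b i * M c j * F i j in
  \sum_(a < 2) \sum_(b < 2) \sum_(c < 2) \sum_(d < 2)
     invmx G a c * invmx G b d * Rm a b c d
  = 2 * riem m p (e 0) (e 1) (e 0) (e 1)
    - (quad lam 0 0 * quad kap 1 1 + quad lam 1 1 * quad kap 0 0
       - 2 * quad lam 0 1 * quad kap 0 1).
Proof.
move=> lamC kapC RmE /=; rewrite riem_frame det22.
have xx a c d : riem m p (X a) (X a) (X c) (X d) = 0.
  by have [E _] := riem_antisym (X a) (X a) (X c) (X d); apply: double_eq0; rewrite {1}E addNr.
have yy a b c : riem m p (X a) (X b) (X c) (X c) = 0.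
  by have [_ E] := riem_antisym (X a) (X b) (X c) (X c); apply: double_eq0; rewrite {1}E addNr.
have [s1 _] := riem_antisym (X 1) (X 0) (X 1) (X 0).
have [s2 _] := riem_antisym (X 1) (X 0) (X 0) (X 1).
have [_ s3] := riem_antisym (X 0) (X 1) (X 1) (X 0).
rewrite !sum2 !RmE !xx !yy s1 s2 s3 (lamC 1 0) (kapC 1 0) !inv_entry.
move: (riem m p (X 0) (X 1) (X 0) (X 1)) (lam 0 0) (lam 0 1) (lam 1 1) => K l00 l01 l11.
move: (kap 0 0) (kap 0 1) (kap 1 1) (M 0 0) (M 0 1) (M 1 0) (M 1 1).
move=> k00 k01 k11 m00 m01 m10 m11; by field.
Qed.

Variables (A B : 'I_2 -> 'rV[R]_4) (z : 'I_2 -> R) (lam kap : 'I_2 -> 'I_2 -> R).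
Hypotheses (AL : forall a, schw m p (A a) L = 0) (BB : forall a, schw m p (B a) Lb = 0)
  (AB : forall a, schw m p (A a) Lb = 2 * z a)
  (BL : forall a, schw m p (B a) L = - 2 * z a)
  (AX : forall a b, schw m p (A a) (X b) = - lam a b)
  (BX : forall a b, schw m p (B a) (X b) = - kap a b)
  (lamC : forall a b, lam a b = lam b a) (kapC : forall a b, kap a b = kap b a).

Lemma connection_form_frame :
  let quad (F : 'I_2 -> 'I_2 -> R) b c := \sum_(i < 2) \sum_(j < 2) M b i * M c j * F i j in
  \det M * connection_form p (X 0) (X 1) (A 0) (A 1) (B 0) (B 1) L Lb (z 0) (z 1)
  = - (\sum_(a < 2) \sum_(b < 2) invmx G a b * lam a b) * schw m p Lb partial_t
    - (quad lam 0 0 * quad kap 1 1 + quad lam 1 1 * quad kap 0 0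
       - 2 * quad lam 0 1 * quad kap 0 1) * (2^-1 * Qform p L Lb).
Proof.
rewrite /= det22 -connection_form_change -!frame_comb.
have AE b c : schw m p (M b 0 *: A 0 + M b 1 *: A 1) (e c) =
   - \sum_(i < 2) \sum_(j < 2) M b i * M c j * lam i j.
  by rewrite frame_comb !schwE !AX !sum2; ring.
have BE b c : schw m p (M b 0 *: B 0 + M b 1 *: B 1) (e c) =
   - \sum_(i < 2) \sum_(j < 2) M b i * M c j * kap i j.
  by rewrite frame_comb !schwE !BX !sum2; ring.
have := @connection_algebra _ m p L Lb (e 0) (e 1) r0 w0 fr
  (M 0 0 *: A 0 + M 0 1 *: A 1) (M 1 0 *: A 0 + M 1 1 *: A 1)
  (M 0 0 *: B 0 + M 0 1 *: B 1) (M 1 0 *: B 0 + M 1 1 *: B 1)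
  (M 0 0 * z 0 + M 0 1 * z 1) (M 1 0 * z 0 + M 1 1 * z 1).
rewrite -/(connection_form _ _ _ _ _ _ _ _ _ _ _) !AE !BE (area_form_tangent r0 w0 fr)
  (triple_tangent r0 w0 fr) => ->.
- rewrite !sum2 !inv_entry (lamC 1 0) (kapC 1 0); ring.
- by rewrite !schwE !AL; ring.
- by rewrite !schwE !AL; ring.
- by rewrite !schwE !BB; ring.
- by rewrite !schwE !BB; ring.
- by rewrite !schwE !AB; ring.
- by rewrite !schwE !AB; ring.
- by rewrite !schwE !BL; ring.
- by rewrite !schwE !BL; ring.
- by rewrite !sum2 (lamC 1 0); ring.
- by rewrite !sum2 (kapC 1 0); ring.
Qed.

(** In the sum of [connection_form_frame], [trace_curvature] and
    [curvature_charge], the products of second fundamental forms and the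
    multiples of Rbar(e1, e2, e1, e2) cancel. *)
Lemma minkowski_integrand (HL S dz : R) (Rm : 'I_2 -> 'I_2 -> 'I_2 -> 'I_2 -> R) :
  (forall a b c d, Rm a b c d = riem m p (X a) (X b) (X c) (X d)
     + - 2^-1 * (lam b d * kap a c + kap b d * lam a c)
     - - 2^-1 * (lam a d * kap b c + kap a d * lam b c)) ->
  HL = \sum_(a < 2) \sum_(b < 2) invmx G a b * lam a b ->
  S = \sum_(a < 2) \sum_(b < 2) \sum_(c < 2) \sum_(d < 2)
     invmx G a c * invmx G b d * Rm a b c d ->
  2 * (\det M * (connection_form p (X 0) (X 1) (A 0) (A 1) (B 0) (B 1) L Lb (z 0) (z 1)
     + area_form p (curv m p (X 0) (X 1) L) Lb + dz * area_form p L Lb))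
  = - 2 * (HL * schw m p Lb partial_t)
    + (S + 4^-1 * Rbar m p L Lb L Lb) * Qform p L Lb
    + (Rbar m p (e 0) (e 1) Lb L - 4 * (\det M * dz)) * Qform p (e 0) (e 1)
    - 4 * m * solid_angle p (e 0) (e 1).
Proof.
move=> RmE HE SE.
have T0 := trace_curvature lamC kapC RmE; rewrite -SE /= in T0.
have C := connection_form_frame; rewrite -HE /= in C.
have Q := curvature_charge r0 w0 fr.
have cc : area_form p (curv m p (e 0) (e 1) L) Lb = \det M * area_form p (curv m p (X 0) (X 1) L) Lb.
  by rewrite det22 -area_form_curv_change // -!frame_comb.
rewrite cc in Q; rewrite -(Rbar_riem _ _ _ _ r0 w0) in T0.
rewrite (mulrDr (\det M) (_ + _)) (mulrDr (\det M) (connection_form _ _ _ _ _ _ _ _ _ _ _)) C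
  (area_form_normal r0 w0 fr).
have T x y : x = 2 * Rbar m p (e 0) (e 1) (e 0) (e 1) - y ->
   S = x -> y = 2 * Rbar m p (e 0) (e 1) (e 0) (e 1) - S by move=> -> ->; ring.
rewrite (T _ _ erefl T0).
move: Q.
move: (area_form p (curv m p (X 0) (X 1) L) Lb) => c.
move: (Rbar m p (e 0) (e 1) (e 0) (e 1)) => r3; move: (Qform p L Lb) => q2.
move: (Rbar m p L Lb L Lb) => r1; move: (Rbar m p (e 0) (e 1) Lb L) => r2.
move: (Qform p (e 0) (e 1)) => q1; move: (solid_angle p (e 0) (e 1)) => s.
move: (schw m p Lb partial_t) (\det M) => t D Q.
transitivity (2 * (- HL * t - (2 * r3 - S) * (2^-1 * q2) + dz * D * (- 2 * q1)) + 2 * (D * c)).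
  by ring.
have -> : 2 * (D * c) = 4^-1 * r1 * q2 + r2 * q1 - 4 * m * s + 2 * r3 * q2 by rewrite -Q; ring.
by field.
Qed.

End FrameChange.

Section Pointwise.
Context {R : realType}.
Variables (m : R) (U : set 'rV[R]_2) (f L Lb : 'rV[R]_2 -> 'rV[R]_4).
Hypotheses (oU : open U) (sf : smooth_on U f) (sL : smooth_on U L) (sLb : smooth_on U Lb)
  (rad0 : forall u, 0 < rad (f u)) (width0 : forall u, 0 < rad (f u) - 2 * m)
  (Gunit : forall u, U u -> induced_mx m f u \in unitmx)
  (LL : forall u, U u -> schw m (f u) (L u) (L u) = 0)
  (BB : forall u, U u -> schw m (f u) (Lb u) (Lb u) = 0)
  (LB : forall u, U u -> schw m (f u) (L u) (Lb u) = -2)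
  (Lf : forall u a, U u -> schw m (f u) (L u) (pd a f u) = 0)
  (Bf : forall u a, U u -> schw m (f u) (Lb u) (pd a f u) = 0).
Implicit Types (a b c d : 'I_2).

Lemma covd_null N a u : smooth_on U N -> U u ->
  (forall q, U q -> schw m (f q) (N q) (N q) = 0) ->
  schw m (f u) (covd m f N (delta_mx 0 a) u) (N u) = 0.
Proof.
move=> sN Uu H; have E := covd_of_constant oU sf rad0 width0 (delta_mx 0 a) sN sN Uu H.
apply: double_eq0; apply: (etrans _ E).
by congr (_ + _); exact: schwC.
Qed.

(** Differentiate <N, d_b f> = 0. *)
Lemma covd_normal N a b u : smooth_on U N -> U u ->
  (forall q c, U q -> schw m (f q) (N q) (pd c f q) = 0) ->
  schw m (f u) (covd m f N (delta_mx 0 a) u) (pd b f u)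
  = - schw m (f u) (second_deriv m f a b u) (N u).
Proof.
move=> sN Uu H; have E := covd_of_constant oU sf rad0 width0 (delta_mx 0 a) sN
  (smooth_derive (delta_mx 0 b) sf) Uu (fun q => H q b).
apply/eqP; rewrite -addr_eq0; apply/eqP; apply: (etrans _ E).
by congr (_ + _); exact: schwC.
Qed.

Lemma covd_zeta a u : schw m (f u) (covd m f L (delta_mx 0 a) u) (Lb u)
   = 2 * zeta m f L Lb (delta_mx 0 a) u.
Proof.
rewrite /zeta; move: (schw _ _ _ _) => x; by rewrite mulrA mulfV ?mul1r ?pnatr_eq0.
Qed.

Lemma covd_zeta' a u : U u -> schw m (f u) (covd m f Lb (delta_mx 0 a) u) (L u)
   = - 2 * zeta m f L Lb (delta_mx 0 a) u.
Proof.
move=> Uu; have E := covd_of_constant oU sf rad0 width0 (delta_mx 0 a) sL sLb Uu LB.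
rewrite mulNr -covd_zeta; apply/eqP; rewrite -addr_eq0; apply/eqP.
by apply: (etrans _ E); rewrite addrC; congr (_ + _); exact: schwC.
Qed.

Variables (u : 'rV[R]_2) (M : 'M[R]_2) (e : 'I_2 -> 'rV[R]_4).
Hypotheses (Uu : U u) (eM : forall b, e b = \sum_(a < 2) M b a *: pd a f u)
  (fr : null_frame m (f u) (L u) (Lb u) (e 0) (e 1)).

Let lam a b := schw m (f u) (second_deriv m f a b u) (L u).
Let kap a b := schw m (f u) (second_deriv m f a b u) (Lb u).
Let G := induced_mx m f u.
Let X a := pd a f u.

Lemma normal_productE a c b d : normal_product m f a c b d u
  = - 2^-1 * (lam b d * kap a c + kap b d * lam a c).
Proof.
have E := schw_normal_product (rad0 u) (width0 u) eM fr (second_deriv m f b d u) (second_deriv m f a c u).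
apply: (etrans _ E); rewrite /normal_product; congr (_ - _).
apply: eq_bigr => s _; congr (_ * _).
exact: (christoffel_induced oU sf rad0 width0 Gunit _ _ _ Uu).
Qed.

Lemma mean_curvature_inner : schw m (f u) (mean_curvature m f u) (L u) =
  \sum_(a < 2) \sum_(b < 2) invmx G a b * lam a b.
Proof.
have P Y := @schw_projection _ m (f u) X Y (L u) (fun a => Lf a Uu).
apply: (etrans (schw_sum2 _ _ _ _ _)).
apply: eq_bigr => a _; apply: eq_bigr => b _; apply: (congr1 (fun x => _ * x)); exact: P.
Qed.

(** The factor [\det M] turns the coordinate expression of d omega into its
    value on the frame [e]. *)
Lemma local_identity :
  2 * (\det M * ('D_(delta_mx 0 0) (potential m f L Lb (delta_mx 0 1)) u
                 - 'D_(delta_mx 0 1) (potential m f L Lb (delta_mx 0 0)) u))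
  = - 2 * (schw m (f u) (mean_curvature m f u) (L u) * schw m (f u) (Lb u) partial_t)
    + (scalar_curvature (induced_mx m f) u + 4^-1 * Rbar m (f u) (L u) (Lb u) (L u) (Lb u))
        * Qform (f u) (L u) (Lb u)
    + (Rbar m (f u) (e 0) (e 1) (Lb u) (L u)
        - 4 * (\det M * dzeta m f L Lb (delta_mx 0 0) (delta_mx 0 1) u))
        * Qform (f u) (e 0) (e 1)
    - 4 * m * solid_angle (f u) (e 0) (e 1).
Proof.
apply: (etrans (congr1 (fun x => 2 * (\det M * x))
  (d_potential oU sf sL sLb rad0 width0 Uu))).
apply: (@minkowski_integrand _ m (f u) (L u) (Lb u) X e M (rad0 u) (width0 u) eM fr
  (fun a => covd m f L (delta_mx 0 a) u) (fun a => covd m f Lb (delta_mx 0 a) u)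
  (fun a => zeta m f L Lb (delta_mx 0 a) u) lam kap _ _ _ _ _ _ _ _ _ _ _
  (fun a b c d => riemann (induced_mx m f) a b c d u)).
- by move=> a; exact: covd_null.
- by move=> a; exact: covd_null.
- by move=> a; exact: covd_zeta.
- by move=> a; exact: covd_zeta'.
- by move=> a b; exact: (covd_normal _ _ sL Uu (fun q c => @Lf q c)).
- by move=> a b; exact: (covd_normal _ _ sLb Uu (fun q c => @Bf q c)).
- by move=> a b; apply: (congr1 (fun Y => schw m (f u) Y (L u))); exact: (second_derivC oU sf).
- by move=> a b; apply: (congr1 (fun Y => schw m (f u) Y (Lb u))); exact: (second_derivC oU sf).
- move=> a b c d.
  apply: (etrans (gauss_equation oU sf rad0 width0 Gunit a b c d Uu)).
  apply: (congr2 (fun x y => x - y)); last exact: normal_productE.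
  by apply: (congr1 (fun x => _ + x)); exact: normal_productE.
- exact: mean_curvature_inner.
- by [].
Qed.

End Pointwise.

(** * Integration against a density *)

Section Density.
Local Open Scope ereal_scope.
Context d d' (X : measurableType d) (T : measurableType d') (R : realType).
Variables (lam : {measure set X -> \bar R}) (mu : {measure set T -> \bar R}).
Variables (c : X -> T) (g : X -> R) (W : set T).
Hypotheses (mW : measurable W) (mc : measurable_fun setT c)
  (mg : measurable_fun setT g) (g0 : forall x, (0 <= g x)%R)
  (density : forall A, measurable A -> mu (A `&` W) = \int[lam]_(x in c @^-1` A) (g x)%:E).

Import HBNNSimple.

Let mgE : measurable_fun setT (fun x => (g x)%:E). Proof. exact/measurable_EFinP. Qed.

Let mpre A : measurable A -> measurable (c @^-1` A).
Proof. by move=> mA; rewrite -[_ @^-1` _]setTI; exact: mc. Qed.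

(** The hypothesis is the case of indicator functions; conclude by linearity and
    monotone convergence. *)
Lemma ge0_integral_density (f : T -> \bar R) : (forall x, 0 <= f x) ->
  measurable_fun setT f ->
  \int[mu]_(p in W) f p = \int[lam]_x (f (c x) * (g x)%:E).
Proof.
move=> f0 mf.
pose h := nnsfun_approx (@measurableT _ T) mf.
have mh n : measurable_fun setT (h n) by exact/measurable_funP.
have fE x : f x = lim ((EFin \o h n) x @[n --> \oo]).
  by apply/esym/cvg_lim => //; exact: cvg_nnsfun_approx.
have -> : \int[mu]_(x in W) f x = lim (\int[mu]_(x in W) (EFin \o h n) x @[n --> \oo]).
  under eq_integral => x _ do rewrite fE.
  apply: monotone_convergence => //.
  - by move=> n; apply/measurable_EFinP; exact: measurable_funTS.
  - by move=> n x _ //=; rewrite lee_fin.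
  - by move=> x _ a b ab; rewrite lee_fin; exact/lefP/nd_nnsfun_approx.
have -> : \int[lam]_x (f (c x) * (g x)%:E) =
    lim (\int[lam]_x ((h n (c x))%:E * (g x)%:E) @[n --> \oo]).
  have fg x : f (c x) * (g x)%:E = lim ((h n (c x))%:E * (g x)%:E @[n --> \oo]).
    apply/esym/cvg_lim => //; apply: cvgeZr => //; exact: cvg_nnsfun_approx.
  under eq_integral => x _ do rewrite fg.
  apply: monotone_convergence => //.
  - move=> n; apply: emeasurable_funM => //; apply/measurable_EFinP.
    exact: measurableT_comp.
  - by move=> n x _ /=; rewrite mule_ge0 ?lee_fin.
  - move=> x _ a b ab /=; rewrite lee_wpmul2r ?lee_fin //.
    exact/lefP/nd_nnsfun_approx.
suff suf n : \int[mu]_(x in W) (EFin \o h n) x = \int[lam]_x ((h n (c x))%:E * (g x)%:E).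
  by under eq_fun do rewrite suf.
transitivity (\int[mu]_(x in W)
   (\sum_(y \in range (h n)) (y * \1_(h n @^-1` [set y]) x)%:E)).
  by apply: eq_integral => t tE; rewrite /= fimfunE -fsumEFin.
have indich m (r : R) : measurable_fun setT (fun x => (r * \1_(h m @^-1` [set r]) x)%:E).
  by apply: (measurable_comp measurableT) => //; exact: measurable_funM.
rewrite ge0_integral_fsum//; last 2 first.
  - by move=> y; exact: measurable_funTS.
  - by move=> y x _; exact: nnfun_muleindic_ge0.
transitivity (\int[lam]_x (\sum_(y \in range (h n))
    (y * \1_(h n @^-1` [set y]) (c x))%:E * (g x)%:E)); last first.
  apply: eq_integral => x _.
  rewrite -ge0_mule_fsuml => [|y]; last exact: nnfun_muleindic_ge0.
  by rewrite fsumEFin // -(fimfunE _ (c x)).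
have mi y : measurable_fun setT (fun x => (y * \1_(h n @^-1` [set y]) (c x))%:E).
  exact: (measurableT_comp (indich n y) mc).
rewrite ge0_integral_fsum//; last 2 first.
  - by move=> y; apply: emeasurable_funM.
  - by move=> y x _; apply: mule_ge0; [rewrite EFinM; exact: nnfun_muleindic_ge0|rewrite lee_fin].
apply: eq_fsbigr => r rhn.
under eq_integral do rewrite EFinM.
have mr : measurable (h n @^-1` [set r]) by exact: measurable_sfunP.
rewrite integralZl_indic_nnsfun// integral_indic// density //.
under [RHS]eq_integral do rewrite EFinM -muleA.
have r0 : (0 <= r)%R by move: rhn; rewrite inE => -[x _ <-].
rewrite ge0_integralZl//; last 2 first.
- apply: emeasurable_funM => //; apply/measurable_EFinP.
  by apply: (measurableT_comp _ mc); exact: measurable_indic.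
- by move=> x _; rewrite mule_ge0 // lee_fin.
congr (_ * _); rewrite [LHS]integral_mkcond; apply: eq_integral => x _.
rewrite /patch /= indicE /=; case: ifPn => hx.
  by rewrite mem_set ?mul1e //; exact: set_mem hx.
by rewrite memNset ?mul0e // => H; move/negP: hx; apply; exact: mem_set.
Qed.

Lemma integral_density (f : T -> R) : measurable_fun setT f ->
  \int[mu]_(p in W) (f p)%:E = \int[lam]_x (f (c x) * g x)%:E.
Proof.
move=> mf; have mfE : measurable_fun setT (fun x => (f x)%:E) by exact/measurable_EFinP.
rewrite integralE [RHS]integralE.
rewrite (@ge0_integral_density ((EFin \o f)^\+)) //; last exact: measurable_funepos.
rewrite (@ge0_integral_density ((EFin \o f)^\-)) //; last exact: measurable_funeneg.
congr (_ - _); apply: eq_integral => x _.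
  by rewrite !funeposE /= -!EFin_max -EFinM; congr (_%:E); rewrite maxr_pMl // mul0r.
by rewrite !funenegE /= -!EFin_max -EFinM; congr (_%:E); rewrite maxr_pMl // mul0r mulNr.
Qed.

End Density.

(** * Green's formula on a rectangle *)

Section Plane.
Context {R : realType}.
Implicit Types (O U : set (R * R)) (z : R * R).

Let MR := measurableTypeR R.
Let MRR := (MR * MR)%type.

(** An open subset of the plane is the union of the countably many open
    rectangles with rational corners that it contains. *)
Lemma open_measurable_prod U : open U -> @measurable _ MRR U.
Proof.
move=> oU.
pose box (a b c d : rat) : set (R * R) :=
  [set` `]ratr a, (ratr b : R)[] `*` [set` `]ratr c, (ratr d : R)[].
pose sub a b c d := if pselect (box a b c d `<=` U) then box a b c d else set0.
have -> : U = \bigcup_a \bigcup_b \bigcup_c \bigcup_d sub a b c d.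
  apply/seteqP; split=> [z Uz|z [a _ [b _ [c _ [d _]]]]]; last first.
    by rewrite /sub; case: pselect => // H /H.
  have [e /= e0 He] := (nbhs_ballP _ _).1 (open_nbhs_nbhs (conj oU Uz)).
  have l x : x - e < x by rewrite ltrBlDr ltrDl.
  have r x : x < x + e by rewrite ltrDl.
  have [a /=] := rat_in_itvoo (l z.1); rewrite in_itv /= => /andP[a1 a2].
  have [b /=] := rat_in_itvoo (r z.1); rewrite in_itv /= => /andP[b1 b2].
  have [c /=] := rat_in_itvoo (l z.2); rewrite in_itv /= => /andP[c1 c2].
  have [d /=] := rat_in_itvoo (r z.2); rewrite in_itv /= => /andP[d1 d2].
  exists a => //; exists b => //; exists c => //; exists d => //.
  have S : box a b c d `<=` U.
    case=> y1 y2 [] /=; rewrite !in_itv /= => /andP[ya yb] /andP[yc yd].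
    apply: He; split; rewrite -ball_normE /ball_ /= ltr_norml; apply/andP; split; lra.
  rewrite /sub; case: pselect => // H.
  by split; rewrite /= in_itv /=; apply/andP.
apply: bigcupT_measurable_rat => a; apply: bigcupT_measurable_rat => b.
apply: bigcupT_measurable_rat => c; apply: bigcupT_measurable_rat => d.
rewrite /sub; case: pselect => H; last exact: measurable0.
by apply: measurableX; exact: measurable_itv.
Qed.

Lemma continuous_measurable_prod (f : R * R -> R) O (D : set MRR) :
  open O -> measurable D -> D `<=` O -> (forall z, O z -> {for z, continuous f}) ->
  measurable_fun D (f : MRR -> R).
Proof.
move=> oO mD DO cf; apply: (measurability _ (RGenOpens.measurableE R)).
move=> _ [_ [a [b ->] <-]].
rewrite (_ : D `&` _ = D `&` (O `&` f @^-1` `]a, b[)); last first.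
  by apply/seteqP; split=> z [Dz]; [move=> fz; split => //; split => //; exact: DO|case].
apply: measurableI => //; apply: open_measurable_prod.
rewrite openE => z [Oz fz]; rewrite /interior.
apply: filterI; first by apply: open_nbhs_nbhs.
exact: (cf z Oz _ (open_nbhs_nbhs (conj (interval_open _ _) fz))).
Qed.

Lemma row2E z : row2 z = z.1 *: delta_mx 0 0 + z.2 *: delta_mx 0 1.
Proof.
apply/rowP => i; rewrite !mxE eqxx /=.
by have [->|->] := ord2P i; rewrite /= ?mulr1 ?mulr0 ?addr0 ?add0r.
Qed.

Lemma row2_continuous : continuous (@row2 R).
Proof.
have -> : @row2 R = (fun z => z.1 *: (delta_mx 0 0 : 'rV[R]_2) + z.2 *: delta_mx 0 1).
  by apply/funext => z; exact: row2E.
move=> z; apply: cvgD.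
  by apply: cvgZr_tmp; exact: cvg_fst.
by apply: cvgZr_tmp; exact: cvg_snd.
Qed.

Section Box.
Variables (a1 b1 a2 b2 : R).
Hypotheses (ab1 : a1 < b1) (ab2 : a2 < b2).
Let I : set R := `[a1, b1].
Let J : set R := `[a2, b2].
Let Q : set MRR := I `*` J.
Let leb := @lebesgue_measure R.

Lemma box_measurable : measurable Q.
Proof. by apply: measurableX; exact: measurable_itv. Qed.

Lemma box_finite : ((leb \x leb)%E Q < +oo)%E.
Proof.
rewrite product_measure1E; [|exact: measurable_itv|exact: measurable_itv].
by rewrite /leb /= !lebesgue_measure_itv /= !lte_fin ab1 ab2 -!EFinB -EFinM ltry.
Qed.

Lemma box_integrable (g : 'rV[R]_2 -> R) (O : set 'rV[R]_2) :
  open O -> (forall z, Q z -> O (row2 z)) -> (forall u, O u -> {for u, continuous g}) ->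
  (leb \x leb)%E.-integrable Q (EFin \o (g \o @row2 R)).
Proof.
move=> oO QO cg.
pose O' := @row2 R @^-1` O.
have oO' : open O' by apply: open_comp => // z _; exact: row2_continuous.
have cg' z : O' z -> {for z, continuous (g \o @row2 R)}.
  by move=> Oz; apply: continuous_comp; [exact: row2_continuous|exact: cg].
apply: measurable_bounded_integrable; [exact: box_measurable|exact: box_finite| |].
  exact: (continuous_measurable_prod oO' box_measurable QO cg').
have cQ : compact Q by apply: compact_setX; exact: segment_compact.
have : compact ((g \o @row2 R) @` Q).
  apply: continuous_compact => //; apply: continuous_in_subspaceT => z.
  by rewrite inE => /QO; exact: cg'.
move/compact_bounded => [M [Mr HM]]; exists M; split => // x Mx z Qz.
by apply: (HM x Mx); exists z.
Qed.

Lemma integral_box_rows (h : MRR -> R) :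
  (leb \x leb)%E.-integrable Q (EFin \o h) ->
  (forall y, J y -> (\int[leb]_(x in I) (h (x, y))%:E = 0)%E) ->
  (\int[leb \x leb]_(z in Q) (h z)%:E = 0)%E.
Proof.
move=> ih h0.
have mQ := box_measurable.
have ik := (@integrable_mkcond _ MRR R (leb \x leb)%E Q (EFin \o h) mQ).1 ih.
rewrite integral_mkcond -integral21_prod_meas1 //.
rewrite integral0_eq // => y _; rewrite /fubini_G.
have [Jy|Jy] := pselect (J y).
  rewrite -[RHS](h0 y Jy) [RHS]integral_mkcond; apply: eq_integral => x _.
  rewrite /patch /=; have [Ix|Ix] := pselect (I x).
    by rewrite mem_set ?(mem_set Ix).
  by rewrite !memNset // => -[].
rewrite integral0_eq // => x _; rewrite /patch memNset // => -[_] /=.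
exact: Jy.
Qed.

Lemma integral_box_columns (h : MRR -> R) :
  (leb \x leb)%E.-integrable Q (EFin \o h) ->
  (forall x, I x -> (\int[leb]_(y in J) (h (x, y))%:E = 0)%E) ->
  (\int[leb \x leb]_(z in Q) (h z)%:E = 0)%E.
Proof.
move=> ih h0.
have mQ := box_measurable.
have ik := (@integrable_mkcond _ MRR R (leb \x leb)%E Q (EFin \o h) mQ).1 ih.
rewrite integral_mkcond -integral12_prod_meas1 //.
rewrite integral0_eq // => x _; rewrite /fubini_F.
have [Ix|Ix] := pselect (I x).
  rewrite -[RHS](h0 x Ix) [RHS]integral_mkcond; apply: eq_integral => y _.
  rewrite /patch /=; have [Jy|Jy] := pselect (J y).
    by rewrite mem_set ?(mem_set Jy).
  by rewrite !memNset // => -[].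
rewrite integral0_eq // => y _; rewrite /patch memNset // => -[] /= Hx _.
exact: Ix.
Qed.

(** The fundamental theorem of calculus for a function vanishing at both ends
    of a segment. *)
Lemma integral_derivative_line (O : set 'rV[R]_2) (P : 'rV[R]_2 -> R) (u v : 'rV[R]_2) (a b : R) :
  a < b -> open O -> C1 O P -> (forall s, s \in `[a, b] -> O (s *: v + u)) ->
  P (a *: v + u) = 0 -> P (b *: v + u) = 0 ->
  (\int[leb]_(s in `[a, b]) ('D_v P (s *: v + u))%:E = 0)%E.
Proof.
move=> ab oO cP HO Pa Pb.
have lc (s : R) : {for s, continuous (fun s : R => s *: v + u)}.
  apply: cvgD; last exact: cvg_cst.
  by apply: cvgZr_tmp; exact: cvg_id.
have dP s : s \in `[a, b] -> is_derive s 1 (fun s : R => P (s *: v + u)) ('D_v P (s *: v + u)).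
  by move=> /HO Os; apply: is_derive_line; exact: C1_is_derive cP Os.
have cPs s : s \in `[a, b] -> {for s, continuous (fun s : R => P (s *: v + u))}.
  move=> /HO Os; apply: (@continuous_comp _ _ _ (fun s : R => s *: v + u) P); first exact: lc.
  exact: (C1_continuous cP Os).
rewrite (@continuous_FTC2 _ _ (fun s => P (s *: v + u)) a b ab).
- by rewrite Pa Pb subee.
- apply: continuous_in_subspaceT => s; rewrite inE => /HO Os.
  apply: (@continuous_comp _ _ _ (fun s : R => s *: v + u) ('D_v P)); first exact: lc.
  exact: (cP _ Os).2.
- split.
  + by move=> s sab; have [] := dP s (subset_itv_oo_cc sab).
  + by apply: cvg_at_right_filter; apply: cPs; rewrite in_itv /= lexx ltW.
  + by apply: cvg_at_left_filter; apply: cPs; rewrite in_itv /= lexx ltW.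
- by move=> s sab; rewrite derive1E; have [_ ->] := dP s (subset_itv_oo_cc sab).
Qed.

(** Each of the two derivatives integrates to zero along the parallels to one
    side of the rectangle. *)
Lemma green_box (O : set 'rV[R]_2) (P0 P1 : 'rV[R]_2 -> R) :
  open O -> (forall z, Q z -> O (row2 z)) -> C1 O P0 -> C1 O P1 ->
  (forall z, Q z -> z.1 = a1 \/ z.1 = b1 \/ z.2 = a2 \/ z.2 = b2 ->
     P0 (row2 z) = 0 /\ P1 (row2 z) = 0) ->
  (\int[leb \x leb]_(z in Q)
    ('D_(delta_mx 0 0) P1 (row2 z) - 'D_(delta_mx 0 1) P0 (row2 z))%:E = 0)%E.
Proof.
move=> oO QO c0 c1 bd.
have i1 : (leb \x leb)%E.-integrable Q (EFin \o ('D_(delta_mx 0 0) P1 \o @row2 R)).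
  by apply: (box_integrable oO QO) => u Ou; exact: (c1 u Ou).2.
have i0 : (leb \x leb)%E.-integrable Q (EFin \o ('D_(delta_mx 0 1) P0 \o @row2 R)).
  by apply: (box_integrable oO QO) => u Ou; exact: (c0 u Ou).2.
have mQ := box_measurable.
have -> : (\int[leb \x leb]_(z in Q)
    ('D_(delta_mx 0 0) P1 (row2 z) - 'D_(delta_mx 0 1) P0 (row2 z))%:E =
  \int[leb \x leb]_(z in Q) ('D_(delta_mx 0 0) P1 (row2 z))%:E -
  \int[leb \x leb]_(z in Q) ('D_(delta_mx 0 1) P0 (row2 z))%:E)%E.
  exact: (integralB_EFin mQ i1 i0).
have a1I : I a1 by rewrite /I /= in_itv /= lexx ltW.
have b1I : I b1 by rewrite /I /= in_itv /= lexx ltW.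
have a2J : J a2 by rewrite /J /= in_itv /= lexx ltW.
have b2J : J b2 by rewrite /J /= in_itv /= lexx ltW.
rewrite (integral_box_rows (h := fun z => 'D_(delta_mx 0 0) P1 (row2 z)) i1); last first.
  move=> y Jy; under eq_integral do rewrite row2E /=.
  apply: (integral_derivative_line ab1 oO c1).
  - by move=> s sI; have := QO (s, y) (conj sI Jy); rewrite row2E.
  - by have [_] := bd (a1, y) (conj a1I Jy) (or_introl erefl); rewrite row2E.
  - by have [_] := bd (b1, y) (conj b1I Jy) (or_intror (or_introl erefl)); rewrite row2E.
rewrite (integral_box_columns (h := fun z => 'D_(delta_mx 0 1) P0 (row2 z)) i0); last first.
  move=> x Ix; under eq_integral do rewrite row2E /= addrC.
  apply: (integral_derivative_line ab2 oO c0).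
  - by move=> s sJ; have := QO (x, s) (conj Ix sJ); rewrite row2E /= addrC.
  - have [] := bd (x, a2) (conj Ix a2J) (or_intror (or_intror (or_introl erefl))).
    by rewrite row2E /= addrC.
  - have [] := bd (x, b2) (conj Ix b2J) (or_intror (or_intror (or_intror erefl))).
    by rewrite row2E /= addrC.
by rewrite sube0.
Qed.

End Box.
End Plane.

(** * The area measure on coordinate squares *)

Section SurfaceMeasure.
Context {R : realType}.
Variables (Sigma : ptopologicalType) (A : set (@chart R Sigma)).
Hypothesis hS : closed_oriented_surface A.
Variable sig : @chart R Sigma -> 'rV[R]_2 -> R.
Hypotheses (sig_gt0 : forall c, A c -> forall u, chart_dom c u -> 0 < sig c u)
  (sig_cont : forall c, A c -> forall u, chart_dom c u -> {for u, continuous (sig c)}).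
Variable mu : {measure set (borel Sigma) -> \bar R}.
Hypothesis hmu : forall c, A c -> forall B : set (borel Sigma), measurable B ->
    B `<=` c @` chart_dom c ->
    mu B = (\int[lebesgue_measure \x lebesgue_measure]_(z in
              [set z | chart_dom c (row2 z) /\ B (c (row2 z))]) (sig c (row2 z))%:E)%E.

Let MR := measurableTypeR R.
Let MRR := (MR * MR)%type.
Let leb2 := (@lebesgue_measure R \x @lebesgue_measure R)%E.

Definition square (u0 : 'rV[R]_2) (r : R) : set 'rV[R]_2 :=
  [set u | forall i, `|u 0 i - u0 0 i| <= r].
Definition open_square (u0 : 'rV[R]_2) (r : R) : set 'rV[R]_2 :=
  [set u | forall i, `|u 0 i - u0 0 i| < r].
(** The set [square] as a subset of the product space carrying Lebesgue measure. *)
Definition square2 (u0 : 'rV[R]_2) (r : R) : set MRR :=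
  `[u0 0 0 - r, u0 0 0 + r] `*` `[u0 0 1 - r, u0 0 1 + r].

Lemma square2E u0 r z : square2 u0 r z <-> square u0 r (row2 z).
Proof.
rewrite /square2 /square /= !in_itv /=; split.
  move=> [] /andP[x1 x2] /andP[y1 y2] i; rewrite !mxE.
  by have [->|->] := ord2P i; rewrite /= ler_norml; apply/andP; split; lra.
move=> H; have := H 0; have := H 1; rewrite !mxE /= !ler_norml.
by move=> /andP[y1 y2] /andP[x1 x2]; split; apply/andP; split; lra.
Qed.

Lemma open_square_ball u0 r : 0 < r -> open_square u0 r = ball u0 r.
Proof.
move=> r0; apply/seteqP; split=> u.
  move=> H; split => // i j; rewrite (ord1 i) -ball_normE /ball_ /= distrC; exact: H.
by move=> [_ H] i; have := H 0 i; rewrite -ball_normE /ball_ /= distrC.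
Qed.

Lemma open_squareP u0 r : 0 < r -> open (open_square u0 r).
Proof. by move=> r0; rewrite open_square_ball //; exact: ball_open. Qed.

Lemma square_compact u0 r : compact (square u0 r).
Proof.
have -> : square u0 r = [set v : 'rV[R]_2 | forall i, `[u0 0 i - r, u0 0 i + r]%classic (v ord0 i)].
  apply/seteqP; split=> u H i; have := H i; rewrite /= in_itv /= ler_norml.
    by move=> /andP[h1 h2]; apply/andP; split; lra.
  by move=> /andP[h1 h2]; apply/andP; split; lra.
by apply: (@rV_compact R 2 (fun i => `[u0 0 i - r, u0 0 i + r]%classic)) => i; exact: segment_compact.
Qed.

(** The image of such a square is compact, hence closed and measurable; the
    squares centered at the points of the surface replace charts in the
    partition of unity. *)
Record coord_square := CoordSquare {
  square_chart : @chart R Sigma ;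
  square_center : 'rV[R]_2 ;
  square_size : R ;
  square_atlas : A square_chart ;
  square_size_gt0 : 0 < square_size ;
  square_sub : square square_center square_size `<=` chart_dom square_chart }.

Lemma square_exists p : exists P : coord_square, square_chart P (square_center P) = p.
Proof.
have [c Ac [u uc cu]] := surface_cover hS p.
have oc := chart_dom_open hS Ac.
have [e /= e0 He] := (nbhs_ballP _ _).1 (open_nbhs_nbhs (conj oc uc)).
have e20 : 0 < e / 2 by lra.
have sub : square u (e / 2) `<=` chart_dom c.
  move=> v Hv; apply: He; rewrite -open_square_ball // => i.
  by apply: le_lt_trans (Hv i) _; lra.
by exists (CoordSquare Ac e20 sub).
Qed.

Section OnePatch.
Variable P : coord_square.
Let c := square_chart P.
Let u0 := square_center P.
Let r := square_size P.
Let Ac := square_atlas P.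
Let r0 := square_size_gt0 P.
Let Q := square2 u0 r.
Let W : set (borel Sigma) := c @` square u0 r.

Lemma square_in z : Q z -> chart_dom c (row2 z).
Proof. by move=> /square2E; exact: square_sub. Qed.

Lemma square_image_closed : closed W.
Proof.
apply: compact_closed; first exact: (surface_hausdorff hS).
apply: continuous_compact; last exact: square_compact.
apply: continuous_in_subspaceT => u; rewrite inE => Hu.
by apply: (chart_continuous hS Ac); exact: square_sub Hu.
Qed.

Lemma square_image_measurable : measurable W.
Proof.
rewrite -(setCK W); apply: measurableC; apply: sub_sigma_algebra.
exact/closed_openC/square_image_closed.
Qed.

Lemma square_inner_open : open (c @` open_square u0 r).
Proof.
apply: (chart_open_map hS Ac); first exact: open_squareP.
by move=> u Hu; apply: square_sub => i; exact/ltW/Hu.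
Qed.

Let Qm : measurable Q.
Proof. exact: box_measurable. Qed.

Let cc (z : MRR) : borel Sigma := if pselect (Q z) then c (row2 z) else point.
Let gg (z : MRR) : R := if pselect (Q z) then sig c (row2 z) else 0.

Let odom : open (@row2 R @^-1` chart_dom c).
Proof.
apply: open_comp; first by move=> z _; exact: row2_continuous.
exact: (chart_dom_open hS Ac).
Qed.

Let mcc : measurable_fun setT cc.
Proof.
apply: (measurability _ (erefl : @measurable _ (borel Sigma) = <<s @open Sigma >>)).
move=> _ [V oV <-]; rewrite setTI.
have oV' : open [set z | chart_dom c (row2 z) /\ V (c (row2 z))].
  rewrite openE => z [dz Vz]; rewrite /interior; apply: filterI.
    by apply: open_nbhs_nbhs.
  have k : {for z, continuous (fun z => c (row2 z))}.
    apply: (@continuous_comp _ _ _ (@row2 R) c); first exact: row2_continuous.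
    exact: (chart_continuous hS Ac dz).
  exact: (k _ (open_nbhs_nbhs (conj oV Vz))).
have -> : cc @^-1` V = (Q `&` [set z | chart_dom c (row2 z) /\ V (c (row2 z))])
    `|` (~` Q `&` [set z | V point]).
  apply/seteqP; split=> z; rewrite /cc /=.
    case: (pselect (Q z)) => [Qz|Qz] /= Vz; [left|right] => //.
    by split => //; split => //; exact: square_in.
  by case=> [[Qz [_ Vz]]|[Qz Vz]]; case: (pselect (Q z)).
apply: measurableU; apply: measurableI => //.
- exact: open_measurable_prod.
- exact: measurableC.
- have [Vp|Vp] := pselect (V point).
    by rewrite (_ : [set z | V point] = setT) //; apply/seteqP; split.
  by rewrite (_ : [set z | V point] = set0) //; apply/seteqP; split.
Qed.

Let sig_patch z : Q z -> 0 < sig c (row2 z).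
Proof. by move=> /square_in; exact: sig_gt0. Qed.

Let i_sig : leb2.-integrable Q (EFin \o (sig c \o @row2 R)).
Proof.
apply: (@box_integrable R _ _ _ _ _ _ (sig c) (chart_dom c)).
- by rewrite ltrBlDr -addrA ltrDl addr_gt0.
- by rewrite ltrBlDr -addrA ltrDl addr_gt0.
- exact: (chart_dom_open hS Ac).
- exact: square_in.
- exact: (sig_cont Ac).
Qed.

Let ggE : gg = (sig c \o @row2 R) \_ Q.
Proof.
apply/funext => z; rewrite /gg; case: (pselect (Q z)) => Qz.
  by rewrite patchE mem_set.
by rewrite patchE memNset.
Qed.

Let mgg : measurable_fun setT gg.
Proof.
rewrite ggE; apply/(measurable_restrictT _ Qm).
by apply/measurable_EFinP; exact: (measurable_int _ i_sig).
Qed.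

Let gg0 z : 0 <= gg z.
Proof. by rewrite /gg; case: pselect => // Qz; exact/ltW/sig_patch. Qed.

Let dens B : measurable B -> mu (B `&` W) = (\int[leb2]_(x in cc @^-1` B) (gg x)%:E)%E.
Proof.
move=> mB.
have sub : B `&` W `<=` c @` chart_dom c.
  by move=> p [_ [u Hu <-]]; exists u => //; exact: square_sub Hu.
rewrite (hmu Ac (measurableI _ _ mB square_image_measurable) sub).
rewrite [LHS]integral_mkcond [RHS]integral_mkcond; apply: eq_integral => z _.
rewrite !patchE; have [Qz|Qz] := pselect (Q z).
  have Ez : cc z = c (row2 z) by rewrite /cc; case: (pselect (Q z)).
  have Eg : gg z = sig c (row2 z) by rewrite /gg; case: (pselect (Q z)).
  have [Bz|Bz] := pselect (B (cc z)).
    rewrite mem_set ?mem_set ?Eg //=; split; first exact: square_in.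
    by rewrite -Ez; split => //; exists (row2 z); [exact/square2E|exact/esym].
  rewrite memNset ?memNset //= => -[_ []]; rewrite -Ez //.
have Eg : gg z = 0 by rewrite /gg; case: (pselect (Q z)).
rewrite memNset ?Eg; first by case: ifP.
move=> /= [dz [_ [u Hu E]]]; apply: Qz; apply/square2E.
by rewrite -(chart_inj hS Ac _ _ E) // inE //; exact: square_sub Hu.
Qed.

(** [integral_density] for the parametrization and the density extended to the
    plane by constants. *)
Lemma integral_coord_square (h : borel Sigma -> R) : measurable_fun setT h ->
  (\int[mu]_(p in W) (h p)%:E =
   \int[leb2]_(z in Q) (h (c (row2 z)) * sig c (row2 z))%:E)%E.
Proof.
move=> mh; rewrite (integral_density square_image_measurable mcc mgg gg0 dens mh).
rewrite [RHS]integral_mkcond; apply: eq_integral => z _.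
rewrite /cc /gg; case: (pselect (Q z)) => Qz; first by rewrite patchE mem_set.
by rewrite patchE memNset // mulr0.
Qed.

Lemma square_finite : (mu W < +oo)%E.
Proof.
have := dens (@measurableT _ _); rewrite setTI => ->.
rewrite preimage_setT.
have -> : (\int[leb2]_x (gg x)%:E = \int[leb2]_(x in Q) (sig c (row2 x))%:E)%E.
  rewrite [RHS]integral_mkcond; apply: eq_integral => z _.
  by rewrite /gg; case: (pselect (Q z)) => Qz; [rewrite patchE mem_set|rewrite patchE memNset].
have /integrableP[_] := i_sig; apply: le_lt_trans.
apply: le_integral => //.
- exact: integrable_abse.
- by move=> z _; exact: lee_abs.
Qed.

End OnePatch.
Lemma continuous_measurable_surface (h : Sigma -> R) :
  continuous h -> measurable_fun setT (h : borel Sigma -> R).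
Proof.
move=> ch; apply: (measurability _ (RGenOpens.measurableE R)).
move=> _ [_ [a [b ->] <-]]; rewrite setTI; apply: sub_sigma_algebra.
by move/continuousP : ch; apply; exact: interval_open.
Qed.

Lemma continuous_chartwise (T : topologicalType) (h : Sigma -> T) :
  (forall c, A c -> forall u, chart_dom c u -> {for u, continuous (h \o c)}) -> continuous h.
Proof.
move=> H p; have [c Ac [u uc <-]] := surface_cover hS p.
move=> N hN; have := H c Ac u uc N hN.
rewrite /= nbhsE => -[V [oV Vu] HV].
have oc := chart_dom_open hS Ac.
rewrite nbhs_filterE nbhsE /=.
exists (c @` (V `&` chart_dom c)); last by move=> _ [v [Vv _] <-]; exact: HV.
split; last by exists u.
apply: (chart_open_map hS Ac); [exact: openI|exact: subIsetr].
Qed.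

Lemma finite_subcover (V : Sigma -> set Sigma) :
  (forall p, open (V p)) -> (forall p, V p p) ->
  exists s : seq Sigma, forall q, exists2 p, p \in s & V p q.
Proof.
move=> oV Vp; have := surface_compact hS; rewrite compact_cover => H.
have [//|p _|D _ HD] := H _ setT V; first by exists p.
exists (finmap.enum_fset D) => q; have [p Dp Vq] := HD q I; by exists p.
Qed.

(** Finitely many coordinate squares cover the compact surface. *)
Lemma surface_finite : (mu setT < +oo)%E.
Proof.
pose P p := projT1 (cid (square_exists p)).
have PE p : square_chart (P p) (square_center (P p)) = p by exact: (projT2 (cid (square_exists p))).
have [|p|s Hs] := finite_subcover
  (V := fun p => square_chart (P p) @` open_square (square_center (P p)) (square_size (P p))).
- by move=> p; exact: square_inner_open.
- exists (square_center (P p)); last exact: PE.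
  by move=> i; rewrite subrr normr0; exact: square_size_gt0.
pose W p : set (borel Sigma) := square_chart (P p) @` square (square_center (P p)) (square_size (P p)).
have mW p : measurable (W p) by exact: square_image_measurable.
have fin t : (mu (\big[setU/set0]_(p <- t) W p) < +oo)%E /\ measurable (\big[setU/set0]_(p <- t) W p).
  elim: t => [|p t [IH mt]]; first by rewrite big_nil measure0; split.
  rewrite big_cons; split; last exact: measurableU.
  apply: le_lt_trans (measureU2 _ (mW p) mt) _; apply: lte_add_pinfty => //.
  exact: square_finite.
apply: le_lt_trans (fin s).1; apply: le_measure; rewrite ?inE //; first exact: (fin s).2.
move=> q _; have [p ps [u Hu cu]] := Hs q.
by rewrite -bigcup_seq; exists p => //; exists u => // i; exact/ltW/Hu.
Qed.

Lemma surface_integrable (h : Sigma -> R) : continuous h ->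
  mu.-integrable setT (EFin \o (h : borel Sigma -> R)).
Proof.
move=> ch; apply: measurable_bounded_integrable => //.
- exact: surface_finite.
- exact: continuous_measurable_surface.
have : compact (h @` setT).
  by apply: continuous_compact; [exact: continuous_subspaceT|exact: (surface_compact hS)].
move/compact_bounded => [M [Mr HM]]; exists M; split => // x Mx z _.
by apply: (HM x Mx); exists z.
Qed.

End SurfaceMeasure.

(** * Partition of unity *)

Lemma derive_basis (R : realType) n (W : normedModType R) (g : 'rV[R]_n -> W) u v :
  differentiable g u -> 'D_v g u = \sum_i v 0 i *: 'D_(delta_mx 0 i) g u.
Proof.
move=> dg; rewrite deriveE // {1}(row_sum_delta v) linear_sum /=.
by apply: eq_bigr => i _; rewrite linearZ /= deriveE.
Qed.

Lemma derive2 (R : realType) (W : normedModType R) (g : 'rV[R]_2 -> W) u v : differentiable g u ->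
  'D_v g u = v 0 0 *: 'D_(delta_mx 0 0) g u + v 0 1 *: 'D_(delta_mx 0 1) g u.
Proof. by move=> dg; rewrite derive_basis // sum2. Qed.

Lemma derive_chain (R : realType) (U V W : normedModType R) (f : U -> V) (g : V -> W) u v :
  differentiable f u -> differentiable g (f u) ->
  'D_v (fun x => g (f x)) u = 'D_('D_v f u) g (f u).
Proof.
move=> df dg.
have E := congr1 (fun k => k v) (diff_comp df dg).
apply: (etrans (deriveE v (differentiable_comp df dg))).
apply: (etrans E); apply/esym.
apply: (etrans (deriveE _ dg)); exact: (congr1 ('d g (f u)) (deriveE v df)).
Qed.

Section Bump.
Context {R : realType}.

(** The square makes this function C^1 at 0, enough for the partition of unity
    in [stokes]. *)
Definition ramp (s : R) : R := Num.max 0 s ^+ 2.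

Lemma max0_continuous : continuous (fun s : R => Num.max 0 s).
Proof. by move=> s; apply: (@continuous_max _ _ (cst 0) id); [exact: cst_continuous|exact: cvg_id]. Qed.

Lemma is_derive_ramp (s : R) : is_derive s 1 ramp (2 * Num.max 0 s).
Proof.
have [s0|s0|->] := ltgtP s 0.
- have D : is_derive s 1 (fun=> 0 : R) (2 * 0).
    by rewrite mulr0; exact: is_derive_constf.
  have N : \forall x \near s, (fun=> 0 : R) x = ramp x.
    have := lt_nbhsl s0; apply: filterS => x x0.
    by rewrite /ramp max_l ?ltW // expr0n.
  exact: (near_eq_is_derive N D).
- have D : is_derive s 1 (fun x : R => x ^+ 2) (2 * s).
    apply: (is_derive_eq (is_derive_expf 2 (is_derive_id s 1))).
    by rewrite /= expr1 mulr1.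
  have N : \forall x \near s, (fun x : R => x ^+ 2) x = ramp x.
    have := lt_nbhsr s0; apply: filterS => x x0.
    by rewrite /ramp max_r ?ltW.
  exact: (near_eq_is_derive N D).
have L : (fun h : R => h^-1 *: ((ramp \o shift 0) (h *: 1) - ramp 0)) @ 0^' --> (2 * 0 : R).
  rewrite mulr0; apply/cvgr0Pnorm_lt => e e0; near=> h.
  have h0 : h != 0 by near: h; exact: nbhs_dnbhs_neq.
  have he : `|h| < e by near: h; exact: dnbhs0_lt.
  rewrite /= addr0 [h *: 1]mulr1 /ramp maxxx expr0n subr0.
  apply: le_lt_trans he; rewrite normrZ normfV normrX.
  have : `|Num.max 0 h| <= `|h|.
    by rewrite ger0_norm ?le_max ?lexx // ge_max normr_ge0 ler_norm.
  have hp : 0 < `|h| by rewrite normr_gt0.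
  move=> H; rewrite mulrC ler_pdivrMr // -expr2; by apply: lerXn2r; rewrite ?nnegrE.
by split; [apply/cvg_ex; exists (2 * 0)|exact: cvg_lim].
Unshelve. all: by end_near. Qed.

Definition bump (u0 : 'rV[R]_2) (r : R) (u : 'rV[R]_2) : R :=
  ramp (r ^+ 2 - ((u 0 0 - u0 0 0) ^+ 2 + (u 0 1 - u0 0 1) ^+ 2)).

Lemma bump_ge0 u0 r u : 0 <= bump u0 r u.
Proof. exact: sqr_ge0. Qed.

Lemma bump_center u0 r : 0 < r -> 0 < bump u0 r u0.
Proof.
move=> r0; rewrite /bump /ramp !subrr expr0n addr0 subr0.
by rewrite exprn_gt0 // lt_max exprn_gt0 ?orbT.
Qed.

Lemma bump_outside (u0 : 'rV[R]_2) r (u : 'rV[R]_2) i : 0 < r -> r <= `|u 0 i - u0 0 i| -> bump u0 r u = 0.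
Proof.
move=> r0 H; rewrite /bump /ramp max_l ?expr0n // subr_le0.
have S : r ^+ 2 <= (u 0 i - u0 0 i) ^+ 2.
  by rewrite -(real_normK (num_real (u 0 i - u0 0 i))) lerXn2r // ?nnegrE ltW.
by have [E|E] := ord2P i; rewrite E in S; apply: le_trans S _;
  rewrite ?lerDl ?lerDr sqr_ge0.
Qed.

Lemma C1_bump n (U : set 'rV[R]_n) (tau : 'rV[R]_n -> 'rV[R]_2) u0 r : open U ->
  (forall i, C1 U (fun x => tau x 0 i)) -> C1 U (fun x => bump u0 r (tau x)).
Proof.
move=> oU ct; apply: (C1_comp oU (dk := fun s => 2 * Num.max 0 s)).
- by move=> u _; exact: is_derive_ramp.
- move=> u _; apply: (@continuousM _ _ (fun=> 2)); first exact: cst_continuous.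
  exact: max0_continuous.
have cd i : C1 U (fun x => (tau x 0 i - u0 0 i) ^+ 2).
  under eq_fun do rewrite expr2.
  by apply: (C1_mul oU); apply: (C1_add oU) => //; exact: (C1_const oU).
apply: (C1_add oU); first exact: (C1_const oU).
by apply: (C1_opp oU); apply: (C1_add oU).
Qed.

End Bump.

(** The witness of [oriented_transition], named because the transformation laws
    below refer to it. *)
Definition transition (R : realType) (Sigma : ptopologicalType) (c d : @chart R Sigma)
    (tau : 'rV[R]_2 -> 'rV[R]_2) : Prop :=
  let O := chart_dom c `&` c @^-1` (d @` chart_dom d) in
  smooth_on O tau /\ forall u, O u ->
    [/\ chart_dom d (tau u), d (tau u) = c u & 0 < \det ('J tau u)].

Section Functions.
Context {R : realType}.
Variables (Sigma : ptopologicalType) (A : set (@chart R Sigma)).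
Hypothesis hS : closed_oriented_surface A.

Lemma overlap_open c d : A c -> A d -> open (chart_dom c `&` c @^-1` (d @` chart_dom d)).
Proof.
move=> Ac Ad; have od := chart_open_map hS Ad (chart_dom_open hS Ad) (@subset_refl _ _).
have oc := chart_dom_open hS Ac.
rewrite openE => u [uc ud]; rewrite /interior; apply: filterI.
  by apply: open_nbhs_nbhs.
exact: (chart_continuous hS Ac uc (open_nbhs_nbhs (conj od ud))).
Qed.

Definition C1_surface (phi : Sigma -> R) : Prop :=
  forall c, A c -> C1 (chart_dom c) (phi \o c).

Lemma C1_surface_continuous phi : C1_surface phi -> continuous phi.
Proof.
move=> cp; apply: (continuous_chartwise hS) => c Ac u uc; exact: C1_continuous (cp c Ac) uc.
Qed.

Lemma C1_surface_mul phi psi : C1_surface phi -> C1_surface psi ->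
  C1_surface (fun p => phi p * psi p).
Proof. by move=> c1 c2 c Ac; apply: (C1_mul (chart_dom_open hS Ac)); [exact: c1|exact: c2]. Qed.

Lemma C1_surface_inv phi : C1_surface phi -> (forall p, phi p != 0) ->
  C1_surface (fun p => (phi p)^-1).
Proof. by move=> cp p0 c Ac; apply: (C1_inv (chart_dom_open hS Ac)); [exact: cp|move=> u _; exact: p0]. Qed.

Lemma C1_surface_sum (I : Type) (s : seq I) (phi : I -> Sigma -> R) :
  (forall i, C1_surface (phi i)) -> C1_surface (fun p => \sum_(i <- s) phi i p).
Proof.
move=> cp c Ac; have oc := chart_dom_open hS Ac; elim: s => [|i s IH].
  by apply: (C1_eq oc _ (C1_const oc 0)) => u _; rewrite /= big_nil.
apply: (C1_eq oc (g := fun u => phi i (c u) + \sum_(i <- s) phi i (c u))).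
  by move=> u _; rewrite /= big_cons.
by apply: (C1_add oc); [exact: (cp i c Ac)|exact: IH].
Qed.

Section PatchBump.
Variable P : coord_square A.
Let c := square_chart P.
Let u0 := square_center P.
Let r := square_size P.
Let Ac := square_atlas P.
Let r0 := square_size_gt0 P.

Definition square_image : set Sigma := square_chart P @` square (square_center P) (square_size P).

Definition square_bump (p : Sigma) : R :=
  if pselect ((square_chart P @` chart_dom (square_chart P)) p) is left H
  then bump (square_center P) (square_size P) (s2val (cid2 H)) else 0.

Lemma square_bump_chart u : chart_dom c u -> square_bump (c u) = bump u0 r u.
Proof.
move=> uc; rewrite /square_bump; case: pselect => [H|]; last by case; exists u.
case: cid2 => /= v vc E; congr bump.
by apply: (chart_inj hS Ac); rewrite ?inE.
Qed.

Lemma square_bump_ge0 p : 0 <= square_bump p.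
Proof. by rewrite /square_bump; case: pselect => // H; exact: bump_ge0. Qed.

Lemma square_bump_outside p : ~ square_image p -> square_bump p = 0.
Proof.
move=> np; rewrite /square_bump; case: pselect => // H; case: cid2 => /= u uc E.
have [i Hi] : exists i, r < `|u 0 i - u0 0 i|.
  apply: contrapT => N; apply: np; exists u => // i; rewrite leNgt; apply/negP => Hi.
  by apply: N; exists i.
exact: (bump_outside r0 (ltW Hi)).
Qed.

Lemma square_image_avoid d v : A d -> chart_dom d v -> ~ square_image (d v) ->
  \forall w \near v, ~ square_image (d w).
Proof.
move=> Ad vd nv; have oW : open (~` square_image).
  exact/closed_openC/(square_image_closed hS).
exact: (chart_continuous hS Ad vd (open_nbhs_nbhs (conj oW nv))).
Qed.

(** Near a point covered by the chart of the square, the bump is composed with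
    a change of coordinates; near any other point it vanishes, because the
    image of the square is closed. *)
Lemma C1_square_bump : C1_surface square_bump.
Proof.
move=> d Ad; apply: C1_near => v vd.
have [H|H] := pselect ((c @` chart_dom c) (d v)); last first.
  have nv : ~ square_image (d v).
    by move=> [u Hu E]; apply: H; exists u => //; exact: square_sub Hu.
  exists (fun=> 0); split.
    apply: filterS (square_image_avoid Ad vd nv) => w nw /=.
    by rewrite square_bump_outside.
  by have := C1_const (@openT 'rV[R]_2) (0 : R); apply.
have [tau [st Ht]] := surface_oriented hS Ad Ac.
have oO := overlap_open Ad Ac.
exists (fun x => bump u0 r (tau x)); split.
  have := near_open oO (conj vd H); apply: filterS => w Ow /=.
  by have [wc <- _] := Ht w Ow; rewrite square_bump_chart.
have cb := @C1_bump _ _ _ tau u0 r oO (fun i => C1_coord oO i st).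
exact: (cb v (conj vd H)).
Qed.

End PatchBump.

Lemma partition_of_unity : exists s : seq (coord_square A), exists phi : coord_square A -> Sigma -> R,
  [/\ forall P, C1_surface (phi P),
      forall P p, ~ square_image P p -> phi P p = 0,
      forall P u, chart_dom (square_chart P) u ->
        (exists i, square_size P <= `|u 0 i - square_center P 0 i|) -> phi P (square_chart P u) = 0 &
      forall p, \sum_(P <- s) phi P p = 1].
Proof.
pose P p := projT1 (cid (square_exists hS p)).
have PE p : square_chart (P p) (square_center (P p)) = p by exact: (projT2 (cid (square_exists hS p))).
have [|p|t Ht] := finite_subcover hS (V := fun p => [set q | 0 < square_bump (P p) q]).
- move=> p; have /continuousP := C1_surface_continuous (C1_square_bump (P p)).
  by move=> /(_ _ (open_gt (y := 0))).
- have uc : chart_dom (square_chart (P p)) (square_center (P p)).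
    by apply: square_sub => i; rewrite subrr normr0 ltW // square_size_gt0.
  by rewrite /= -{2}(PE p) square_bump_chart // bump_center // square_size_gt0.
pose s := [seq P p | p <- t]; pose Psi q := \sum_(Q <- s) square_bump Q q.
have Psi0 q : 0 < Psi q.
  have [p pt Hp] := Ht q; rewrite /Psi /s big_map (big_rem p) //=.
  by rewrite ltr_pwDl // sumr_ge0 // => i _; exact: square_bump_ge0.
exists s, (fun Q q => square_bump Q q * (Psi q)^-1); split.
- move=> Q; apply: C1_surface_mul; first exact: C1_square_bump.
  apply: C1_surface_inv; last by move=> q; rewrite gt_eqF.
  by apply: C1_surface_sum => i; exact: C1_square_bump.
- by move=> Q p np; rewrite square_bump_outside // mul0r.
- move=> Q u uc [i Hi]; rewrite square_bump_chart // (bump_outside _ Hi) ?mul0r //.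
  exact: square_size_gt0.
- by move=> q; rewrite -mulr_suml -/(Psi q) mulfV ?(gt_eqF (Psi0 q)).
Qed.

End Functions.

(** * Stokes' theorem on a closed surface *)

Section Stokes.
Context {R : realType}.
Variables (Sigma : ptopologicalType) (A : set (@chart R Sigma)).
Hypothesis hS : closed_oriented_surface A.
Variable sig : @chart R Sigma -> 'rV[R]_2 -> R.
Hypotheses (sig_gt0 : forall c, A c -> forall u, chart_dom c u -> 0 < sig c u)
  (sig_cont : forall c, A c -> forall u, chart_dom c u -> {for u, continuous (sig c)}).
Variable mu : {measure set (borel Sigma) -> \bar R}.
Hypothesis hmu : forall c, A c -> forall B : set (borel Sigma), measurable B ->
    B `<=` c @` chart_dom c ->
    mu B = (\int[lebesgue_measure \x lebesgue_measure]_(z in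
              [set z | chart_dom c (row2 z) /\ B (c (row2 z))]) (sig c (row2 z))%:E)%E.

Lemma derive_transition (W : normedModType R) (phi : Sigma -> W) (c d : @chart R Sigma) tau u v :
  A c -> A d -> transition c d tau -> chart_dom c u -> (d @` chart_dom d) (c u) ->
  differentiable (phi \o d) (tau u) ->
  'D_v (phi \o c) u = 'D_('D_v tau u) (phi \o d) (tau u).
Proof.
move=> Ac Ad [st Ht] uc ud dphi.
have oO := overlap_open hS Ac Ad.
have dt : differentiable tau u by exact: smooth_differentiable st (conj uc ud).
rewrite -(derive_chain v dt dphi); apply: near_eq_derive.
have := near_open oO (conj uc ud); apply: filterS => w Ow /=.
by have [_ -> _] := Ht w Ow.
Qed.

Variable omega : @chart R Sigma -> 'rV[R]_2 -> 'rV[R]_2 -> R.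
Hypotheses
  (omega_C1 : forall c, A c -> forall v, C1 (chart_dom c) (omega c v))
  (omega_linear : forall c, A c -> forall u, chart_dom c u -> forall v,
     omega c v u = \sum_i v 0 i * omega c (delta_mx 0 i) u)
  (omega_transition : forall c d tau u v, A c -> A d -> transition c d tau ->
     chart_dom c u -> (d @` chart_dom d) (c u) ->
     omega c v u = omega d ('D_v tau u) (tau u))
  (sig_transition : forall c d tau u, A c -> A d -> transition c d tau ->
     chart_dom c u -> (d @` chart_dom d) (c u) ->
     sig c u = sig d (tau u) * \det ('J tau u)).

(** The coefficient of d phi /\ omega in the chart [c]. *)
Definition wedge (c : @chart R Sigma) (phi : Sigma -> R) (u : 'rV[R]_2) : R :=
  'D_(delta_mx 0 0) (phi \o c) u * omega c (delta_mx 0 1) u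
  - 'D_(delta_mx 0 1) (phi \o c) u * omega c (delta_mx 0 0) u.

Lemma wedge_transition c d tau u phi : A c -> A d -> transition c d tau ->
  chart_dom c u -> (d @` chart_dom d) (c u) -> C1_surface A phi ->
  wedge c phi u = \det ('J tau u) * wedge d phi (tau u).
Proof.
move=> Ac Ad T uc ud cphi.
have [st Ht] := T; have [td _ _] := Ht u (conj uc ud).
have dt : differentiable tau u by exact: smooth_differentiable st (conj uc ud).
have dphi := (cphi d Ad _ td).1.
have E v i : ('D_v tau u) 0 i = \sum_j v 0 j * ('J tau u) j i.
  by rewrite deriveEjacobian // mxE.
have Ea (a i : 'I_2) : ('D_(delta_mx 0 a) tau u) 0 i = ('J tau u) a i.
  by rewrite deriveEjacobian // -rowE mxE.
have Dp (a : 'I_2) : 'D_(delta_mx 0 a) (phi \o c) u =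
    ('J tau u) a 0 * 'D_(delta_mx 0 0) (phi \o d) (tau u)
    + ('J tau u) a 1 * 'D_(delta_mx 0 1) (phi \o d) (tau u).
  rewrite (derive_transition _ Ac Ad T uc ud dphi) derive2 //.
  by rewrite !Ea.
have Do (a : 'I_2) : omega c (delta_mx 0 a) u =
    ('J tau u) a 0 * omega d (delta_mx 0 0) (tau u)
    + ('J tau u) a 1 * omega d (delta_mx 0 1) (tau u).
  by rewrite (omega_transition _ Ac Ad T uc ud) omega_linear // sum2 !Ea.
by rewrite /wedge !Dp !Do det22; ring.
Qed.

Lemma coordinates_exist p : exists cu : @chart R Sigma * 'rV[R]_2,
  [/\ A cu.1, chart_dom cu.1 cu.2 & cu.1 cu.2 = p].
Proof. by have [c Ac [u uc E]] := surface_cover hS p; exists (c, u). Qed.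

(** The quotient of d phi /\ omega by the area form. The choice of a chart at
    each point is harmless by [wedge_density_chart]. *)
Definition wedge_density phi (p : Sigma) : R :=
  let cu := projT1 (cid (coordinates_exist p)) in wedge cu.1 phi cu.2 / sig cu.1 cu.2.

Lemma wedge_density_chart phi c u : C1_surface A phi -> A c -> chart_dom c u ->
  wedge_density phi (c u) = wedge c phi u / sig c u.
Proof.
move=> cphi Ac uc; rewrite /wedge_density.
case: cid => -[d v] [/= Ad dv E].
have [tau T] := surface_oriented hS Ad Ac.
have vc : (c @` chart_dom c) (d v) by rewrite E; exists u.
have [tc Et j0] := T.2 v (conj dv vc).
have tu : tau v = u by apply: (chart_inj hS Ac); rewrite ?inE // Et.
rewrite (wedge_transition Ad Ac T dv vc cphi) (sig_transition Ad Ac T dv vc) tu.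
rewrite [\det _ * _]mulrC -mulrA invfM; congr (_ * _).
by rewrite mulrCA mulfV ?mulr1 // gt_eqF.
Qed.

Lemma wedge_density_sum (I : Type) (s : seq I) (phi : I -> Sigma -> R) p :
  (forall i, C1_surface A (phi i)) ->
  wedge_density (fun q => \sum_(i <- s) phi i q) p = \sum_(i <- s) wedge_density (phi i) p.
Proof.
move=> cphi; rewrite /wedge_density.
case: cid => -[d v] [/= Ad dv _].
have D (k : 'rV[R]_2) (t : seq I) : is_derive v k (fun u => \sum_(i <- t) phi i (d u))
    (\sum_(i <- t) 'D_k (phi i \o d) v).
  elim: t => [|i t IH].
    rewrite big_nil (_ : (fun u => _) = fun=> 0); first exact: is_derive_constf.
    by apply/funext => u; rewrite big_nil.
  rewrite big_cons (_ : (fun u => _) = fun u => phi i (d u) + \sum_(i <- t) phi i (d u)).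
    apply: is_derive_addf => //; exact: (C1_is_derive k (cphi i d Ad) dv).
  by apply/funext => u; rewrite big_cons.
rewrite -mulr_suml /wedge; congr (_ / _).
rewrite sumrB -!mulr_suml; congr (_ * _ - _ * _).
  by have [_ <-] := D (delta_mx 0 0) s.
by have [_ <-] := D (delta_mx 0 1) s.
Qed.

Lemma wedge_density_const k p : wedge_density (fun=> k) p = 0.
Proof.
rewrite /wedge_density.
case: cid => -[d v] [/= Ad dv _].
rewrite /wedge; have D w : 'D_w ((fun=> k) \o d) v = 0 by exact: derive_cst.
by rewrite !D !mul0r subrr mul0r.
Qed.

Lemma wedge_density_continuous phi : C1_surface A phi -> continuous (wedge_density phi).
Proof.
move=> cphi; apply: (continuous_chartwise hS) => c Ac u uc.
have oc := chart_dom_open hS Ac.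
have cw : {for u, continuous (fun u => wedge c phi u / sig c u)}.
  apply: (@continuousM _ _ (wedge c phi) (fun u => (sig c u)^-1)); last first.
    by apply: (@continuousV _ _ (sig c)); [rewrite gt_eqF // sig_gt0|exact: sig_cont].
  have co v := C1_continuous (omega_C1 Ac v) uc.
  have cd v : {for u, continuous ('D_v (phi \o c))} by exact: (cphi c Ac u uc).2.
  apply: (@continuousB _ _ _ (fun u => 'D_(delta_mx 0 0) (phi \o c) u * omega c (delta_mx 0 1) u)
     (fun u => 'D_(delta_mx 0 1) (phi \o c) u * omega c (delta_mx 0 0) u)).
    exact: (@continuousM _ _ ('D_(delta_mx 0 0) (phi \o c)) (omega c (delta_mx 0 1))).
  exact: (@continuousM _ _ ('D_(delta_mx 0 1) (phi \o c)) (omega c (delta_mx 0 0))).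
apply: near_eq_continuous cw.
by have := near_open oc uc; apply: filterS => w wc; rewrite /= wedge_density_chart.
Qed.

Variable K : Sigma -> R.
Hypotheses (K_cont : continuous K)
  (K_density : forall c, A c -> forall u, chart_dom c u -> K (c u) * sig c u =
     'D_(delta_mx 0 0) (omega c (delta_mx 0 1)) u - 'D_(delta_mx 0 1) (omega c (delta_mx 0 0)) u).

(** In the chart of the square, the integrand is the coefficient of
    d(phi omega), and [phi] vanishes on the boundary of the square. *)
Lemma local_stokes (P : coord_square A) (phi : Sigma -> R) : C1_surface A phi ->
  (forall p, ~ square_image P p -> phi p = 0) ->
  (forall u, chart_dom (square_chart P) u ->
     (exists i, square_size P <= `|u 0 i - square_center P 0 i|) -> phi (square_chart P u) = 0) ->
  \int[mu]_(p in [set: borel Sigma]) (phi p * K p + wedge_density phi p) = 0.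
Proof.
move=> cphi out bd; set h := fun p : borel Sigma => _.
pose c := square_chart P; have Ac : A c := square_atlas P; have oc := chart_dom_open hS Ac.
have hout p : ~ square_image P p -> h p = 0.
  move=> np; rewrite /h out // mul0r add0r.
  have [d Ad [v vd dv]] := surface_cover hS p; rewrite -dv wedge_density_chart //.
  rewrite -dv in np.
  have Z k : 'D_k (phi \o d) v = 0.
    rewrite -(derive_cst (0 : R) v k); apply: near_eq_derive.
    by apply: filterS (square_image_avoid hS Ad vd np) => w nw /=; rewrite out.
  by rewrite /wedge !Z !mul0r subrr mul0r.
have ch : continuous h.
  move=> p; apply: (@continuousD _ _ _ (fun p => phi p * K p) (wedge_density phi)).
    apply: (@continuousM _ _ phi K); last exact: K_cont.
    exact: (C1_surface_continuous hS cphi).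
  exact: wedge_density_continuous.
rewrite /Rintegral.
have -> : (\int[mu]_(p in [set: borel Sigma]) (h p)%:E =
           \int[mu]_(p in (square_image P : set (borel Sigma))) (h p)%:E)%E.
  rewrite integral_mkcond [RHS]integral_mkcond; apply: eq_integral => p _.
  rewrite patchE mem_set //; have [Wp|Wp] := pselect (square_image P p).
    by rewrite patchE mem_set.
  by rewrite patchE memNset // hout.
rewrite (integral_coord_square hS sig_gt0 sig_cont hmu P); last exact: (continuous_measurable_surface ch).
pose P1 u := phi (c u) * omega c (delta_mx 0 1) u.
pose P0 u := phi (c u) * omega c (delta_mx 0 0) u.
have co v := omega_C1 Ac v.
have c1 : C1 (chart_dom c) P1 by apply: (C1_mul oc (cphi c Ac)).
have c0 : C1 (chart_dom c) P0 by apply: (C1_mul oc (cphi c Ac)).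
have r0 := square_size_gt0 P.
have s0 x : x - square_size P < x + square_size P by lra.
have G := @green_box R _ _ _ _ (s0 (square_center P 0 0)) (s0 (square_center P 0 1))
  (chart_dom c) P0 P1 oc (@square_in _ _ _ P) c0 c1.
rewrite -[RHS]/(fine 0%E); congr fine; rewrite -[RHS]G.
  apply: eq_integral => z; rewrite inE => Qz; congr (_%:E).
  have zc := square_in Qz.
  have Dphi := C1_is_derive _ (cphi c Ac) zc.
  have [_ ->] := is_derive_mulf (Dphi (delta_mx 0 0)) (C1_is_derive (delta_mx 0 0) (co (delta_mx 0 1)) zc).
  have [_ ->] := is_derive_mulf (Dphi (delta_mx 0 1)) (C1_is_derive (delta_mx 0 1) (co (delta_mx 0 0)) zc).
  rewrite /h wedge_density_chart // mulrDl -mulrA K_density // divfK; last first.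
    by rewrite gt_eqF // sig_gt0.
  rewrite /wedge /comp; ring.
move=> z Qz H; have zc := square_in Qz.
have edge_lo (x : R) : square_size P <= `|x - square_size P - x|.
  by rewrite addrAC subrr add0r normrN ler_norm.
have edge_hi (x : R) : square_size P <= `|x + square_size P - x|.
  by rewrite addrAC subrr add0r ler_norm.
have Z : phi (c (row2 z)) = 0.
  apply: bd => //; case: H => [|[|[|]]] E; [exists 0|exists 0|exists 1|exists 1];
  by rewrite mxE /= E; first [exact: edge_lo|exact: edge_hi].
by rewrite /P0 /P1 Z !mul0r.
Qed.

(** Sum [local_stokes] over a partition of unity: the [phi]'s add up to 1,
    whose differential is zero. *)
Theorem stokes : \int[mu]_(p in [set: borel Sigma]) K p = 0.
Proof.
have [s [phi [cphi out bd sum1]]] := partition_of_unity hS.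
pose h P p := phi P p * K p + wedge_density (phi P) p.
have ch P : continuous (h P).
  move=> p; apply: (@continuousD _ _ _ (fun p => phi P p * K p) (wedge_density (phi P))).
    apply: (@continuousM _ _ (phi P) K); last exact: K_cont.
    exact: (C1_surface_continuous hS (cphi P)).
  exact: wedge_density_continuous.
have ih P := surface_integrable hS sig_cont hmu (ch P).
have KE p : K p = \sum_(P <- s) h P p.
  rewrite big_split /= -mulr_suml sum1 mul1r -wedge_density_sum //.
  have -> : (fun q => \sum_(i <- s) phi i q) = (fun=> 1) by apply/funext.
  by rewrite wedge_density_const addr0.
have {KE} -> : K = fun p => \sum_(P <- s) h P p by apply/funext.
have [_ ->] // : mu.-integrable setT (EFin \o (fun p : borel Sigma => \sum_(P <- s) h P p))
   /\ \int[mu]_(p in [set: borel Sigma]) (\sum_(P <- s) h P p) = 0.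
elim: s {sum1} => [|P s [ints IH]].
  have -> : (fun p : borel Sigma => \sum_(P <- [::]) h P p) = fun=> 0.
    by apply/funext => p; rewrite big_nil.
  split; first exact: (integrable0 mu setT).
  by rewrite /Rintegral integral0.
have E : (fun p : borel Sigma => \sum_(Q <- P :: s) h Q p) =
         (fun p => h P p + \sum_(Q <- s) h Q p).
  by apply/funext => p; rewrite big_cons.
rewrite E; split.
  exact: (integrableD measurableT (ih P) ints).
rewrite (RintegralD measurableT (ih P) ints) IH addr0.
by apply: (local_stokes (cphi P) (out P)); exact: bd.
Qed.

End Stokes.

(** * The potential as a one-form *)

Lemma vol_combination (R : realType) (a b c d : R) (X Y Z W : 'rV[R]_4) :
  vol X Y (a *: Z + b *: W) (c *: Z + d *: W) = (a * d - b * c) * vol X Y Z W.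
Proof. by rewrite /vol !linE !(tripleDm, tripleZm, tripleDr, tripleZr) /triple; ring. Qed.

Section ChartGeometry.
Context {R : realType}.
Variables (m : R) (U : set 'rV[R]_2) (f L Lb : 'rV[R]_2 -> 'rV[R]_4).
Hypotheses (oU : open U) (sf : smooth_on U f) (sL : smooth_on U L) (sLb : smooth_on U Lb)
  (rad0 : forall u, 0 < rad (f u)) (width0 : forall u, 0 < rad (f u) - 2 * m).
Implicit Types (u v w : 'rV[R]_2).

Definition area_density u : R := Num.sqrt (\det (induced_mx m f u)).

Definition covd_at p (X Y N : 'rV[R]_4) : 'rV[R]_4 := Y + chr m p X N.

Lemma covd_at_linear p a b X X' Y Y' N : covd_at p (a *: X + b *: X') (a *: Y + b *: Y') N
  = a *: covd_at p X Y N + b *: covd_at p X' Y' N.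
Proof.
rewrite /covd_at chr_linl.
have -> : chr m p (b *: X') N = b *: chr m p X' N.
  have Z : chr m p 0 N = 0.
    apply: (addIr (chr m p 0 N)); rewrite add0r.
    by have := chr_linl m p 1 0 0 N; rewrite !scale1r addr0.
  by have := chr_linl m p b X' 0 N; rewrite Z !addr0.
by rewrite !scalerDr addrACA.
Qed.

Definition zeta_at p (X Y N N' : 'rV[R]_4) : R := 2^-1 * schw m p (covd_at p X Y N) N'.

Lemma zeta_at_linear p a b X X' Y Y' N N' :
  zeta_at p (a *: X + b *: X') (a *: Y + b *: Y') N N'
  = a * zeta_at p X Y N N' + b * zeta_at p X' Y' N N'.
Proof. by rewrite /zeta_at covd_at_linear !schwE; ring. Qed.

(** The value of [potential] as a function of the derivatives of [f] and L in
    the given direction. Linearity in these two arguments shows that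
    [potential] is a one-form and yields its transformation under a change of
    chart. *)
Definition potential_at p (X Y N N' : 'rV[R]_4) : R :=
  area_form p (covd_at p X Y N) N' + zeta_at p X Y N N' * area_form p N N'.

Lemma potential_atE v u :
  potential m f L Lb v u = potential_at (f u) ('D_v f u) ('D_v L u) (L u) (Lb u).
Proof. by rewrite /potential /zeta covdE. Qed.

Lemma potential_at_linear p a b X X' Y Y' N N' :
  potential_at p (a *: X + b *: X') (a *: Y + b *: Y') N N'
  = a * potential_at p X Y N N' + b * potential_at p X' Y' N N'.
Proof.
rewrite /potential_at covd_at_linear zeta_at_linear.
by rewrite /area_form !linE tripleDm !tripleZm; ring.
Qed.

Lemma potential_linear u v : U u ->
  potential m f L Lb v u = \sum_i v 0 i * potential m f L Lb (delta_mx 0 i) u.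
Proof.
move=> Uu; rewrite sum2 !potential_atE.
rewrite (derive2 v (smooth_differentiable sf Uu)) (derive2 v (smooth_differentiable sL Uu)).
exact: potential_at_linear.
Qed.

Lemma zeta_atE v u :
  zeta m f L Lb v u = zeta_at (f u) ('D_v f u) ('D_v L u) (L u) (Lb u).
Proof. by rewrite /zeta covdE. Qed.

Lemma zeta_linear u v : U u -> zeta m f L Lb v u =
  v 0 0 * zeta m f L Lb (delta_mx 0 0) u + v 0 1 * zeta m f L Lb (delta_mx 0 1) u.
Proof.
move=> Uu; rewrite !zeta_atE.
rewrite (derive2 v (smooth_differentiable sf Uu)) (derive2 v (smooth_differentiable sL Uu)).
exact: zeta_at_linear.
Qed.

(** A two-form in two variables is determined by its value on the basis. *)
Lemma exterior_derivative_linear (z : 'rV[R]_2 -> 'rV[R]_2 -> R) u v w :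
  (forall y, C1 U (z y)) ->
  (forall q y, U q -> z y q = y 0 0 * z (delta_mx 0 0) q + y 0 1 * z (delta_mx 0 1) q) -> U u ->
  'D_v (z w) u - 'D_w (z v) u = (v 0 0 * w 0 1 - v 0 1 * w 0 0)
    * ('D_(delta_mx 0 0) (z (delta_mx 0 1)) u - 'D_(delta_mx 0 1) (z (delta_mx 0 0)) u).
Proof.
move=> cz lz Uu.
have D x y : 'D_x (z y) u = y 0 0 * 'D_x (z (delta_mx 0 0)) u + y 0 1 * 'D_x (z (delta_mx 0 1)) u.
  have N : \forall q \near u, y 0 0 * z (delta_mx 0 0) q + y 0 1 * z (delta_mx 0 1) q = z y q.
    by have := near_open oU Uu; apply: filterS => q Uq; rewrite (lz q y Uq).
  apply: (etrans (esym (near_eq_derive x N))).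
  have d0 := C1_is_derive x (cz (delta_mx 0 0)) Uu.
  have d1 := C1_is_derive x (cz (delta_mx 0 1)) Uu.
  have := is_derive_addf (is_derive_mulf (is_derive_constf (y 0 0) u x) d0)
     (is_derive_mulf (is_derive_constf (y 0 1) u x) d1).
  by case=> _ ->; rewrite !mul0r !add0r.
have D2 x y : 'D_x (z y) u = x 0 0 * 'D_(delta_mx 0 0) (z y) u
   + x 0 1 * 'D_(delta_mx 0 1) (z y) u by exact: (derive2 x (cz y u Uu).1).
rewrite (D v w) (D w v) (D2 v (delta_mx 0 0)) (D2 v (delta_mx 0 1))
  (D2 w (delta_mx 0 0)) (D2 w (delta_mx 0 1)).
move: ('D_(delta_mx 0 0) (z (delta_mx 0 0)) u) ('D_(delta_mx 0 1) (z (delta_mx 0 0)) u)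
 ('D_(delta_mx 0 0) (z (delta_mx 0 1)) u) ('D_(delta_mx 0 1) (z (delta_mx 0 1)) u).
clear; move=> *; ring.
Qed.

Lemma dzeta_linear u v w : U u -> dzeta m f L Lb v w u =
  (v 0 0 * w 0 1 - v 0 1 * w 0 0) * dzeta m f L Lb (delta_mx 0 0) (delta_mx 0 1) u.
Proof.
apply: (@exterior_derivative_linear (zeta m f L Lb)).
  exact: (C1_zeta oU sf rad0 width0 sL sLb).
by move=> q y Uq; exact: zeta_linear.
Qed.

Lemma C1_metric a b : C1 U (fun u => induced_mx m f u a b).
Proof.
under eq_fun do rewrite mxE.
by apply: (C1_schw oU sf rad0 width0); apply: (C1_vector_smooth oU); exact: smooth_derive.
Qed.

Lemma C1_metric_det : C1 U (fun u => \det (induced_mx m f u)).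
Proof.
under eq_fun do rewrite det22.
by apply: (C1_add oU); [|apply: (C1_opp oU)]; apply: (C1_mul oU); exact: C1_metric.
Qed.

End ChartGeometry.

Section MeanCurvature.
Context {R : realType}.
Variables (m : R) (U : set 'rV[R]_2) (f L : 'rV[R]_2 -> 'rV[R]_4).
Hypotheses (oU : open U) (sf : smooth_on U f) (sL : smooth_on U L)
  (rad0 : forall u, 0 < rad (f u)) (width0 : forall u, 0 < rad (f u) - 2 * m)
  (Gunit : forall u, U u -> induced_mx m f u \in unitmx)
  (Lf : forall u a, U u -> schw m (f u) (L u) (pd a f u) = 0).

Lemma C1_inverse_metric a b : C1 U (fun u => invmx (induced_mx m f u) a b).
Proof.
apply: (C1_eq oU (g := fun u => (\det (induced_mx m f u))^-1
    * ((-1) ^+ (b + a) * induced_mx m f u (lift b 0) (lift a 0)))).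
  by move=> u Uu; rewrite (invmx_entry _ _ (Gunit Uu)).
apply: (C1_mul oU).
  apply: (C1_inv oU); first exact: C1_metric_det.
  by move=> u /Gunit; rewrite unitmxE unitfE.
by apply: (C1_mul oU); [exact: (C1_const oU)|exact: C1_metric].
Qed.

(** As L is normal, the trace of the second fundamental form paired with L can
    be expressed by first derivatives of L. *)
Lemma C1_mean_curvature : C1 U (fun u => schw m (f u) (mean_curvature m f u) (L u)).
Proof.
pose lam a b u := schw m (f u) (covd m f L (delta_mx 0 a) u) (pd b f u).
apply: (C1_eq oU (g := fun u => \sum_(a < 2) \sum_(b < 2) invmx (induced_mx m f u) a b * - lam a b u)).
  move=> u Uu; apply: (etrans _ (esym (mean_curvature_inner Lf Uu))).
  apply: eq_bigr => a _; apply: eq_bigr => b _; apply: (congr1 (fun s => _ * s)).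
  rewrite /lam (covd_normal oU sf rad0 width0 a b sL Uu (fun q c => @Lf q c)); exact: opprK.
apply: (C1_sum oU) => a; apply: (C1_sum oU) => b; apply: (C1_mul oU).
  exact: C1_inverse_metric.
apply: (C1_opp oU); apply: (C1_schw oU sf rad0 width0).
  exact: (C1_covd oU sf rad0 width0).
by apply: (C1_vector_smooth oU); exact: smooth_derive.
Qed.

End MeanCurvature.

(** * The integral formula *)

Lemma det_gram_change (R : realType) (m : R) p p' (X Y : 'I_2 -> 'rV[R]_4) (J : 'M[R]_2) :
  p = p' -> (forall a, X a = J a 0 *: Y 0 + J a 1 *: Y 1) ->
  \det (\matrix_(a, b) schw m p (X a) (X b))
  = \det J ^+ 2 * \det (\matrix_(a, b) schw m p' (Y a) (Y b)).
Proof.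
move=> <- XE.
have -> : \matrix_(a, b) schw m p (X a) (X b) = J *m (\matrix_(a, b) schw m p (Y a) (Y b)) *m J^T.
  apply/matrixP => a b.
  by rewrite !mxE !sum2 !mxE !sum2 !mxE !XE !schwE; ring.
by rewrite !det_mulmx det_tr mulrAC -expr2.
Qed.

Lemma null_frame_tangent (R : realType) (m : R) p (N N' : 'rV[R]_4) (X E : 'I_2 -> 'rV[R]_4)
    (M : 'M[R]_2) :
  0 < \det M -> (forall b, E b = \sum_(a < 2) M b a *: X a) ->
  (forall b b', schw m p (E b) (E b') = (b == b')%:R) ->
  (forall a, schw m p N (X a) = 0) -> (forall a, schw m p N' (X a) = 0) ->
  schw m p N N = 0 -> schw m p N' N' = 0 -> schw m p N N' = -2 ->
  0 < vol N' N (X 0) (X 1) -> null_frame m p N N' (E 0) (E 1).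
Proof.
move=> M0 EM on NX NX' NN NN' NE V.
have EE b : E b = M b 0 *: X 0 + M b 1 *: X 1 by rewrite EM sum2.
have orth Y b : (forall a, schw m p Y (X a) = 0) -> schw m p Y (E b) = 0.
  by move=> H; rewrite EE schwDr !schwZr !H !mulr0 addr0.
split => //; try exact: orth; rewrite ?on //.
by rewrite !EE vol_combination -det22; exact: mulr_gt0.
Qed.

Lemma antisymmetric_sum (R : realType) (r q z : 'I_2 -> 'I_2 -> R) (D : R) :
  r 1 0 = - r 0 1 -> q 1 0 = - q 0 1 -> q 0 0 = 0 -> q 1 1 = 0 -> z 0 1 = D -> z 1 0 = - D ->
  \sum_(b < 2) \sum_(c < 2) (2^-1 * r b c - 2 * z b c) * q b c = (r 0 1 - 4 * D) * q 0 1.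
Proof. by move=> r1 q1 q2 q3 z1 z2; rewrite !sum2 r1 q1 q2 q3 z1 z2; field. Qed.

Section Minkowski.
Context {R : realType}.
Variables (m : R) (Sigma : ptopologicalType) (A : set (@chart R Sigma)).
Hypotheses (hm : 0 <= m) (hSigma : closed_oriented_surface A).
Variables (F L Lb : Sigma -> 'rV[R]_4).
Hypotheses (hF : spacelike_immersion m A F) (hL : null_normals m A F L Lb).
Variables (H : Sigma -> 'rV[R]_4) (S : Sigma -> R)
  (dz : Sigma -> 'rV[R]_4 -> 'rV[R]_4 -> R) (e : Sigma -> 'I_2 -> 'rV[R]_4).
Hypotheses (hH : is_mean_curvature m A F H) (hS : is_scalar_curvature m A F S)
  (hdz : is_dzeta m A F L Lb dz) (he : oriented_frame m A F e).

Let rad0 p : 0 < rad (F p).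
Proof. by case: hF => _ /(_ p) xp _; exact: rad_gt0 hm xp. Qed.
Let width0 p : 0 < rad (F p) - 2 * m.
Proof. by case: hF => _ /(_ p) xp _; exact: width_gt0. Qed.
Let sF c : A c -> smooth_on (chart_dom c) (F \o c).
Proof. by case: hF => + _ _; exact. Qed.
Let sL c : A c -> smooth_on (chart_dom c) (L \o c).
Proof. by case: hL => -[+ _] _ _ _ _; exact. Qed.
Let sLb c : A c -> smooth_on (chart_dom c) (Lb \o c).
Proof. by case: hL => -[_ +] _ _ _ _; exact. Qed.
Let oc c : A c -> open (chart_dom c) := chart_dom_open hSigma (c:=c).
Let Lf c u a : A c -> chart_dom c u -> schw m (F (c u)) (L (c u)) (pd a (F \o c) u) = 0.
Proof. by move=> Ac uc; case: hL => _ K _ _ _; case: (K c Ac u uc (delta_mx 0 a)). Qed.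
Let Bf c u a : A c -> chart_dom c u -> schw m (F (c u)) (Lb (c u)) (pd a (F \o c) u) = 0.
Proof. by move=> Ac uc; case: hL => _ K _ _ _; case: (K c Ac u uc (delta_mx 0 a)). Qed.
Let norms p : [/\ schw m (F p) (L p) (L p) = 0, schw m (F p) (Lb p) (Lb p) = 0 &
                    schw m (F p) (L p) (Lb p) = -2].
Proof. by case: hL. Qed.

Let sig (c : @chart R Sigma) u := area_density m (F \o c) u.

(** The area density is the inverse of [\det M], since [M] carries the
    coordinate basis to an orthonormal one. *)
Lemma frame_exists c u : A c -> chart_dom c u -> exists M : 'M[R]_2,
  [/\ 0 < \det M, forall b, e (c u) b = \sum_(a < 2) M b a *: pd a (F \o c) u,
      null_frame m (F (c u)) (L (c u)) (Lb (c u)) (e (c u) 0) (e (c u) 1),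
      induced_mx m (F \o c) u \in unitmx & \det M * sig c u = 1].
Proof.
move=> Ac uc; have [[M M0 eM] on] := he Ac uc; exists M.
have [LL BB LB] := norms (c u).
have fr : null_frame m (F (c u)) (L (c u)) (Lb (c u)) (e (c u) 0) (e (c u) 1).
  apply: (null_frame_tangent M0 eM on _ _ LL BB LB).
  - by move=> a; exact: Lf.
  - by move=> a; exact: Bf.
  - by case: hL => _ _ _ _ /(_ c Ac u uc); rewrite det_vol.
split => //; first exact: (frame_unit eM fr).
have := frame_det eM fr; rewrite /sig /area_density /induced_mx /=.
move: (\det (\matrix_(a, b) _)) => g E.
have -> : g = ((\det M)^-1) ^+ 2.
  by rewrite exprVn; apply: (mulfI (expf_neq0 2 (lt0r_neq0 M0))); rewrite E mulfV // expf_neq0 // gt_eqF.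
by rewrite sqrtr_sqr ger0_norm ?invr_ge0 ?ltW // mulfV // gt_eqF.
Qed.

Lemma area_density_gt0 c : A c -> forall u, chart_dom c u -> 0 < sig c u.
Proof.
move=> Ac u uc; have [M [M0 _ _ _ E]] := frame_exists Ac uc.
by rewrite -(pmulr_rgt0 _ M0) E.
Qed.

Lemma C1_area_density c : A c -> C1 (chart_dom c) (sig c).
Proof.
move=> Ac; apply: (C1_sqrt (oc Ac)).
  by apply: C1_metric_det => //; [exact: oc|exact: sF|move=> u; exact: rad0|move=> u; exact: width0].
by move=> u uc; have := area_density_gt0 Ac uc; rewrite sqrtr_gt0.
Qed.

Lemma area_density_continuous c : A c -> forall u, chart_dom c u -> {for u, continuous (sig c)}.
Proof. by move=> Ac u; exact: C1_continuous (C1_area_density Ac). Qed.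

Lemma area_density_transition c d tau u : A c -> A d -> transition c d tau ->
  chart_dom c u -> (d @` chart_dom d) (c u) ->
  sig c u = sig d (tau u) * \det ('J tau u).
Proof.
move=> Ac Ad T uc ud; have [st Ht] := T; have [td Et j0] := Ht u (conj uc ud).
have dt : differentiable tau u by exact: smooth_differentiable st (conj uc ud).
have dF : differentiable (F \o d) (tau u) by exact: smooth_differentiable (sF Ad) td.
have X a : pd a (F \o c) u = ('J tau u) a 0 *: pd 0 (F \o d) (tau u) + ('J tau u) a 1 *: pd 1 (F \o d) (tau u).
  have Ea (i : 'I_2) : ('D_(delta_mx 0 a) tau u) 0 i = ('J tau u) a i.
    by rewrite deriveEjacobian // -rowE mxE.
  rewrite -!Ea; apply: (etrans (derive_transition hSigma _ Ac Ad T uc ud dF)); exact: derive2.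
have G : \det (induced_mx m (F \o c) u) = \det ('J tau u) ^+ 2 * \det (induced_mx m (F \o d) (tau u)).
  exact: (@det_gram_change _ m _ _ (fun a => pd a (F \o c) u)
    (fun a => pd a (F \o d) (tau u)) ('J tau u) (congr1 F (esym Et)) X).
rewrite /sig /area_density G sqrtrM ?sqr_ge0 // sqrtr_sqr ger0_norm ?ltW //; exact: mulrC.
Qed.

Let omega (c : @chart R Sigma) v u := potential m (F \o c) (L \o c) (Lb \o c) v u.

Lemma potential_transition c d tau u v : A c -> A d -> transition c d tau ->
  chart_dom c u -> (d @` chart_dom d) (c u) -> omega c v u = omega d ('D_v tau u) (tau u).
Proof.
move=> Ac Ad T uc ud; have [st Ht] := T; have [td Et j0] := Ht u (conj uc ud).
have dF : differentiable (F \o d) (tau u) by exact: smooth_differentiable (sF Ad) td.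
have dL : differentiable (L \o d) (tau u) by exact: smooth_differentiable (sL Ad) td.
have congr5 p p' X X' Y Y' N N' M M' : p = p' -> X = X' -> Y = Y' -> N = N' -> M = M' ->
  potential_at m p X Y N M = potential_at m p' X' Y' N' M' by do 5! move=> ->.
have PE (b : @chart R Sigma) w q := @potential_atE R m (F \o b) (L \o b) (Lb \o b)
  (fun u => rad0 (b u)) (fun u => width0 (b u)) w q.
apply: (etrans (PE c v u)); apply: (etrans _ (esym (PE d _ _))); apply: congr5.
- exact: (congr1 F (esym Et)).
- exact: (derive_transition hSigma _ Ac Ad T uc ud dF).
- exact: (derive_transition hSigma _ Ac Ad T uc ud dL).
- exact: (congr1 L (esym Et)).
- exact: (congr1 Lb (esym Et)).
Qed.

Let Gunit c : A c -> forall u, chart_dom c u -> induced_mx m (F \o c) u \in unitmx.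
Proof. by move=> Ac u uc; have [M []] := frame_exists Ac uc. Qed.

Definition flux p := schw m (F p) (H p) (L p) * schw m (F p) (Lb p) partial_t.
Definition curvature_flux p :=
  (S p + 4^-1 * Rbar m (F p) (L p) (Lb p) (L p) (Lb p)) * Qform (F p) (L p) (Lb p)
  + \sum_(b < 2) \sum_(c < 2)
      (2^-1 * Rbar m (F p) (e p b) (e p c) (Lb p) (L p) - 2 * dz p (e p b) (e p c))
       * Qform (F p) (e p b) (e p c).
Definition solid p := solid_angle (F p) (e p 0) (e p 1).
(** The quotient of d omega by the area form; see [exact_densityE]. *)
Definition exact_density p := 2^-1 * (- 2 * flux p + curvature_flux p - 4 * m * solid p).

Lemma exact_densityE c u : A c -> chart_dom c u -> exact_density (c u) * sig c u =
  'D_(delta_mx 0 0) (omega c (delta_mx 0 1)) u - 'D_(delta_mx 0 1) (omega c (delta_mx 0 0)) u.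
Proof.
move=> Ac uc; have [M [M0 eM fr _ Ms]] := frame_exists Ac uc.
have id := @local_identity R m (chart_dom c) (F \o c) (L \o c) (Lb \o c) (oc Ac) (sF Ac) (sL Ac)
  (sLb Ac) (fun u => rad0 (c u)) (fun u => width0 (c u)) (Gunit Ac)
  (fun q _ => let: And3 x _ _ := norms (c q) in x) (fun q _ => let: And3 _ x _ := norms (c q) in x)
  (fun q _ => let: And3 _ _ x := norms (c q) in x)
  (fun q a qc => Lf a Ac qc) (fun q a qc => Bf a Ac qc) u M (e (c u)) uc eM fr.
have eD b : e (c u) b = 'D_(row b M) (F \o c) u.
  rewrite eM sum2 (derive2 _ (smooth_differentiable (sF Ac) uc)).
  by apply: (congr2 (fun s t => s *: _ + t *: _)); rewrite mxE.
have dzE b b' : dz (c u) (e (c u) b) (e (c u) b') = (M b 0 * M b' 1 - M b 1 * M b' 0)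
    * dzeta m (F \o c) (L \o c) (Lb \o c) (delta_mx 0 0) (delta_mx 0 1) u.
  apply: (etrans (congr2 (dz (c u)) (eD b) (eD b'))); apply: (etrans (hdz Ac uc _ _)).
  apply: (etrans (@dzeta_linear R m (chart_dom c) (F \o c) (L \o c) (Lb \o c) (oc Ac) (sF Ac) (sL Ac)
    (sLb Ac) (fun u => rad0 (c u)) (fun u => width0 (c u)) u _ _ uc)).
  by apply: (congr1 (fun s => s * _)); rewrite !mxE.
have E := @antisymmetric_sum R (fun b b' => Rbar m (F (c u)) (e (c u) b) (e (c u) b') (Lb (c u)) (L (c u)))
  (fun b b' => Qform (F (c u)) (e (c u) b) (e (c u) b')) (fun b b' => dz (c u) (e (c u) b) (e (c u) b'))
  (\det M * dzeta m (F \o c) (L \o c) (Lb \o c) (delta_mx 0 0) (delta_mx 0 1) u).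
have Q2 : exact_density (c u) = \det M * ('D_(delta_mx 0 0) (omega c (delta_mx 0 1)) u
    - 'D_(delta_mx 0 1) (omega c (delta_mx 0 0)) u).
  have two : (2 : R) != 0 by rewrite pnatr_eq0.
  apply: (mulfI two); apply: (etrans _ (esym id)); apply: (etrans (mulVKf two _)).
  apply: (congr2 (fun s t => s - t)) => //; rewrite /flux /curvature_flux addrA.
  apply: (congr2 (fun s t => s + t)).
    apply: (congr2 (fun s t => s + t)).
      by apply: (congr1 (fun X => - 2 * (schw m (F (c u)) X (L (c u)) * _))); exact: (hH Ac uc).
    by apply: (congr1 (fun X => (X + _) * _)); exact: (hS Ac uc).
  apply: E.
  - rewrite !Rbar_riem //; exact: (riem_antisym _ _ _ _ _ _).1.
  - by rewrite /Qform; ring.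
  - by rewrite /Qform; ring.
  - by rewrite /Qform; ring.
  - by rewrite dzE det22.
  - rewrite dzE det22; move: (dzeta _ _ _ _ _ _ _); clear; move=> D; ring.
rewrite Q2 mulrAC Ms; exact: mul1r.
Qed.

(** The frame [e] need not be continuous: continuity is read off the expression
    through omega. *)
Lemma exact_density_continuous : continuous exact_density.
Proof.
apply: (continuous_chartwise hSigma) => c Ac u uc.
have co v := C1_potential (oc Ac) (sF Ac) (fun u => rad0 (c u)) (fun u => width0 (c u)) (sL Ac) (sLb Ac) v.
have cq : {for u, continuous (fun u => ('D_(delta_mx 0 0) (omega c (delta_mx 0 1)) u
   - 'D_(delta_mx 0 1) (omega c (delta_mx 0 0)) u) * (sig c u)^-1)}.
  apply: (@continuousM _ _ (fun u => 'D_(delta_mx 0 0) (omega c (delta_mx 0 1)) u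
   - 'D_(delta_mx 0 1) (omega c (delta_mx 0 0)) u) (fun u => (sig c u)^-1)).
    apply: (@continuousB _ _ _ ('D_(delta_mx 0 0) (omega c (delta_mx 0 1)))
       ('D_(delta_mx 0 1) (omega c (delta_mx 0 0)))).
      exact: (co _ u uc).2.
    exact: (co _ u uc).2.
  apply: (@continuousV _ _ (sig c)); first by rewrite gt_eqF // (area_density_gt0 Ac uc).
  exact: (area_density_continuous Ac uc).
apply: near_eq_continuous cq.
have := near_open (oc Ac) uc; apply: filterS => w wc; rewrite /= -(exact_densityE Ac wc).
by apply: mulfK; rewrite gt_eqF // (area_density_gt0 Ac wc).
Qed.

Lemma flux_continuous : continuous flux.
Proof.
apply: (continuous_chartwise hSigma) => c Ac u uc.
suff cf : C1 (chart_dom c) (flux \o c) by exact: C1_continuous cf uc.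
have r0 u := rad0 (c u); have w0 u := width0 (c u).
apply: (C1_eq (oc Ac) (g := fun u => schw m ((F \o c) u) (mean_curvature m (F \o c) u) ((L \o c) u)
   * schw m ((F \o c) u) ((Lb \o c) u) partial_t)).
  move=> v vc; apply: (congr1 (fun X => schw m (F (c v)) X (L (c v)) * _)); exact/esym/(hH Ac vc).
apply: (C1_mul (oc Ac)).
  apply: (C1_mean_curvature (oc Ac) (sF Ac) (sL Ac) r0 w0 (Gunit Ac)).
  by move=> q a qc; exact: Lf.
apply: (C1_schw (oc Ac) (sF Ac) r0 w0 (Y := fun=> partial_t)).
  exact: (C1_vector_smooth (oc Ac) (sLb Ac)).
by move=> i; exact: (C1_const (oc Ac)).
Qed.

(** The frame enters through [\det M] only, the inverse of the area density. *)
Lemma solid_continuous : continuous solid.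
Proof.
apply: (continuous_chartwise hSigma) => c Ac u uc.
suff cf : C1 (chart_dom c) (solid \o c) by exact: C1_continuous cf uc.
have cF := C1_vector_smooth (oc Ac) (sF Ac).
have r0 u := rad0 (c u).
apply: (C1_eq (oc Ac) (g := fun u => (sig c u)^-1 *
   (triple (space ((F \o c) u)) (space (pd 0 (F \o c) u)) (space (pd 1 (F \o c) u))
     * (rad ((F \o c) u) ^+ 3)^-1))).
  move=> v vc; have [M [M0 eM _ _ Ms]] := frame_exists Ac vc.
  rewrite /solid /= /solid_angle det_triple !eM !sum2.
  have -> : (sig c v)^-1 = \det M.
    have s0 := lt0r_neq0 (area_density_gt0 Ac vc).
    by apply: (mulIf s0); rewrite Ms; exact: mulVf.
  move: (pd 0 _ _) (pd 1 _ _) => X Y.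
  rewrite !linE !(tripleDm, tripleZm, tripleDr, tripleZr) det22 /triple; ring.
apply: (C1_mul (oc Ac)).
  apply: (C1_inv (oc Ac)); first exact: (C1_area_density Ac).
  by move=> v vc; rewrite gt_eqF // (area_density_gt0 Ac vc).
apply: (C1_mul (oc Ac)).
  apply: (C1_triple (oc Ac) cF); apply: (C1_vector_smooth (oc Ac));
  exact: (smooth_derive _ (sF Ac)).
apply: (C1_inv (oc Ac)); first by apply: (C1_exp (oc Ac)); exact: (C1_rad (oc Ac) (sF Ac) r0).
by move=> v _; rewrite expf_neq0 // gt_eqF // r0.
Qed.

Variable mu : {measure set (borel Sigma) -> \bar R}.
Hypothesis hmu : is_area_measure m A F mu.

Lemma integral_exact_density : \int[mu]_(p in [set: borel Sigma]) exact_density p = 0.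
Proof.
apply: (@stokes R Sigma A hSigma sig area_density_gt0 area_density_continuous mu hmu omega).
- by move=> c Ac v; exact: (C1_potential (oc Ac) (sF Ac) (fun u => rad0 (c u))
    (fun u => width0 (c u)) (sL Ac) (sLb Ac) v).
- by move=> c Ac u uc v; exact: (potential_linear (Lb \o c) (sF Ac) (sL Ac)
    (fun u => rad0 (c u)) (fun u => width0 (c u)) v uc).
- by move=> c d tau u v Ac Ad T uc ud; exact: (potential_transition v Ac Ad T uc ud).
- by move=> c d tau u Ac Ad T uc ud; exact: (area_density_transition Ac Ad T uc ud).
- exact: exact_density_continuous.
- by move=> c Ac u uc; exact: exact_densityE.
Qed.

Lemma integral_curvature_flux :
  \int[mu]_(p in [set: borel Sigma]) curvature_flux p
  = 2 * \int[mu]_(p in [set: borel Sigma]) flux p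
    + 4 * m * \int[mu]_(p in [set: borel Sigma]) solid p.
Proof.
have ints (h : Sigma -> R) (ch : continuous h) :=
  surface_integrable hSigma area_density_continuous hmu ch.
have intZ k (h : Sigma -> R) : continuous h -> continuous (fun p => k * h p).
  by move=> ch p; apply: (@continuousM _ _ (fun=> k) h); [exact: cst_continuous|exact: ch].
have cK := exact_density_continuous.
have c1 := intZ 2 _ cK; have c2 := intZ 2 _ flux_continuous.
have c3 := intZ (4 * m) _ solid_continuous.
have c12 : continuous (fun p => 2 * exact_density p + 2 * flux p).
  by move=> p; apply: (@continuousD _ _ _ (fun p => 2 * exact_density p)); [exact: c1|exact: c2].
rewrite -[RHS]add0r -[in RHS](mulr0 2) -integral_exact_density addrA.
rewrite -(RintegralZl _ measurableT (ints _ cK)) -(RintegralZl _ measurableT (ints _ flux_continuous)).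
rewrite -(RintegralZl _ measurableT (ints _ solid_continuous)).
rewrite -(RintegralD measurableT (ints _ c1) (ints _ c2)).
rewrite -(RintegralD measurableT (ints _ c12) (ints _ c3)).
by apply: eq_Rintegral => p _; rewrite /exact_density; field.
Qed.

End Minkowski.

Theorem theoremF (R : realType) (m : R) (hm : 0 <= m)
  (Sigma : ptopologicalType) (A : set (@chart R Sigma))
  (hSigma : closed_oriented_surface A)
  (F : Sigma -> 'rV[R]_4) (hF : spacelike_immersion m A F)
  (L Lb : Sigma -> 'rV[R]_4) (hL : null_normals m A F L Lb)
  (H : Sigma -> 'rV[R]_4) (hH : is_mean_curvature m A F H)
  (S : Sigma -> R) (hS : is_scalar_curvature m A F S)
  (dz : Sigma -> 'rV[R]_4 -> 'rV[R]_4 -> R) (hdz : is_dzeta m A F L Lb dz)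
  (e : Sigma -> 'I_2 -> 'rV[R]_4) (he : oriented_frame m A F e)
  (mu : {measure set (borel Sigma) -> \bar R})
  (hmu : is_area_measure m A F mu)
  (hdeg : 0 < m -> homologous_to_sphere F e mu) :
  2 * (\int[mu]_(p in [set: Sigma])
         (schw m (F p) (H p) (L p) * schw m (F p) (Lb p) partial_t))
  = - 16 * pi * m
    + \int[mu]_(p in [set: Sigma])
        ((S p + 4^-1 * Rbar m (F p) (L p) (Lb p) (L p) (Lb p))
           * Qform (F p) (L p) (Lb p)
         + \sum_(b < 2) \sum_(c < 2)
             (2^-1 * Rbar m (F p) (e p b) (e p c) (Lb p) (L p)
                - 2 * dz p (e p b) (e p c))
             * Qform (F p) (e p b) (e p c)).
Proof.
have E := integral_curvature_flux hm hSigma hF hL hH hS hdz he hmu.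
(* For m = 0, where no degree is prescribed, both sides vanish. *)
have sphere : m * \int[mu]_(p in [set: borel Sigma]) solid F e p = m * (4 * pi).
  have [->|m0] := eqVneq m 0; first by rewrite !mul0r.
  have /hdeg : 0 < m by rewrite lt0r m0.
  rewrite /homologous_to_sphere -/(solid F e) => E1; congr (_ * _).
  have p0 : 4 * pi != 0 :> R by rewrite mulf_neq0 ?pnatr_eq0 // gt_eqF // pi_gt0.
  by apply: (mulfI (invr_neq0 p0)); rewrite mulVf.
rewrite -/(flux m F L Lb H) -/(curvature_flux m F L Lb S dz e).
move: E; rewrite -mulrA sphere.
move: (Rintegral _ _ _) (Rintegral _ _ _) pi => a b p; clear; move=> ->; ring.
Qed.
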